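(* Suppose $\boldsymbol u_h\in\boldsymbol V^h$ satisfies $$\int_{\Omega_h}(\nabla\cdot\boldsymbol u_h)\,q=0\qquad\forall q\in Q^h.$$ Then $\nabla\cdot\boldsymbol u_h\equiv 0$ in $\Omega_h$.
   Context: Mesh. $\Omega\subset\mathbb R^2$ is a sufficiently smooth domain (boundary given by finitely many local charts). $\tilde{\mathcal T}_h$ is a member of a shape-regular family of affine (straight-sided) triangulations with mesh size $h=\max_{\tilde T}\mathrm{diam}(\tilde T)$ sufficiently small, whose boundary vertices lie on $\partial\Omega$, each triangle having at most two boundary vertices; $\tilde\Omega_h=\mathrm{int}\big(\bigcup_{\tilde T\in\tilde{\mathcal T}_h}\overline{\tilde T}\big)$ is an $O(h^2)$ polygonal approximation of $\Omega$. $G:\tilde\Omega_h\to\Omega$ is a bijection with $\|G\|_{W^{1,\infty}(\tilde\Omega_h)}\le C$, $G(x)=x$ at all vertices, and $G$ the identity on every triangle with three interior vertices. $G_h$ is the piecewise quadratic nodal (vertices and edge midpoints) interpolant of $G$, with $\|DG_h\|_{W^{1,\infty}(\tilde T)}\le C$ and $\|DG_h^{-1}\|_{W^{1,\infty}(\tilde T)}\le C$ for all $\tilde T$. $\mathcal T_h=\{G_h(\tilde T):\tilde T\in\tilde{\mathcal T}_h\}$ is the isoparametric mesh and $\Omega_h=\mathrm{int}\big(\bigcup_{T\in\mathcal T_h}\overline T\big)$. $\hat T$ is the reference triangle with vertices $(1,0),(0,1),(0,0)$; for $T=G_h(\tilde T)$, $F_{\tilde T}:\hat T\to\tilde T$ is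 an affine bijection with $|F_{\tilde T}|_{W^{1,\infty}(\hat T)}\le Ch_T$, $|F_{\tilde T}^{-1}|_{W^{1,\infty}(\tilde T)}\le Ch_T^{-1}$, $F_T=G_h\circ F_{\tilde T}:\hat T\to T$, $h_T=\mathrm{diam}(\tilde T)$, and $|F_T|_{W^{m,\infty}(\hat T)}\le Ch_T^m$ ($0\le m\le2$), $|F_T^{-1}|_{W^{m,\infty}(T)}\le Ch_T^{-m}$ ($0\le m\le 3$), $c_1h_T^2\le\det(DF_T)\le c_2h_T^2$. Interior edges of $\mathcal T_h$ are straight and are edges of $\tilde{\mathcal T}_h$; if $e=F_T(\hat e)$ is a straight edge then $F_T|_{\hat e}$ is affine; if all edges of $T$ are straight then $F_T$ is affine and $T=\tilde T$. All constants are independent of the mesh size. Local spaces. $\hat T^{ct}$ is the Clough–Tocher split of $\hat T$ into three triangles obtained by joining the vertices to the barycenter; $\hat{\boldsymbol V}=\{\hat{\boldsymbol v}\in [H^1(\hat T)]^2:\hat{\boldsymbol v}|_{\hat K}\in[\mathcal P_2(\hat K)]^2\ \forall\hat K\in\hat T^{ct}\}$, $\hat Q=\{\hat q\in L^2(\hat T):\hat q|_{\hat K}\in\mathcal P_1(\hat K)\ \forall\hat K\in\hat T^{ct}\}$ ($\mathcal P_k$: polynomials of degree $\le k$). With $A_T=DF_T/\det(DF_T)$, $x=F_T(\hat x)$, $\tilde x=F_{\tilde T}(\hat x)$: $\tilde{\boldsymbol V}(\tilde T)=\{\tilde{\boldsymbol v}:\tilde{\boldsymbol v}(\tilde x)=\hat{\boldsymbol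 v}(\hat x),\ \hat{\boldsymbol v}\in\hat{\boldsymbol V}\}$, $\tilde Q(\tilde T)=\{\tilde q:\tilde q(\tilde x)=\hat q(\hat x),\ \hat q\in\hat Q\}$, $\boldsymbol V(T)=\{\boldsymbol v:\boldsymbol v(x)=A_T(\hat x)\hat{\boldsymbol v}(\hat x),\ \hat{\boldsymbol v}\in\hat{\boldsymbol V}\}$, $Q(T)=\{q: q(x)=\hat q(\hat x),\ \hat q\in\hat Q\}$. $\mathcal N_{\hat T}$ is the set of the 4 vertices and 6 edge midpoints of $\hat T^{ct}$, $\mathcal N_T=F_T(\mathcal N_{\hat T})$, $\mathcal N_{\tilde T}=F_{\tilde T}(\mathcal N_{\hat T})$. Global spaces. $\tilde{\boldsymbol V}^h=\{\tilde{\boldsymbol v}\in[H^1_0(\tilde\Omega_h)]^2:\tilde{\boldsymbol v}|_{\tilde T}\in\tilde{\boldsymbol V}(\tilde T)\ \forall\tilde T\}$, $\tilde Q^h=\{\tilde q\in L^2_0(\tilde\Omega_h):\tilde q|_{\tilde T}\in\tilde Q(\tilde T)\ \forall\tilde T\}$ ($L^2_0$: zero mean). $\Psi$ is defined elementwise by: $(\Psi\tilde{\boldsymbol v})|_T\in\boldsymbol V(T)$ is the unique function with $(\Psi\tilde{\boldsymbol v})|_T(a)=\tilde{\boldsymbol v}|_{\tilde T}(\tilde a)$ for all $\tilde a\in\mathcal N_{\tilde T}$, $a=G_h(\tilde a)$; $\Upsilon$ by $(\Upsilon\tilde q)|_T(F_T(\hat x))=\tilde q|_{\tilde T}(F_{\tilde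 T}(\hat x))$. $\boldsymbol V^h=\Psi(\tilde{\boldsymbol V}^h)$ (a subspace of $\boldsymbol H_0(\mathrm{div};\Omega_h)$) and $Q^h=\Upsilon(\tilde Q^h)$. *)

(* Defs.v *)
From HB Require Import structures.
From mathcomp Require Import all_boot all_order all_algebra.
From mathcomp Require Import all_classical all_reals all_analysis.
Set Implicit Arguments.
Unset Strict Implicit.
Unset Printing Implicit Defensive.
Import Order.TTheory GRing.Theory Num.Theory.
Import numFieldNormedType.Exports.
Local Open Scope classical_set_scope.
Local Open Scope ring_scope.

Section Plane.
Variable R : realType.
Implicit Types (x y p q : R * R) (D : set (R * R)).

Definition mu2 := ((@lebesgue_measure R) \x (@lebesgue_measure R))%E.

(* The library norm of [R * R] is the maximum norm. *)
Definition edist x y : R :=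
  Num.sqrt ((x.1 - y.1) ^+ 2 + (x.2 - y.2) ^+ 2).

Definition diam D : R := sup [set edist x y | x in D & y in D].

Definition bdry D : set (R * R) := closure D `\` D°.

Definition seg p q : set (R * R) :=
  [set x | exists t : R, 0 <= t <= 1 /\ x = (1 - t) *: p + t *: q].

Definition hull (v : 'I_3 -> R * R) : set (R * R) :=
  [set x | exists l : 'I_3 -> R,
     [/\ forall a, 0 <= l a, \sum_a l a = 1 & x = \sum_a l a *: v a]].

Definition comp (i : 'I_2) (f : R * R -> R * R) (x : R * R) : R :=
  if val i is 0%N then (f x).1 else (f x).2.

Definition dirv (j : 'I_2) : R * R := if val j is 0%N then (1, 0) else (0, 1).

Definition partial (j : 'I_2) (f : R * R -> R) (x : R * R) : R :=
  'D_(dirv j) f x.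

Definition Jac (f : R * R -> R * R) (x : R * R) : 'M[R]_2 :=
  \matrix_(i, j) partial j (comp i f) x.

Definition mxapp (A : 'M[R]_2) (x : R * R) : R * R :=
  (A ord0 ord0 * x.1 + A ord0 ord_max * x.2,
   A ord_max ord0 * x.1 + A ord_max ord_max * x.2).

Definition poly_le (k : nat) (f : R * R -> R) : Prop :=
  exists c : nat -> nat -> R, forall x,
    f x = \sum_(i < k.+1) \sum_(j < (k - i).+1) c i j * x.1 ^+ i * x.2 ^+ j.

End Plane.

Section Sobolev.
Variable R : realType.
Implicit Types (D : set (R * R)) (f g : R * R -> R) (phi : R * R -> R).

Definition in_L2 D f : Prop :=
  measurable_fun D f /\ (\int[@mu2 R]_(x in D) ((f x) ^+ 2)%:E < +oo)%E.

(* Weak derivatives are tested against C^1 functions with compact support in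
   the open set D (the convention of Gilbarg and Trudinger); mollification
   gives the same notion as infinitely differentiable test functions. *)
Definition C1c D phi : Prop :=
  [/\ forall x, differentiable phi x,
      forall j, continuous (partial j phi),
      compact (closure [set x | phi x != 0]) &
      closure [set x | phi x != 0] `<=` D].

Definition weak_partial D (j : 'I_2) f g : Prop :=
  forall phi, C1c D phi ->
    \int[@mu2 R]_(x in D) (f x * partial j phi x) =
    - \int[@mu2 R]_(x in D) (g x * phi x).

Definition in_H1 D f : Prop :=
  in_L2 D f /\ forall j, exists2 g, in_L2 D g & weak_partial D j f g.

(* Closure in H^1(D) of the compactly supported functions. *)
Definition in_H10 D f : Prop :=
  exists g : 'I_2 -> R * R -> R,
    [/\ in_L2 D f,
        forall j, in_L2 D (g j) /\ weak_partial D j f (g j) &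
        forall eps : R, 0 < eps -> exists2 phi, C1c D phi &
          (\int[@mu2 R]_(x in D)
             ((f x - phi x) ^+ 2
              + \sum_j (g j x - partial j phi x) ^+ 2)%:E < eps%:E)%E].

(* u belongs to H(div; D) and g represents its divergence. *)
Definition Hdiv_with D (u : R * R -> R * R) g : Prop :=
  [/\ forall j, in_L2 D (comp j u), in_L2 D g &
      forall phi, C1c D phi ->
        \int[@mu2 R]_(x in D) (\sum_j comp j u x * partial j phi x) =
        - \int[@mu2 R]_(x in D) (g x * phi x)].

(* |f|_{W^{m,oo}(D)} <= M *)
Fixpoint Winf_semi_le (m : nat) D f (M : R) : Prop :=
  if m is m'.+1 then
    forall j, exists2 g, weak_partial D j f g & Winf_semi_le m' D g M
  else measurable_fun D f /\ {ae @mu2 R, forall x, D x -> `|f x| <= M}.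

Definition Winf_norm_le (k : nat) D f (M : R) : Prop :=
  forall m, (m <= k)%N -> Winf_semi_le m D f M.

End Sobolev.

Section SmoothDomain.
Variable R : realType.

Definition Ck (k : nat) (f : R -> R) : Prop :=
  (forall n, (n < k)%N -> forall t, derivable (derive1n n f) t 1) /\
  continuous (derive1n k f).

Record chart := Chart {
  ctr : R * R; dir : R * R; rad : R; hgt : R; graph_fun : R -> R }.

(* Coordinates in the positively oriented orthonormal frame with origin
   [ctr c] and first axis [dir c]. *)
Definition loc (c : chart) (x : R * R) : R * R :=
  let y := x - ctr c in
  ((dir c).1 * y.1 + (dir c).2 * y.2, (dir c).1 * y.2 - (dir c).2 * y.1).

Definition box (c : chart) : set (R * R) :=
  [set x | `|(loc c x).1| < rad c /\ `|(loc c x).2| < hgt c].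

Definition is_chart (k : nat) (Om : set (R * R)) (c : chart) : Prop :=
  [/\ (dir c).1 ^+ 2 + (dir c).2 ^+ 2 = 1, 0 < rad c, 0 < hgt c,
      Ck k (graph_fun c) &
      forall x, box c x ->
        (Om x <-> graph_fun c (loc c x).1 < (loc c x).2) /\
        (bdry Om x <-> (loc c x).2 = graph_fun c (loc c x).1)].

Definition smooth_domain (k : nat) (Om : set (R * R)) : Prop :=
  [/\ open Om, connected Om, Om !=set0 &
      exists (n : nat) (cs : 'I_n -> chart),
        (forall i, is_chart k Om (cs i)) /\
        (forall x, bdry Om x -> exists i, box (cs i) x)].

End SmoothDomain.

Section Reference.
Variable R : realType.

Definition rv (a : 'I_3) : R * R :=
  match val a with 0%N => (1, 0) | 1%N => (0, 1) | _ => (0, 0) end.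

Definition That : set (R * R) := hull rv.

Definition bary : R * R := 3^-1 *: \sum_a rv a.

Definition Khat (k : 'I_3) : set (R * R) :=
  hull (fun a => if a == k then bary else rv a).

Definition ct_vertex (x : R * R) : Prop := x = bary \/ exists a, x = rv a.

(* Any two of the four vertices of the split span an edge; the case x = y
   gives the vertices themselves. *)
Definition Nhat : set (R * R) :=
  [set z | exists x y, [/\ ct_vertex x, ct_vertex y & z = 2^-1 *: (x + y)]].

(* Polynomial on each closed subtriangle: elements are given by their
   continuous representatives, as required by nodal values. *)
Definition Vhat : set (R * R -> R * R) :=
  [set v | (forall j, in_H1 That° (comp j v)) /\
     forall (k : 'I_3) (j : 'I_2), exists2 p, poly_le 2 p &
       forall x, Khat k x -> comp j v x = p x].

Definition Qhat : set (R * R -> R) :=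
  [set q | in_L2 That° q /\
     forall k : 'I_3, exists2 p, poly_le 1 p &
       forall x, (Khat k)° x -> q x = p x].

(* The affine map sending [rv a] to [v a]. *)
Definition Faff (v : 'I_3 -> R * R) (x : R * R) : R * R :=
  \sum_a (match val a with
          | 0%N => x.1 | 1%N => x.2 | _ => 1 - x.1 - x.2 end) *: v a.

Definition piola (F : R * R -> R * R) (x : R * R) : 'M[R]_2 :=
  (\det (Jac F x))^-1 *: Jac F x.

Definition Vtri (v : 'I_3 -> R * R) : set (R * R -> R * R) :=
  [set w | exists2 wh, Vhat wh & forall x, That x -> w (Faff v x) = wh x].

Definition Qtri (v : 'I_3 -> R * R) : set (R * R -> R) :=
  [set q | exists2 qh, Qhat qh & forall x, That° x -> q (Faff v x) = qh x].

Definition Viso (F : R * R -> R * R) : set (R * R -> R * R) :=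
  [set w | exists2 wh, Vhat wh &
     forall x, That x -> w (F x) = mxapp (piola F x) (wh x)].

End Reference.

Section Mesh.
Variables (R : realType) (I : finType).
(* [vtx i a], a : 'I_3, are the vertices of the straight triangle i. *)
Variable vtx : I -> 'I_3 -> R * R.

Definition Ttil (i : I) : set (R * R) := hull (vtx i).
Definition Ftil (i : I) : R * R -> R * R := Faff (vtx i).
Definition hT (i : I) : R := diam (Ttil i).
Definition hmesh : R := \big[Num.max/0]_i hT i.
Definition Omtil : set (R * R) := (\bigcup_i Ttil i)°.

Definition conforming : Prop :=
  forall i j : I, i != j ->
    [\/ Ttil i `&` Ttil j = set0,
        exists a b, vtx i a = vtx j b /\ Ttil i `&` Ttil j = [set vtx i a] |
        exists a a' b b',
          [/\ a != a', b != b', vtx i a = vtx j b, vtx i a' = vtx j b' &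
              Ttil i `&` Ttil j = seg (vtx i a) (vtx i a')]].

(* The piecewise quadratic map is given by one quadratic polynomial map of the
   plane per triangle, so that its derivative makes sense up to the boundary
   of the triangle: on [Ttil i] it is [Gh i]. *)
Variable Gh : I -> R * R -> R * R.

Definition Fiso (i : I) : R * R -> R * R := Gh i \o Ftil i.
Definition Tiso (i : I) : set (R * R) := Fiso i @` @That R.
Definition Omh : set (R * R) := (\bigcup_i Tiso i)°.

Definition nodal_interpolant (G : R * R -> R * R) : Prop :=
  forall i : I,
    (forall j : 'I_2, poly_le 2 (comp j (Gh i))) /\
    (forall a b : 'I_3, let m := 2^-1 *: (vtx i a + vtx i b) in
       Gh i m = G m).

Definition straight_edge (i : I) (a b : 'I_3) : Prop :=
  exists p q, Fiso i @` seg (rv R a) (rv R b) = seg p q.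

Definition Vtil : set (R * R -> R * R) :=
  [set v | (forall j, in_H10 Omtil (comp j v)) /\
           forall i, Vtri (vtx i) v].

Definition Qtil : set (R * R -> R) :=
  [set q | [/\ in_L2 Omtil q, \int[@mu2 R]_(x in Omtil) q x = 0 &
               forall i, Qtri (vtx i) q]].

(* u = Psi v; the value of u on the null set of element boundaries, where it
   need not be continuous, is left free. *)
Definition is_Psi (v u : R * R -> R * R) : Prop :=
  (forall j, measurable_fun Omh (comp j u)) /\
  forall i : I, exists2 w, Viso (Fiso i) w &
    (forall a, @Nhat R a -> w (Fiso i a) = v (Ftil i a)) /\
    (forall x, (Tiso i)° x -> u x = w x).

(* p = Upsilon q, with the same convention. *)
Definition is_Upsilon (q p : R * R -> R) : Prop :=
  measurable_fun Omh p /\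
  forall (i : I) x, (@That R)° x -> p (Fiso i x) = q (Ftil i x).

Definition Vh : set (R * R -> R * R) :=
  [set u | exists2 v, Vtil v & is_Psi v u].

Definition Qh : set (R * R -> R) :=
  [set p | exists2 q, Qtil q & is_Upsilon q p].

Record isoparametric_mesh (Om : set (R * R)) (C c1 c2 sigma : R)
    (G : R * R -> R * R) : Prop := {
  im_const : [/\ 0 < C, 0 < c1, 0 < c2 & 0 < sigma];
  im_conforming : conforming;
  im_shape_regular : forall i, exists x,
    [set y | edist x y <= hT i / sigma] `<=` Ttil i;
  im_bdry_vertex : forall i a, bdry Omtil (vtx i a) -> bdry Om (vtx i a);
  im_two_bdry_vertices : forall i, ~ (forall a, bdry Omtil (vtx i a));
  im_approx :
    (forall x, bdry Omtil x ->
       exists2 y, bdry Om y & edist x y <= C * hmesh ^+ 2) /\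
    (forall y, bdry Om y ->
       exists2 x, bdry Omtil x & edist x y <= C * hmesh ^+ 2);
  im_G_bij : set_bij Omtil Om G;
  im_G_W1inf : forall j, Winf_norm_le 1 Omtil (comp j G) C;
  (* the continuous extension of the Lipschitz map G to boundary nodes *)
  im_G_cont : {within closure Omtil, continuous G};
  im_G_vertex : forall i a, G (vtx i a) = vtx i a;
  im_G_id : forall i, (forall a, Omtil (vtx i a)) ->
    forall x, Ttil i x -> G x = x;
  im_interpolant : nodal_interpolant G;
  im_DGh : forall i (a b : 'I_2),
    Winf_norm_le 1 (Ttil i)° (fun x => Jac (Gh i) x a b) C;
  im_DGh_inv : forall i,
    (forall x, Ttil i x -> Jac (Gh i) x \in unitmx) /\
    forall a b : 'I_2,
      Winf_norm_le 1 (Ttil i)° (fun x => invmx (Jac (Gh i) x) a b) C;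
  im_Ftil : forall i (j : 'I_2),
    Winf_semi_le 1 (@That R)° (comp j (Ftil i)) (C * hT i);
  im_Ftil_inv : forall i, exists2 F',
    (forall x, @That R x -> F' (Ftil i x) = x) &
    forall j : 'I_2, Winf_semi_le 1 (Ttil i)° (comp j F') (C / hT i);
  im_Fiso : forall i (j : 'I_2) (m : nat), (m <= 2)%N ->
    Winf_semi_le m (@That R)° (comp j (Fiso i)) (C * hT i ^+ m);
  im_Fiso_inv : forall i, exists2 F',
    (forall x, @That R x -> F' (Fiso i x) = x) &
    forall (j : 'I_2) (m : nat), (m <= 3)%N ->
      Winf_semi_le m (Tiso i)° (comp j F') (C / hT i ^+ m);
  im_det : forall i x, @That R x ->
    c1 * hT i ^+ 2 <= \det (Jac (Fiso i) x) <= c2 * hT i ^+ 2;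
  (* the curved triangles form a mesh: distinct ones do not overlap *)
  im_disjoint : forall i j, i != j -> (Tiso i)° `&` (Tiso j)° = set0;
  im_interior_edge : forall i j a a' b b',
    i != j -> a != a' -> vtx i a = vtx j b -> vtx i a' = vtx j b' ->
    Gh i @` seg (vtx i a) (vtx i a') = seg (vtx i a) (vtx i a');
  im_straight_affine : forall i a b, a != b -> straight_edge i a b ->
    forall t : R, 0 <= t <= 1 ->
      Fiso i ((1 - t) *: rv R a + t *: rv R b) =
      (1 - t) *: Fiso i (rv R a) + t *: Fiso i (rv R b);
  im_all_straight : forall i, (forall a b, a != b -> straight_edge i a b) ->
    (forall j : 'I_2, poly_le 1 (comp j (Fiso i))) /\ Tiso i = Ttil i
}.

End Mesh.

(* Main.v *)
Require Import Defs.
From HB Require Import structures.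
From mathcomp Require Import all_boot all_order all_algebra.
From mathcomp Require Import all_classical all_reals all_analysis.
From mathcomp Require Import measurable_realfun ring lra.
Set Implicit Arguments.
Unset Strict Implicit.
Unset Printing Implicit Defensive.
Import Order.TTheory GRing.Theory Num.Theory.
Import numFieldNormedType.Exports.
Local Open Scope classical_set_scope.
Local Open Scope ring_scope.

(* On F_i(K), K an open subtriangle of the Clough-Tocher split, the Piola transform
   gives div u = J^-1 (d o F_i^-1) with d = div \hat w affine and J = det DF_i > 0.
   The function p equal to d o F_i^-1 on each F_i(K) belongs to Q^h up to an additive
   constant c. Since u also satisfies |u(x)| <= C |x - z| for every z outside Omega_h,
   cutting off near the boundary gives int div u = 0; hence
   0 = int (div u) (p - c) = int J^-1 p^2, where no change of variables is needed,
   and p = 0 almost everywhere.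

   The bound on u holds because the nodal values of v vanish on every edge belonging
   to one triangle only (the trace of an H^1_0 function), so that u is dominated by a
   Lipschitz, single-valued majorant vanishing on the boundary of Omega_h; following a
   segment from x until it first leaves Omega_h compares its values with |x - z|. *)

(** * Lebesgue measure on the plane and test functions *)

(** The pressure space has zero mean over the straight domain, while the divergence lives on the
    curved one: the constant [c] is a mean over the former, and int div u = 0 is what discards it.
    As u need not be continuous across edges, this mean cannot be obtained from H^1_0 membership of
    its components; only the distributional definition of div u is tested. A cutoff with gradient
    O(1/e) in a layer of width O(e) pairs boundedly with a field that is O(e) there, so the
    pointwise limit 0 passes under the integral and the area of the layer is never estimated. On
    each piece the second derivatives of F cancel (Piola identity), which leaves an affine numerator
    d over J; d is itself an admissible pressure, and d^2 / J has a sign. Quadratic maps keep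
    inversion elementary: F x - F y = DF(m)(x - y) holds exactly at the midpoint m, and convexity of
    the reference triangle keeps m where the determinant is bounded below. *)

Section MuIsMeasure.
Variable R : realType.
Let mu : {sigma_finite_measure set (measurableTypeR R) -> \bar R} := @lebesgue_measure R.
Let mumu : measure (measurableTypeR R * measurableTypeR R)%type R := (mu \x mu)%E.
(** [mu2] is a constant standing for a product measure; the measure structure is attached to the
    constant itself so that integration theory applies to it. *)
HB.instance Definition _ := isMeasure.Build _ _ _ (@mu2 R) (measure0 mumu)
  (measure_ge0 mumu) (@measure_semi_sigma_additive _ _ _ mumu).
End MuIsMeasure.

Section PlaneMeasure.
Variable R : realType.
Implicit Types (D : set (R * R)) (x y : R * R).

Lemma open_ballP D x :
  open D -> D x -> exists2 e : R, 0 < e & forall y, `|x - y| < e -> D y.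
Proof.
move=> oD Dx; have /nbhs_ballP[e /= e0 he] := open_nbhs_nbhs (conj oD Dx).
by exists e => // y xy; apply: he; rewrite -ball_normE.
Qed.

Lemma openP D :
  (forall x, D x -> exists2 e : R, 0 < e & forall y, `|x - y| < e -> D y) ->
  open D.
Proof.
move=> h; rewrite openE => x /h[e e0 he]; apply/nbhs_ballP; exists e => //= y.
by rewrite -ball_normE; exact: he.
Qed.

Definition obox (q : R * R * (R * R)) : set (R * R) :=
  `]q.1.1, q.1.2[ `*` `]q.2.1, q.2.2[.
Definition cbox (q : R * R * (R * R)) : set (R * R) :=
  `[q.1.1, q.1.2] `*` `[q.2.1, q.2.2].

(** Rational end points make the family countable, which gives measurability of open sets. The
    condition bears on the closed box, so that test functions supported in that box are compactly
    supported in [D]. *)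
Lemma open_bigcup_obox D : open D -> exists Q : rat * rat * (rat * rat) -> _,
  D = \bigcup_(q in [set q | cbox (Q q) `<=` D]) obox (Q q).
Proof.
move=> oD; exists (fun q : rat * rat * (rat * rat) =>
  ((ratr q.1.1, ratr q.1.2), (ratr q.2.1, ratr q.2.2))).
apply/seteqP; split => [x Dx|x [q /= qD]]; last first.
  move=> -[/=]; rewrite !in_itv /= => /andP[? ?] /andP[? ?].
  by apply: qD; split; rewrite /= in_itv /= !ltW.
have [e e0 he] := open_ballP oD Dx.
have h (t : R) : exists q : rat * rat,
    [/\ t - e < ratr q.1, ratr q.1 < t, t < ratr q.2 & ratr q.2 < t + e].
  have [q1] : exists q, ratr q \in `](t - e), t[ by apply: rat_in_itvoo; lra.
  have [q2] : exists q, ratr q \in `]t, (t + e)[ by apply: rat_in_itvoo; lra.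
  by rewrite !in_itv /= => /andP[? ?] /andP[? ?]; exists (q1, q2).
have [q1 [a1 a2 a3 a4]] := h x.1; have [q2 [b1 b2 b3 b4]] := h x.2.
exists (q1, q2); last by split; rewrite /= in_itv /=; apply/andP.
move=> y [] /=; rewrite !in_itv /= => /andP[c1 c2] /andP[d1 d2].
by apply: he; rewrite prod_normE gt_max/= !ltr_distl; lra.
Qed.

Lemma measurable_obox q : measurable (obox q).
Proof. by apply: measurableX; exact: measurable_itv. Qed.

Lemma open_measurable2 D : open D -> measurable D.
Proof.
move=> /open_bigcup_obox[Q ->]; rewrite bigcup_mkcond.
apply: countable_bigcupT_measurable => // q.
by case: ifP => // _; exact: measurable_obox.
Qed.

Lemma closed_measurable2 D : closed D -> measurable D.
Proof. by move/closed_openC/open_measurable2/measurableC; rewrite setCK. Qed.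

Lemma open_continuous_measurable_fun2 D (f : R * R -> R) : open D ->
  (forall x, D x -> {for x, continuous f}) -> measurable_fun D f.
Proof.
move=> oD cf mD.
apply: (measurability _ (RGenOpens.measurableE R)) => //.
move=> _ [_ [a [b ->] <-]]; apply: open_measurable2.
rewrite openE => x [Dx fx]; apply: filterI; first exact: open_nbhs_nbhs.
apply: (cf x Dx); apply: open_nbhs_nbhs; split => //; exact: interval_open.
Qed.

Lemma continuous_measurable_fun2 (f : R * R -> R) :
  continuous f -> measurable_fun setT f.
Proof.
move=> cf; apply: open_continuous_measurable_fun2; first exact: openT.
by move=> x _; exact: cf.
Qed.

Lemma mu2_box_lty (a b c d : R) : (@mu2 R (cbox ((a, b), (c, d))) < +oo)%E.
Proof.
rewrite /mu2 /cbox product_measure1E /=; [|exact: measurable_itv..].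
by rewrite !lebesgue_measure_itv /=; case: ifP => _; case: ifP => _;
  rewrite ?mule0 ?mul0e ?ltry // -EFinB -EFinM ltry.
Qed.

Lemma mu2_bounded_lty D M : measurable D -> (forall x, D x -> `|x| <= M) ->
  (@mu2 R D < +oo)%E.
Proof.
move=> mD DM; apply: le_lt_trans (mu2_box_lty (- M) M (- M) M).
apply: le_measure; rewrite ?inE //.
  by apply: measurableX; exact: measurable_itv.
move=> x /DM; rewrite prod_normE ge_max => /andP[].
by rewrite !ler_norml => h1 h2; split; rewrite /= in_itv.
Qed.

End PlaneMeasure.

(** * Integrals of partial derivatives of functions with bounded support *)

Section DivergenceTheorem.
Variable R : realType.
Local Notation mu1 := (@lebesgue_measure R).

Lemma integral_deriv_bounded_support (F g : R -> R) (M : R) :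
  (forall x : R, is_derive x (1:R) F (g x)) -> continuous g ->
  (forall x, M < `|x| -> F x = 0) -> (forall x, M < `|x| -> g x = 0) ->
  (\int[mu1]_x (g x)%:E = 0)%E.
Proof.
move=> dF cg F0 g0; pose N := `|M| + 1.
have N0 : - N < N by rewrite /N; have := normr_ge0 M; lra.
have MN : M < N by rewrite /N; have := ler_norm M; lra.
have gE : (\int[mu1]_x (g x)%:E = \int[mu1]_(x in `[(- N)%R, N]) (g x)%:E)%E.
  rewrite [RHS]integral_mkcond; apply: eq_integral => x _.
  rewrite patchE; case: ifPn => // /negP xN; rewrite g0 // (lt_le_trans MN) //.
  rewrite leNgt; apply/negP => xN'; apply: xN; rewrite inE /= in_itv /=.
  by move: xN'; rewrite ltr_norml => /andP[/ltW -> /ltW ->].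
have cF : continuous F by move=> x; apply: differentiable_continuous; apply/derivable1_diffP; apply: ex_derive.
rewrite gE (@continuous_FTC2 _ g F) //.
- rewrite F0 ?F0 ?subee// ?normrN (lt_le_trans MN) ?ler_norm //.
- exact: continuous_subspaceT.
- split.
  + by move=> x _; exact: ex_derive.
  + by apply: cvg_at_right_filter; exact: cF.
  + by apply: cvg_at_left_filter; exact: cF.
- by move=> x _; rewrite derive1E derive_val.
Qed.

Lemma integrable_continuous_bounded_support (f : R * R -> R) (M : R) :
  continuous f -> (forall x, M < `|x| -> f x = 0) ->
  (@mu2 R).-integrable setT (EFin \o f).
Proof.
move=> cf f0; pose N := `|M|.
have cB : compact (cbox ((- N, N), (- N, N))).
  by apply: compact_setX; exact: segment_compact.
have B0 : cbox ((- N, N), (- N, N)) !=set0.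
  by exists 0; split; rewrite /= in_itv /= oppr_le0 /N normr_ge0.
have cfB g : continuous g -> {within cbox ((- N, N), (- N, N)), continuous (g : R * R -> R)}.
  by move=> cg; exact: continuous_subspaceT.
have [c _ fc] := compact_EVT_max B0 cB (cfB (fun x => `|f x|) (fun x => continuous_comp (cf x) (@norm_continuous _ _ (f x)))).
have f0B x : x \notin cbox ((- N, N), (- N, N)) -> f x = 0.
  move=> /negP xN; apply: f0; rewrite ltNge; apply/negP => xM; apply: xN.
  have xN : `|x| <= N by rewrite (le_trans xM) // ler_norm.
  rewrite inE; move: xN; rewrite prod_normE ge_max !ler_norml => /andP[? ?].
  by split; rewrite /= in_itv.
rewrite (_ : EFin \o f = (EFin \o f) \_ (cbox ((- N, N), (- N, N)))); last first.
  apply/funext => x; rewrite patchE; case: ifPn => //= /f0B ->//.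
have mB : measurable (cbox ((- N, N), (- N, N))).
  by apply: measurableX; exact: measurable_itv.
apply/integrable_restrict => //; rewrite setTI.
apply: measurable_bounded_integrable => //.
- exact: mu2_box_lty.
- apply: (@measurable_funS _ _ _ _ setT) => //.
  exact: continuous_measurable_fun2.
- exists `|f c|; split; first exact: num_real.
  by move=> x fx y yB; apply: le_trans (ltW fx); apply: fc; rewrite inE.
Qed.

Lemma open_norm_gt (M : R) : open [set x : R * R | M < `|x|].
Proof.
apply: openP => x /= Mx; exists (`|x| - M) => [|y xy]; first by rewrite subr_gt0.
have := ler_normD (x - y) y; rewrite subrK => h.
by rewrite /=; lra.
Qed.

Lemma is_derive_fst (f : R * R -> R) (x y d : R) (j : 'I_2) : val j = 0%N ->
  is_derive (x, y) (dirv R j) f d -> is_derive x (1:R) (fun t => f (t, y)) d.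
Proof.
move=> j0 [df dv].
have E : (fun h : R => h^-1 *: (f (h *: dirv R j + (x, y)) - f (x, y))) =
         (fun h : R => h^-1 *: (f (h *: 1 + x, y) - f (x, y))).
  apply/funext => h; congr (_ *: (f _ - _)).
  by rewrite /dirv j0 /=; congr pair; rewrite /= scaler0 add0r.
by split; [move: df; rewrite /derivable E|rewrite -dv /derive E].
Qed.

Lemma is_derive_snd (f : R * R -> R) (x y d : R) (j : 'I_2) : val j <> 0%N ->
  is_derive (x, y) (dirv R j) f d -> is_derive y (1:R) (fun t => f (x, t)) d.
Proof.
move=> j0 [df dv].
have E : (fun h : R => h^-1 *: (f (h *: dirv R j + (x, y)) - f (x, y))) =
         (fun h : R => h^-1 *: (f (x, h *: 1 + y) - f (x, y))).
  apply/funext => h; congr (_ *: (f _ - _)).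
  rewrite /dirv; case: (val j) j0 => //= _ _.
  by congr pair; rewrite /= scaler0 add0r.
by split; [move: df; rewrite /derivable E|rewrite -dv /derive E].
Qed.

Lemma continuous_fst_section (f : R * R -> R) y :
  continuous f -> continuous (fun t => f (t, y)).
Proof.
move=> cf t; apply: (@continuous_comp _ _ _ (fun t => (t, y)) f); last exact: cf.
by apply: (@cvg_pair _ _ _ _ (nbhs t) (nbhs y)); [exact: cvg_id|exact: cvg_cst].
Qed.

Lemma continuous_snd_section (f : R * R -> R) x :
  continuous f -> continuous (fun t => f (x, t)).
Proof.
move=> cf t; apply: (@continuous_comp _ _ _ (fun t => (x, t)) f); last exact: cf.
by apply: (@cvg_pair _ _ _ _ (nbhs x) (nbhs t)); [exact: cvg_cst|exact: cvg_id].
Qed.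

(** Fubini with direction [j] integrated first: each line integral vanishes by the fundamental
    theorem of calculus. All integrations by parts below derive from this boundary-free divergence
    theorem. *)
Lemma integral_partial_bounded_support (j : 'I_2) (f df : R * R -> R) (M : R) :
  (forall x, is_derive x (dirv R j) f (df x)) -> continuous df ->
  (forall x, M < `|x| -> f x = 0) ->
  \int[@mu2 R]_x df x = 0.
Proof.
move=> dF cdf f0.
have df0 x : M < `|x| -> df x = 0.
  move=> Mx; rewrite -(@derive_val _ _ _ _ _ _ _ (dF x)).
  rewrite (@near_eq_derive _ _ _ f (cst 0)) ?derive_cst //.
  by have := open_nbhs_nbhs (conj (@open_norm_gt M) Mx); apply: filterS => y; exact: f0.
have idf := integrable_continuous_bounded_support cdf df0.
rewrite /Rintegral /mu2.
case: (boolP (val j == 0%N)) => [/eqP j0|/eqP j0].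
  rewrite -(@fubini2 _ _ _ _ _ mu1 mu1 _ idf)/= [X in fine X](_ : _ = 0%E) //.
  apply: integral0_eq => y _.
  apply: (@integral_deriv_bounded_support (fun x => f (x, y)) _ M).
  - by move=> x; exact: (is_derive_fst j0).
  - exact: continuous_fst_section.
  - by move=> x Mx; apply: f0; rewrite prod_normE lt_max Mx.
  - by move=> x Mx; apply: df0; rewrite prod_normE lt_max Mx.
rewrite -(@fubini1 _ _ _ _ _ mu1 mu1 _ idf)/= [X in fine X](_ : _ = 0%E) //.
apply: integral0_eq => x _.
apply: (@integral_deriv_bounded_support (fun y => f (x, y)) _ M).
- by move=> y; exact: (is_derive_snd j0).
- exact: continuous_snd_section.
- by move=> y My; apply: f0; rewrite prod_normE lt_max My orbT.
- by move=> y My; apply: df0; rewrite prod_normE lt_max My orbT.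
Qed.
End DivergenceTheorem.

(** * Frechet derivatives represented by gradient vectors *)

Section Gradient.
Variable R : realType.
Implicit Types (f : R * R -> R) (x g : R * R).

Definition lin2 g (h : R * R) : R := g.1 * h.1 + g.2 * h.2.
(** Full differentiability rather than existence of partial derivatives, so that the chain rule is
    available for compositions with inverse maps. *)
Definition has_grad f x g := is_diff x f (lin2 g).
Definition gcomp (j : 'I_2) g : R := if val j is 0%N then g.1 else g.2.

Lemma lin2_is_linear g : linear (lin2 g).
Proof. by move=> k u v; rewrite /lin2 /= /GRing.scale /=; ring. Qed.

HB.instance Definition _ g :=
  GRing.isLinear.Build R (R * R)%type R _ (lin2 g) (lin2_is_linear g).

Lemma continuous_lin2 g : continuous (lin2 g).
Proof.
move=> x; apply: (@continuousD _ _ _ (fun x => g.1 * x.1) (fun x => g.2 * x.2));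
  apply: (@continuousM _ _ (cst _)); try exact: cvg_cst.
- exact: cvg_fst.
- exact: cvg_snd.
Qed.

Lemma lin2_dirv g (j : 'I_2) : lin2 g (dirv R j) = gcomp j g.
Proof.
by rewrite /lin2 /gcomp /dirv; case: (val j) => [|n] /=;
  rewrite !(mulr1, mulr0) ?addr0 ?add0r.
Qed.

Lemma has_grad_is_derive f x g j :
  has_grad f x g -> is_derive x (dirv R j) f (gcomp j g).
Proof.
move=> [df dv]; split; first exact: diff_derivable.
by rewrite deriveE // dv lin2_dirv.
Qed.

Lemma has_grad_partial f x g j : has_grad f x g -> partial j f x = gcomp j g.
Proof. by move=> /(has_grad_is_derive j)[_]. Qed.

Lemma has_grad_continuous f x g : has_grad f x g -> {for x, continuous f}.
Proof. by move=> [df _]; exact: differentiable_continuous. Qed.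

Lemma differentiable_has_grad f x : differentiable f x ->
  has_grad f x (partial ord0 f x, partial ord_max f x).
Proof.
move=> df; split => //; apply/funext => h; rewrite /lin2 /= /partial !deriveE //.
have {1}-> : h = h.1 *: dirv R ord0 + h.2 *: dirv R ord_max.
  rewrite /dirv /=; case: h => a b.
  by congr pair; rewrite /= /GRing.scale /= !(mulr1, mulr0) ?addr0 ?add0r.
by rewrite linearD !linearZ /= /GRing.scale /= mulrC [X in _ + X]mulrC.
Qed.

Lemma has_grad_eq f x g g' : has_grad f x g -> g = g' -> has_grad f x g'.
Proof. by move=> ? <-. Qed.

Lemma has_gradP f x g : has_grad f x g <->
  forall e, 0 < e -> exists2 d, 0 < d & forall h, `|h| < d ->
    `|f (h + x) - f x - lin2 g h| <= e * `|h|.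
Proof.
split=> [[df dv] e e0|H].
  have /diff_locally/eqaddoP/(_ e e0)/nbhs_ballP[d /= d0 hd] := df.
  exists d => // h hd'; have := hd h; rewrite -ball_normE /= sub0r normrN => /(_ hd').
  by rewrite /= !fctE dv opprD addrA.
have D : 'd f x = lin2 g :> (R * R -> R).
  apply: (@diff_unique _ _ _ f (lin2 g) x (@continuous_lin2 g)).
  apply/eqaddoP => e e0; have [d d0 hd] := H e e0.
  apply/nbhs_ballP; exists d => //= h; rewrite -ball_normE /= sub0r normrN => /hd.
  by rewrite -addrA -opprD.
split=> //; apply/diff_locallyP; rewrite D; split; first exact: continuous_lin2.
apply/eqaddoP => e e0; have [d d0 hd] := H e e0.
apply/nbhs_ballP; exists d => //= h; rewrite -ball_normE /= sub0r normrN => /hd.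
by rewrite -addrA -opprD.
Qed.

Lemma has_grad_near f f' x g (r : R) : 0 < r ->
  (forall y, `|x - y| < r -> f y = f' y) -> has_grad f x g -> has_grad f' x g.
Proof.
move=> r0 ff' /has_gradP H; apply/has_gradP => e /H[d d0 hd].
exists (Num.min d r); first by rewrite lt_min d0.
move=> h; rewrite lt_min => /andP[h1 h2].
rewrite -!ff' ?hd // ?subrr ?normr0 //.
by rewrite opprD addrCA subrr addr0 normrN.
Qed.

Lemma has_grad_cst a x : has_grad (cst a) x 0.
Proof.
apply: (@is_diff_eq _ _ _ _ _ _ _ (is_diff_cst a x)).
by apply/funext => h; rewrite /lin2 /= !mul0r addr0.
Qed.

Lemma has_grad_fst x : has_grad fst x (1, 0).
Proof.
apply/has_gradP => e e0; exists 1 => // h _.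
have -> : (h + x).1 - x.1 - lin2 (1, 0) h = 0.
  by have -> : (h + x).1 = h.1 + x.1 by []; rewrite /lin2 /=; ring.
by rewrite normr0 mulr_ge0 // ltW.
Qed.

Lemma has_grad_snd x : has_grad snd x (0, 1).
Proof.
apply/has_gradP => e e0; exists 1 => // h _.
have -> : (h + x).2 - x.2 - lin2 (0, 1) h = 0.
  by have -> : (h + x).2 = h.2 + x.2 by []; rewrite /lin2 /=; ring.
by rewrite normr0 mulr_ge0 // ltW.
Qed.

Lemma has_gradD f1 f2 x g1 g2 : has_grad f1 x g1 -> has_grad f2 x g2 ->
  has_grad (fun y => f1 y + f2 y) x (g1 + g2).
Proof.
move=> h1 h2; apply: (@is_diff_eq _ _ _ _ _ _ _ (is_diffD h1 h2)).
by apply/funext => h; rewrite /lin2 /= !fctE /=; ring.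
Qed.

Lemma has_gradM f1 f2 x g1 g2 : has_grad f1 x g1 -> has_grad f2 x g2 ->
  has_grad (fun y => f1 y * f2 y) x (f1 x *: g2 + f2 x *: g1).
Proof.
move=> h1 h2; apply: (@is_diff_eq _ _ _ _ _ _ _ (is_diffM h1 h2)).
by apply/funext => h; rewrite /lin2 /= !fctE /= /GRing.scale /=; ring.
Qed.

Lemma has_grad_comp1 (a : R -> R) (d : R) f x g : is_derive (f x) (1:R) a d ->
  has_grad f x g -> has_grad (fun y => a (f y)) x (d *: g).
Proof.
move=> [/derivable1_diffP da dv] h.
have ha : is_diff (f x) a (fun t : R => t *: d).
  split=> //; apply/funext => t; rewrite -dv deriveE // -linearZ /= /GRing.scale /=.
  by rewrite mulr1.
apply: (@is_diff_eq _ _ _ _ _ _ _ (is_diff_comp h ha)).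
by apply/funext => t; rewrite /lin2 /= /GRing.scale /=; ring.
Qed.

Lemma has_grad_comp f (F1 F2 : R * R -> R) x g g1 g2 :
  has_grad F1 x g1 -> has_grad F2 x g2 -> has_grad f (F1 x, F2 x) g ->
  has_grad (fun y => f (F1 y, F2 y)) x (g.1 *: g1 + g.2 *: g2).
Proof.
move=> h1 h2 h.
apply: (@is_diff_eq _ _ _ _ _ _ _ (is_diff_comp (is_diff_pair h1 h2) h)).
by apply/funext => t; rewrite /lin2 /= /GRing.scale /=; ring.
Qed.

Lemma has_grad_sum (I : Type) (r : seq I) (F : I -> R * R -> R) (G : I -> R * R) x :
  (forall i, has_grad (F i) x (G i)) ->
  has_grad (fun y => \sum_(i <- r) F i y) x (\sum_(i <- r) G i).
Proof.
move=> H; elim: r => [|i r IH].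
  rewrite big_nil; apply: (@has_grad_near (cst 0) _ _ _ 1) => //.
    by move=> y _; rewrite big_nil.
  exact: has_grad_cst.
rewrite big_cons; have := has_gradD (H i) IH.
by apply: (@has_grad_near _ _ _ _ 1) => // y _; rewrite big_cons.
Qed.

End Gradient.

(** * C^1 quadratic splines of one variable *)

Section Ramp.
Variable R : realType.

(** With a remainder of order [h ^+ 2] for all [h], differentiating a piecewise quadratic function
    reduces to polynomial inequalities. *)
Lemma is_derive_quad (f : R -> R) (x l C : R) :
  (forall h, `|f (h + x) - f x - l * h| <= C * h ^+ 2) -> is_derive x (1:R) f l.
Proof.
move=> H.
have C0 : 0 <= C.
  by have := le_trans (normr_ge0 _) (H 1); rewrite expr1n mulr1.
have cv : (h^-1 *: (f (h *: (1:R) + x) - f x)) @[h --> 0^'] --> l.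
  apply/cvgrPdist_le => e e0; near=> h.
  have h0 : h != 0 by near: h; exact: nbhs_dnbhs_neq.
  have hd : `|h| < e / (C + 1).
    by near: h; apply: dnbhs0_lt; rewrite divr_gt0 // ltr_pwDr.
  rewrite /GRing.scale /= mulr1 distrC.
  have -> : h^-1 * (f (h + x) - f x) - l = h^-1 * (f (h + x) - f x - l * h).
    by field.
  rewrite normrM normfV ler_pdivrMl ?normr_gt0 // (le_trans (H h)) //.
  rewrite -real_normK ?num_real // mulrC expr2 -mulrA ler_wpM2l ?normr_ge0 //.
  move: hd; rewrite ltr_pdivlMr ?ltr_pwDr // => hd.
  by have := normr_ge0 h; nra.
split; first by apply/cvg_ex; exists l.
exact: cvg_lim cv.
Unshelve. all: by end_near. Qed.

Definition pos (t : R) : R := Num.max t 0.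
(** The quadratic spline with knots 0, 1/2 and 1 that rises from 0 to 1. Its derivative [tent] is
    piecewise linear with support [[0, 1]] and peak 2 at 1/2. The class C^1 is what test functions
    require. *)
Definition smoothstep (t : R) : R :=
  2 * pos t ^+ 2 - 4 * pos (t - 2^-1) ^+ 2 + 2 * pos (t - 1) ^+ 2.
Definition tent (t : R) : R := 4 * pos t - 8 * pos (t - 2^-1) + 4 * pos (t - 1).

Lemma posE (t : R) : (0 <= t /\ pos t = t) \/ (t <= 0 /\ pos t = 0).
Proof.
rewrite /pos; have [h|h] := leP t 0; [right|left]; split => //.
exact: ltW.
Qed.

Lemma is_derive_pos2 (c x : R) :
  is_derive x (1:R) (fun t => pos (t - c) ^+ 2) (2 * pos (x - c)).
Proof.
apply: (@is_derive_quad _ _ _ 1) => h; rewrite ler_norml.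
have [[]|[]] := posE (x - c); have [[]|[]] := posE (h + x - c);
  move=> h1 -> h2 ->; apply/andP; split; nra.
Qed.

Lemma is_derive_smoothstep x : is_derive x (1:R) smoothstep (tent x).
Proof.
have h0 := is_derive_pos2 0 x; have h1 := is_derive_pos2 2^-1 x.
have h2 := is_derive_pos2 1 x.
have := is_deriveD (is_deriveB (is_deriveZ 2 h0) (is_deriveZ 4 h1)) (is_deriveZ 2 h2).
rewrite (_ : _ + _ = smoothstep); last first.
  by apply/funext => t; rewrite /smoothstep -{2}(subr0 t).
by move/is_derive_eq; apply; rewrite /tent subr0 /GRing.scale /=; ring.
Qed.

Lemma continuous_pos : continuous pos.
Proof.
move=> x; apply: (@continuous_max _ _ idfun (cst 0)); first exact: cvg_id.
exact: cvg_cst.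
Qed.

Lemma continuous_tent : continuous tent.
Proof.
have cp c : continuous (fun t : R => pos (t - c)).
  move=> x; apply: (@continuous_comp _ _ _ (fun t => t - c) pos).
    by apply: (@cvgB _ _ _ (nbhs x) _ idfun (cst c)); [exact: cvg_id|exact: cvg_cst].
  exact: continuous_pos.
move=> x; apply: (@cvgD _ _ _ (nbhs x) _ (fun t => 4 * pos t - 8 * pos (t - 2^-1))).
  apply: (@cvgB _ _ _ (nbhs x) _ (fun t => 4 * pos t)).
    by apply: cvgZr; exact: continuous_pos.
  by apply: cvgZr; exact: cp.
by apply: cvgZr; exact: cp.
Qed.

Lemma smoothstep_le0 t : t <= 0 -> smoothstep t = 0.
Proof.
move=> t0; rewrite /smoothstep.
have [[]|[]] := posE t; have [[]|[]] := posE (t - 2^-1); have [[]|[]] := posE (t - 1);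
  move=> ? -> ? -> ? ->; nra.
Qed.

Lemma smoothstep_ge1 t : 1 <= t -> smoothstep t = 1.
Proof.
move=> t0; rewrite /smoothstep.
have [[]|[]] := posE t; have [[]|[]] := posE (t - 2^-1); have [[]|[]] := posE (t - 1);
  move=> ? -> ? -> ? ->; try lra; nra.
Qed.

Lemma smoothstep_gt0 t : 0 < t -> 0 < smoothstep t.
Proof.
move=> t0; rewrite /smoothstep.
have [[]|[]] := posE t; have [[]|[]] := posE (t - 2^-1); have [[]|[]] := posE (t - 1);
  move=> ? -> ? -> ? ->; nra.
Qed.

Lemma smoothstep_le1 t : smoothstep t <= 1.
Proof.
rewrite /smoothstep.
have [[]|[]] := posE t; have [[]|[]] := posE (t - 2^-1); have [[]|[]] := posE (t - 1);
  move=> ? -> ? -> ? ->; nra.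
Qed.

Lemma smoothstep_ge0 t : 0 <= smoothstep t.
Proof.
by have [/smoothstep_le0->//|/smoothstep_gt0/ltW] := leP t 0.
Qed.

Lemma tent_eq0 t : t <= 0 \/ 1 <= t -> tent t = 0.
Proof.
rewrite /tent; have [[]|[]] := posE t; have [[]|[]] := posE (t - 2^-1); have [[]|[]] := posE (t - 1);
  move=> ? -> ? -> ? -> []; lra.
Qed.

Lemma tent_ge0 t : 0 <= tent t.
Proof.
rewrite /tent; have [[]|[]] := posE t; have [[]|[]] := posE (t - 2^-1); have [[]|[]] := posE (t - 1);
  move=> ? -> ? -> ? ->; lra.
Qed.

Lemma tent_le2 t : tent t <= 2.
Proof.
rewrite /tent; have [[]|[]] := posE t; have [[]|[]] := posE (t - 2^-1); have [[]|[]] := posE (t - 1);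
  move=> ? -> ? -> ? ->; lra.
Qed.

Lemma is_derive_continuous (a a' : R -> R) :
  (forall t : R, is_derive t (1:R) a (a' t)) -> continuous a.
Proof.
move=> ha t; apply: differentiable_continuous; apply/derivable1_diffP.
exact: (@ex_derive _ _ _ _ _ _ _ (ha t)).
Qed.

Lemma continuous_smoothstep : continuous smoothstep.
Proof. exact: is_derive_continuous is_derive_smoothstep. Qed.

End Ramp.

(** * Test functions supported in boxes *)

Section TestFunctions.
Variable R : realType.
Implicit Types (D B : set (R * R)) (phi f : R * R -> R).

Lemma open_bigcup_obox_nat D : open D -> exists Q : nat -> R * R * (R * R),
  (forall n, cbox (Q n) `<=` D) /\ D = \bigcup_n obox (Q n).
Proof.
move=> /open_bigcup_obox[Q DQ].
(* Codes that name no admissible rational box are sent to a box with reversed end points, whose open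
   and closed versions are both empty. *)
pose Q' n := if @unpickle (rat * rat * (rat * rat))%type n is Some q
  then if `[< cbox (Q q) `<=` D >] then Q q else ((1, 0), (1, 0))
  else ((1, 0), (1, 0)).
have E1 : cbox ((1, 0), (1, 0)) `<=` D.
  by move=> x [] /=; rewrite in_itv /= => /andP[/le_trans h1 /h1]; rewrite ler10.
have E2 (x : R * R) : obox ((1, 0), (1, 0)) x -> False.
  by move=> [] /=; rewrite in_itv /= => /andP[/lt_trans h1 /h1]; rewrite ltr10.
exists Q'; split.
  move=> n; rewrite /Q'; case: unpickle => [q|//].
  by case: ifPn => [/asboolP|].
rewrite {1}DQ; apply/seteqP; split => [x [q /= qD qx]|x [n _]].
  by exists (pickle q) => //; rewrite /Q' pickleK; case: asboolP.
rewrite /Q'; case: unpickle => [q|/E2//].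
by case: ifPn => [/asboolP qD qx|_ /E2//]; exists q.
Qed.

Lemma compact_cbox q : compact (@cbox R q).
Proof. by apply: compact_setX; exact: segment_compact. Qed.

Lemma closed_cbox q : closed (@cbox R q).
Proof.
apply: (@compact_closed _ _ _ (@compact_cbox q)).
exact: norm_hausdorff.
Qed.

Lemma C1c_intro D B phi (g : R * R -> R * R) :
  (forall x, has_grad phi x (g x)) ->
  continuous (fun x => (g x).1) -> continuous (fun x => (g x).2) ->
  compact B -> B `<=` D -> (forall x, phi x <> 0 -> B x) -> C1c D phi.
Proof.
move=> dphi c1 c2 cB BD pB.
have clB : closure [set x | phi x != 0] `<=` B.
  have /closure_id BE : closed B.
    by apply: (@compact_closed _ _ _ cB); exact: norm_hausdorff.
  by rewrite BE; apply: closureS => x /= /eqP; exact: pB.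
split.
- by move=> x; have [] := dphi x.
- move=> j; rewrite (_ : partial j phi = fun x => gcomp j (g x)).
    by rewrite /gcomp; case: (val j).
  by apply/funext => x; rewrite (has_grad_partial j (dphi x)).
- apply: subclosed_compact cB clB; exact: closed_closure.
- exact: subset_trans clB BD.
Qed.

Lemma has_grad_tensor (a b : R -> R) (da db : R) (x : R * R) :
  is_derive x.1 (1:R) a da -> is_derive x.2 (1:R) b db ->
  has_grad (fun y => a y.1 * b y.2) x (da * b x.2, a x.1 * db).
Proof.
move=> ha hb.
have := has_gradM (has_grad_comp1 ha (has_grad_fst x)) (has_grad_comp1 hb (has_grad_snd x)).
move/has_grad_eq; apply; rewrite /GRing.scale /= /scale_pair /= /GRing.scale /=.
by congr pair; rewrite /= /GRing.scale /=; ring.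
Qed.

Lemma continuous_tensor (a b : R -> R) : continuous a -> continuous b ->
  continuous (fun y : R * R => a y.1 * b y.2).
Proof.
move=> ca cb x; apply: (@cvgM _ _ (nbhs x) _ (fun y => a y.1) (fun y => b y.2)).
  by apply: (@continuous_comp _ _ _ fst a); [exact: cvg_fst|exact: ca].
by apply: (@continuous_comp _ _ _ snd b); [exact: cvg_snd|exact: cb].
Qed.

Lemma C1c_tensor D (a a' b b' : R -> R) q :
  (forall t, is_derive t (1:R) a (a' t)) -> (forall t, is_derive t (1:R) b (b' t)) ->
  continuous a' -> continuous b' ->
  (forall t, a t <> 0 -> q.1.1 <= t <= q.1.2) ->
  (forall t, b t <> 0 -> q.2.1 <= t <= q.2.2) ->
  cbox q `<=` D -> C1c D (fun y => a y.1 * b y.2).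
Proof.
move=> ha hb ca' cb' a0 b0 qD.
apply: (@C1c_intro D (cbox q) _ (fun x => (a' x.1 * b x.2, a x.1 * b' x.2))) => //.
- by move=> x; exact: has_grad_tensor.
- exact: (continuous_tensor ca' (is_derive_continuous hb)).
- exact: (continuous_tensor (is_derive_continuous ha) cb').
- exact: compact_cbox.
- move=> x /eqP; rewrite mulf_eq0 negb_or => /andP[/eqP/a0 h1 /eqP/b0 h2].
  by split; rewrite /= in_itv.
Qed.

(** Vanishes outside [[a, b]] for every [n] and converges pointwise to the indicator of []a, b[], so
    that tests by products of plateaus recover integrals over boxes. *)
Definition plateau (a b : R) (n : nat) (t : R) : R :=
  smoothstep (n%:R * (t - a)) * smoothstep (n%:R * (b - t)).

Lemma is_derive_smoothstep_affine (k c : R) t :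
  is_derive t (1:R) (fun t => smoothstep (k * t + c)) (tent (k * t + c) * k).
Proof.
have h : is_derive t (1:R) (fun t : R => k * t + c) k.
  by apply: (@is_derive_quad _ _ _ _ 0) => h; rewrite (_ : _ - _ = 0) ?normr0 ?mul0r //; ring.
have := @is_derive1_comp _ _ (fun t : R => k * t + c) _ _ _ (is_derive_smoothstep (k * t + c)) h.
by move/is_derive_eq; apply; rewrite mulrC.
Qed.

Lemma plateauE a b n : plateau a b n =
  fun t => smoothstep (n%:R * t + - (n%:R * a)) * smoothstep (- n%:R * t + n%:R * b).
Proof. by apply/funext => t; rewrite /plateau; congr (smoothstep _ * smoothstep _); ring. Qed.

Definition dplateau (a b : R) (n : nat) (t : R) : R :=
  smoothstep (n%:R * t + - (n%:R * a)) * (tent (- n%:R * t + n%:R * b) * - n%:R) +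
  smoothstep (- n%:R * t + n%:R * b) * (tent (n%:R * t + - (n%:R * a)) * n%:R).

Lemma is_derive_plateau a b n t : is_derive t (1:R) (plateau a b n) (dplateau a b n t).
Proof.
rewrite plateauE.
exact: (is_deriveM (is_derive_smoothstep_affine _ _ t) (is_derive_smoothstep_affine _ _ t)).
Qed.

Lemma continuous_affine (k c : R) : continuous (fun t : R => k * t + c).
Proof.
move=> t; apply: (@cvgD _ _ _ (nbhs t) _ (fun t => k * t) (cst c)).
  by apply: cvgZr; exact: cvg_id.
exact: cvg_cst.
Qed.

Lemma continuous_dplateau a b n : continuous (dplateau a b n).
Proof.
have cs k c : continuous (fun t : R => smoothstep (k * t + c)).
  move=> t; apply: (@continuous_comp _ _ _ (fun t => k * t + c) (@smoothstep R)).
    exact: continuous_affine.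
  exact: continuous_smoothstep.
have ct k c : continuous (fun t : R => tent (k * t + c)).
  move=> t; apply: (@continuous_comp _ _ _ (fun t => k * t + c) (@tent R)).
    exact: continuous_affine.
  exact: continuous_tent.
move=> t; apply: cvgD; (apply: cvgM; [exact: cs|]);
  by apply: cvgM; [exact: ct|exact: cvg_cst].
Qed.

Lemma plateau_neq0 a b n t : plateau a b n t <> 0 -> a <= t <= b.
Proof.
move=> /eqP; rewrite mulf_eq0 negb_or => /andP[h1 h2].
have n0 : 0 <= n%:R :> R by [].
rewrite !leNgt; apply/andP; split; apply/negP => h.
  by move: h1; rewrite smoothstep_le0 ?eqxx //; nra.
by move: h2; rewrite smoothstep_le0 ?eqxx //; nra.
Qed.

Lemma plateau_ge0 a b n t : 0 <= plateau a b n t.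
Proof. by rewrite mulr_ge0 // smoothstep_ge0. Qed.

Lemma plateau_le1 a b n t : plateau a b n t <= 1.
Proof. by rewrite mulr_ile1 ?smoothstep_ge0 ?smoothstep_le1. Qed.

Lemma plateau_cvg a b t : plateau a b n t @[n --> \oo] --> (\1_(`]a, b[) t : R).
Proof.
rewrite indicE; case: (boolP (t \in `]a, b[%classic)).
  rewrite inE /= in_itv /= => /andP[at_ tb].
  apply: cvg_near_cst; near=> n; rewrite /plateau.
  have n1 : 1 <= n%:R * (t - a).
    rewrite -ler_pdivrMr ?subr_gt0 // mul1r; near: n; exact: nbhs_infty_ger.
  have n2 : 1 <= n%:R * (b - t).
    rewrite -ler_pdivrMr ?subr_gt0 // mul1r; near: n; exact: nbhs_infty_ger.
  by rewrite !smoothstep_ge1 // mulr1.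
move=> tab; apply: cvg_near_cst; apply: nearW => n; apply/eqP; apply/negPn/negP => h.
move: tab; rewrite notin_setE /= in_itv /=; apply; move/eqP: (h) => /plateau_neq0/andP[h1 h2].
rewrite !lt_neqAle h1 h2 !andbT; apply/andP; split; apply: contraNneq h => e.
  by rewrite /plateau e subrr mulr0 smoothstep_le0 // mul0r.
by rewrite /plateau e subrr mulr0 (@smoothstep_le0 _ 0) // mulr0.
Unshelve. all: by end_near. Qed.

Definition plateau2 (q : R * R * (R * R)) (n : nat) (x : R * R) : R :=
  plateau q.1.1 q.1.2 n x.1 * plateau q.2.1 q.2.2 n x.2.

Lemma C1c_plateau2 D q n : cbox q `<=` D -> C1c D (plateau2 q n).
Proof.
move=> qD; apply: (@C1c_tensor D (plateau q.1.1 q.1.2 n) (dplateau q.1.1 q.1.2 n)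
  (plateau q.2.1 q.2.2 n) (dplateau q.2.1 q.2.2 n) q) => //.
- exact: is_derive_plateau.
- exact: is_derive_plateau.
- exact: continuous_dplateau.
- exact: continuous_dplateau.
- by move=> t; exact: plateau_neq0.
- by move=> t; exact: plateau_neq0.
Qed.

Lemma C1c_continuous D phi : C1c D phi -> continuous phi.
Proof. by move=> [dphi _ _ _] x; exact: differentiable_continuous. Qed.

Lemma C1c_outside D phi x : C1c D phi -> ~ D x -> phi x = 0.
Proof.
move=> [_ _ _ sD] Dx; apply: contrapT => px; apply: Dx; apply: sD.
by apply: subset_closure; apply/eqP.
Qed.

End TestFunctions.

(** * The fundamental lemma of the calculus of variations *)

Section DuBoisReymond.
Variable R : realType.
Implicit Types (D E : set (R * R)) (f : R * R -> R).

Lemma integrable2_le D (f g : R * R -> R) : measurable D ->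
  measurable_fun D f -> (forall x, D x -> `|f x| <= `|g x|) ->
  (@mu2 R).-integrable D (EFin \o g) -> (@mu2 R).-integrable D (EFin \o f).
Proof.
move=> mD mf fg; apply: le_integrable => //; first exact/measurable_EFinP.
Qed.

Lemma integrable2S D E (f : R * R -> R) : measurable D -> measurable E ->
  E `<=` D -> (@mu2 R).-integrable D (EFin \o f) ->
  (@mu2 R).-integrable E (EFin \o f).
Proof. by move=> mD mE ED; exact: integrableS. Qed.

(** For the sigma-algebra generated by boxes both projections are measurable: the preimage of []a,
    b[] is the union of the boxes whose other side is []-n, n[]. This allows a Dynkin argument that
    starts from boxes. *)
Lemma g_sigma_obox : @measurable _ (measurableTypeR R * measurableTypeR R)%type
  = <<s range (@obox R) >>.
Proof.
apply/seteqP; split; last first.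
  apply: smallest_sub; first exact: sigma_algebra_measurable.
  by move=> _ [q _ <-]; exact: measurable_obox.
pose T := g_sigma_algebraType (range (@obox R)).
have mfst : measurable_fun setT (fst : T -> measurableTypeR R).
  apply: (measurability _ (RGenOpens.measurableE R)) => //.
  move=> _ [_ [a [b ->] <-]].
  rewrite (_ : _ `&` _ = \bigcup_n obox ((a, b), (- n%:R, n%:R))).
    apply: bigcupT_measurable => n; apply: sub_sigma_algebra.
    by exists ((a, b), (- n%:R, n%:R)).
  apply/seteqP; split => [x [_ /= xab]|x [n _] [xab _]] //.
  exists (Num.bound `|x.2|) => //; split => //=.
  by rewrite in_itv /= -ltr_norml archi_boundP.
have msnd : measurable_fun setT (snd : T -> measurableTypeR R).
  apply: (measurability _ (RGenOpens.measurableE R)) => //.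
  move=> _ [_ [a [b ->] <-]].
  rewrite (_ : _ `&` _ = \bigcup_n obox ((- n%:R, n%:R), (a, b))).
    apply: bigcupT_measurable => n; apply: sub_sigma_algebra.
    by exists ((- n%:R, n%:R), (a, b)).
  apply/seteqP; split => [x [_ /= xab]|x [n _] [_ xab]] //.
  exists (Num.bound `|x.1|) => //; split => //=.
  by rewrite in_itv /= -ltr_norml archi_boundP.
rewrite measurable_prod_measurableType.
apply: smallest_sub; first exact: smallest_sigma_algebra.
move=> _ [A mA] [B mB] <-.
have -> : A `*` B = (setT `&` (fst : T -> _) @^-1` A) `&` (setT `&` (snd : T -> _) @^-1` B).
  by rewrite !setTI; apply/seteqP; split.
apply: (@measurableI _ T); [exact: mfst|exact: msnd].
Qed.

Definition meet_box (q r : R * R * (R * R)) : R * R * (R * R) :=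
  ((Num.max q.1.1 r.1.1, Num.min q.1.2 r.1.2),
   (Num.max q.2.1 r.2.1, Num.min q.2.2 r.2.2)).

Lemma obox_meet q r : obox q `&` obox r = obox (meet_box q r).
Proof.
apply/seteqP; split => x /=.
  move=> [[/= + +] [/= + +]]; rewrite !in_itv /=.
  move=> /andP[? ?] /andP[? ?] /andP[? ?] /andP[? ?].
  by split; rewrite /= in_itv /= gt_max lt_min; apply/andP; split; apply/andP.
move=> [] /=; rewrite !in_itv /= !gt_max !lt_min.
move=> /andP[/andP[? ?] /andP[? ?]] /andP[/andP[? ?] /andP[? ?]].
by split; split; rewrite /= in_itv; apply/andP.
Qed.

Lemma cbox_meet q r : cbox (meet_box q r) `<=` cbox q.
Proof.
move=> x [] /=; rewrite !in_itv /= !ge_max !le_min.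
move=> /andP[/andP[? ?] /andP[? ?]] /andP[/andP[? ?] /andP[? ?]].
by split; rewrite /= in_itv; apply/andP.
Qed.

Lemma setI_closed_obox : setI_closed (range (@obox R)).
Proof.
by move=> _ _ [q _ <-] [r _ <-]; exists (meet_box q r) => //; rewrite obox_meet.
Qed.

(** The plateaus over [q] are admissible because the closed box lies in [D]; they converge to the
    indicator of the open box, with [|f|] as dominating function. *)
Lemma integral_obox_eq0 D f q : open D ->
  (@mu2 R).-integrable D (EFin \o f) ->
  (forall phi, C1c D phi -> \int[@mu2 R]_(x in D) (f x * phi x) = 0) ->
  cbox q `<=` D -> (\int[@mu2 R]_(x in obox q) (f x)%:E = 0)%E.
Proof.
move=> oD fi f0 qD; have mD := open_measurable2 oD.
have mf : measurable_fun D f by apply/measurable_EFinP; exact: measurable_int fi.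
have qD' : obox q `<=` D.
  by move=> x [/= h1 h2]; apply: qD; split; exact: subset_itv_oo_cc.
have mb n : measurable_fun D (plateau2 q n).
  apply: (@measurable_funS _ _ _ _ setT) => //; apply: continuous_measurable_fun2.
  exact: C1c_continuous (C1c_plateau2 n qD).
have mfb n : measurable_fun D (fun x => f x * plateau2 q n x) by exact: measurable_funM.
have fb n x : `|f x * plateau2 q n x| <= `|f x|.
  have b0 : 0 <= plateau2 q n x by rewrite mulr_ge0 // plateau_ge0.
  by rewrite normrM ler_piMr // ger0_norm // mulr_ile1 ?plateau_ge0 ?plateau_le1.
have [] := @dominated_convergence _ _ _ (@mu2 R) D mD
  (fun n x => (f x * plateau2 q n x)%:E) (fun x => (f x * \1_(obox q) x)%:E) (fun x => `|f x|%:E).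
- by move=> n; apply/measurable_EFinP; exact: mfb.
- apply/measurable_EFinP; apply: measurable_funM => //.
  by apply: measurable_indic; exact: measurable_obox.
- apply: aeW => x Dx; apply: cvg_EFin; first exact: nearW.
  apply: cvgM; first exact: cvg_cst.
  rewrite (_ : \1_(obox q) x = \1_(`]q.1.1, q.1.2[) x.1 * \1_(`]q.2.1, q.2.2[) x.2).
    by apply: cvgM; exact: plateau_cvg.
  rewrite !indicE -natrM mulnb; congr (_%:R); congr nat_of_bool.
  by apply/idP/andP; rewrite !inE.
- by move/integrable_norm: fi.
- by apply: aeW => x n Dx /=; rewrite lee_fin.
move=> _ _.
have -> : (fun n => (\int[@mu2 R]_(x in D) (f x * plateau2 q n x)%:E)%E) = cst 0%E.
  apply/funext => n /=; have := f0 _ (C1c_plateau2 n qD).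
  rewrite /Rintegral => h; rewrite -[LHS]fineK ?h //.
  apply: integral_fune_fin_num => //.
  by apply: (integrable2_le mD (mfb n) _ fi) => x _; exact: fb.
move=> /cvg_unique; move=> /(_ _ _ (cvg_cst _)) <- //.
rewrite [RHS]integral_mkcond [LHS]integral_mkcond.
apply: eq_integral => x _; rewrite !patchE indicE.
case: (boolP (x \in obox q)) => xq; last by rewrite mulr0; case: ifP.
by rewrite mulr1 mem_set //; apply: qD'; rewrite inE in xq.
Qed.

(** Boxes are stable under intersection, so by Dynkin's theorem the vanishing of integrals extends
    from boxes to all measurable subsets of [Q n]; hence [f = 0] almost everywhere on each of the
    countably many boxes that make up [D]. *)
Lemma du_bois_reymond D f : open D -> (@mu2 R).-integrable D (EFin \o f) ->
  (forall phi, C1c D phi -> \int[@mu2 R]_(x in D) (f x * phi x) = 0) ->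
  {ae @mu2 R, forall x, D x -> f x = 0}.
Proof.
move=> oD fi f0; have mD := open_measurable2 oD.
have [Q [QD DQ]] := open_bigcup_obox_nat oD.
suff H n : {ae @mu2 R, forall x, obox (Q n) x -> f x = 0}.
  have := @ae_foralln _ _ _ (@mu2 R) _ H.
  by apply: filterS => x hx; rewrite DQ => -[n _]; exact: hx.
have mQ := measurable_obox (Q n).
have QnD : obox (Q n) `<=` D by rewrite DQ => x Qx; exists n.
have fiQ : (@mu2 R).-integrable (obox (Q n)) (EFin \o f) by exact: integrableS fi.
have fiE A : measurable A -> (@mu2 R).-integrable (obox (Q n) `&` A) (EFin \o f).
  by move=> mA; apply: (integrable2S mQ _ _ fiQ) => //; exact: measurableI.
have H A : measurable A -> (\int[@mu2 R]_(x in obox (Q n) `&` A) (f x)%:E = 0)%E.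
  move=> mA; have : <<s range (@obox R) >> A by rewrite -g_sigma_obox.
  move: A {mA}; apply: (dynkin_induction g_sigma_obox setI_closed_obox).
  - by rewrite setIT; exact: integral_obox_eq0 f0 _.
  - move=> _ [q _ <-].
    rewrite obox_meet; apply: (integral_obox_eq0 oD fi f0).
    exact: subset_trans (@cbox_meet _ _) (QD n).
  - move=> A mA A0.
    have := @integral_setU _ _ _ (@mu2 R) (obox (Q n) `&` A) (obox (Q n) `&` ~` A) (EFin \o f).
    rewrite -setIUr setUv setIT /= A0 add0e (integral_obox_eq0 oD fi f0 (QD n)) => -> //.
    + exact: measurableI.
    + by apply: measurableI => //; exact: measurableC.
    + exact: measurable_int fiQ.
    + by apply/disj_set2P; rewrite setIACA setICr setI0.
  - move=> F mF tF F0; rewrite setI_bigcupr integral_bigcup /=.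
    + by apply: eseries0 => k _ _; exact: F0.
    + exact: trivIset_setIl.
    + by move=> k; exact: measurableI.
    + by rewrite -setI_bigcupr; apply: fiE; exact: bigcupT_measurable.
have : ae_eq (@mu2 R) (obox (Q n)) (EFin \o f) (cst 0%E).
  apply: integral_ae_eq => //.
  by move=> E EQ mE; rewrite -(setIidr EQ) H // integral0.
by apply: filterS => x h /h [].
Qed.
End DuBoisReymond.

(** * Lipschitz curves have measure zero *)

Section NullSets.
Variable R : realType.
Local Notation mu := (@mu2 R).

Lemma mu2_cbox_square (c : R * R) (r : R) : 0 <= r ->
  mu (cbox ((c.1 - r, c.1 + r), (c.2 - r, c.2 + r))) = (4 * r ^+ 2)%:E.
Proof.
move=> r0; rewrite /mu2 /cbox product_measure1E /=; [|exact: measurable_itv..].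
have E (a : R) : @lebesgue_measure R [set` `[a - r, a + r]] = (2 * r)%:E.
  rewrite lebesgue_measure_itv /= lte_fin; case: ltP => h; rewrite -?EFinB; congr EFin; lra.
by rewrite !E -EFinM; congr EFin; ring.
Qed.

(** The curve is covered by [n.+2] squares of half-side [L / n.+1], of total area
    [4 * (L / n.+1) ^+ 2 * n.+2], which is at most [8 * L ^+ 2 / n.+1]. *)
Lemma null_lipschitz_curve (g : R -> R * R) (L : R) :
  (forall s t, 0 <= s <= 1 -> 0 <= t <= 1 -> `|g s - g t| <= L * `|s - t|) ->
  continuous g -> mu (g @` `[0, 1]) = 0%E.
Proof.
move=> gL cg.
have L0 : 0 <= L.
  by have := le_trans (normr_ge0 _) (@gL 1 0 _ _); rewrite subr0 normr1 mulr1; apply; rewrite ?lexx ?ler01.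
have mA : measurable (g @` `[0, 1]).
  apply: closed_measurable2; apply: (@compact_closed _ _); first exact: norm_hausdorff.
  by apply: continuous_compact; [exact: continuous_subspaceT|exact: segment_compact].
set A := g @` `[0, 1] in mA *.
suff H n : (mu A <= (8 * L ^+ 2 / n.+1%:R)%:E)%E.
  apply/eqP; rewrite eq_le measure_ge0 andbT.
  apply/lee_addgt0Pr => e e0; rewrite add0e.
  have [n Hn] : exists n : nat, 8 * L ^+ 2 / e < n%:R.
    exists (Num.bound (8 * L ^+ 2 / e)); apply: archi_boundP.
    by rewrite divr_ge0 ?mulr_ge0 ?sqr_ge0 // ltW.
  apply: le_trans (H n) _; rewrite lee_fin ler_pdivrMr // [e * _]mulrC.
  by rewrite -ler_pdivrMr // (le_trans (ltW Hn)) // ler_nat.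
pose N : R := n.+1%:R.
have N0 : 0 < N by rewrite ltr0n.
pose B k := let c := g (k%:R / N) in
  cbox ((c.1 - L / N, c.1 + L / N), (c.2 - L / N, c.2 + L / N)).
have mB k : measurable (B k) by apply: closed_measurable2; exact: closed_cbox.
(* The truncation of [t * N] takes the value [n.+1] at [t = 1], whence [n.+2] squares and not
   [n.+1]. *)
have sub : A `<=` \big[setU/set0]_(k < n.+2) B k.
  move=> _ [t /= t01 <-]; rewrite in_itv /= in t01; have /andP[t0 t1] := t01.
  have tN0 : 0 <= t * N by rewrite mulr_ge0 // ltW.
  have /andP[h1 h2] := Num.Theory.truncn_itv tN0.
  set k := Num.truncn (t * N) in h1 h2.
  have kn : (k < n.+2)%N.
    by rewrite ltnS -(ler_nat R) (le_trans h1) // -[leRHS]mul1r ler_wpM2r // ltW.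
  rewrite (bigD1 (Ordinal kn)) //=; left.
  have k01 : 0 <= k%:R / N <= 1.
    apply/andP; split; first by rewrite divr_ge0 // ltW.
    rewrite ler_pdivrMr // mul1r (le_trans h1) //.
    by rewrite -[leRHS]mul1r ler_wpM2r // ltW.
  have iN0 : 0 < N^-1 by rewrite invr_gt0.
  have h : `|t - k%:R / N| <= N^-1.
    have -> : t - k%:R / N = (t * N - k%:R) / N by field; rewrite gt_eqF.
    rewrite normrM (gtr0_norm iN0) ler_piMl ?(ltW iN0) //.
    by move: h2; rewrite -natr1 ler_norml => h2; apply/andP; split; lra.
  have := gL _ _ t01 k01; move=> /le_trans /(_ (ler_wpM2l L0 h)).
  rewrite prod_normE ge_max /B /= => /andP[]; rewrite !ler_distl => h3 h4.
  by split; rewrite /= in_itv.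
have mU : measurable (\big[setU/set0]_(k < n.+2) B k) by exact: bigsetU_measurable.
apply: (@le_trans _ _ (mu (\big[setU/set0]_(k < n.+2) B k))).
  by apply: le_measure => //; rewrite inE.
apply: le_trans (Boole_inequality _ _) _; first by move=> i _; exact: mB.
rewrite (eq_bigr (fun=> (4 * (L / N) ^+ 2)%:E)); last first.
  by move=> k _; apply: mu2_cbox_square; rewrite divr_ge0 // ltW.
rewrite sumEFin lee_fin sumr_const card_ord -[leLHS]mulr_natr -/N.
have -> : 4 * (L / N) ^+ 2 * n.+2%:R = (8 * L ^+ 2 / N) * (n.+2%:R / (2 * N)).
  by field; rewrite gt_eqF.
rewrite ler_piMr //.
  by rewrite divr_ge0 ?(ltW N0) // mulr_ge0 ?sqr_ge0.
rewrite ler_pdivrMr ?mulr_gt0 // mul1r -natrM ler_nat.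
by rewrite ltn_Pmull.
Qed.
End NullSets.

(** * Integration of real functions over subsets of the plane *)

Section PlaneIntegral.
Variable R : realType.
Implicit Types (D : set (R * R)) (f g : R * R -> R).
Local Notation mu := (@mu2 R).
Variable D : set (R * R).
Hypothesis mD : measurable D.

Lemma integrable2D f g : mu.-integrable D (EFin \o f) ->
  mu.-integrable D (EFin \o g) -> mu.-integrable D (EFin \o (fun x => f x + g x)).
Proof. exact: integrableD. Qed.

Lemma integrable2B f g : mu.-integrable D (EFin \o f) ->
  mu.-integrable D (EFin \o g) -> mu.-integrable D (EFin \o (fun x => f x - g x)).
Proof. exact: integrableB. Qed.

Lemma integrable2Z (k : R) f : mu.-integrable D (EFin \o f) ->
  mu.-integrable D (EFin \o (fun x => k * f x)).
Proof. exact: integrableZl. Qed.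

Lemma integrable2_measurable f :
  mu.-integrable D (EFin \o f) -> measurable_fun D f.
Proof. by move=> fi; apply/measurable_EFinP; exact: measurable_int fi. Qed.

Lemma Rintegral2D f g : mu.-integrable D (EFin \o f) ->
  mu.-integrable D (EFin \o g) ->
  \int[mu]_(x in D) (f x + g x) = \int[mu]_(x in D) f x + \int[mu]_(x in D) g x.
Proof. exact: RintegralD. Qed.

Lemma Rintegral2B f g : mu.-integrable D (EFin \o f) ->
  mu.-integrable D (EFin \o g) ->
  \int[mu]_(x in D) (f x - g x) = \int[mu]_(x in D) f x - \int[mu]_(x in D) g x.
Proof. exact: RintegralB. Qed.

Lemma Rintegral2Z (k : R) f : mu.-integrable D (EFin \o f) ->
  \int[mu]_(x in D) (k * f x) = k * \int[mu]_(x in D) f x.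
Proof. exact: RintegralZl. Qed.

Lemma EFin_Rintegral2 f : mu.-integrable D (EFin \o f) ->
  (\int[mu]_(x in D) f x)%:E = (\int[mu]_(x in D) (f x)%:E)%E.
Proof. by move=> fi; rewrite fineK //; exact: integrable_fin_num fi. Qed.

Lemma integrable2_Mbounded f g (C : R) : mu.-integrable D (EFin \o f) ->
  measurable_fun D g -> (forall x, D x -> `|g x| <= C) ->
  mu.-integrable D (EFin \o (fun x => f x * g x)).
Proof.
move=> fi mg gC; apply: (@integrable2_le _ D _ (fun x => C * f x)) => //.
- exact: (measurable_funM (integrable2_measurable fi) mg).
- move=> x Dx; rewrite !normrM mulrC ler_wpM2r // (le_trans (gC x Dx)) //.
  exact: ler_norm.
- exact: integrable2Z.
Qed.

End PlaneIntegral.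

(** * Almost everywhere statements in the plane *)

Section AlmostEverywhere.
Variable R : realType.
Local Notation mu := (@mu2 R).
Implicit Types P Q : R * R -> Prop.

Lemma ae2S P Q : (forall x, P x -> Q x) ->
  {ae mu, forall x, P x} -> {ae mu, forall x, Q x}.
Proof. by move=> PQ [N [mN N0 PN]]; exists N; split=> // x /= nQ; apply: PN => /PQ. Qed.

Lemma ae2I P Q : {ae mu, forall x, P x} -> {ae mu, forall x, Q x} ->
  {ae mu, forall x, P x /\ Q x}.
Proof.
move=> [N [mN N0 PN]] [N' [mN' N0' PN']]; exists (N `|` N'); split.
- exact: measurableU.
- by rewrite null_set_setU.
- by move=> x /= /not_andP[h|h]; [left; exact: PN|right; exact: PN'].
Qed.

Lemma ae2_null (N : set (R * R)) : measurable N -> mu N = 0%E ->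
  {ae mu, forall x, ~ N x}.
Proof. by move=> mN N0; exists N; split=> // x /= /contrapT. Qed.

Lemma ae2_forall (J : finType) (P : J -> R * R -> Prop) :
  (forall i, {ae mu, forall x, P i x}) -> {ae mu, forall x, forall i, P i x}.
Proof.
move=> H; suff : {ae mu, forall x, forall i, i \in index_enum J -> P i x}.
  by apply: ae2S => x h i; apply: h; rewrite mem_index_enum.
elim: (index_enum J) => [|i r IH]; first by exists set0; split => // x /=; apply.
apply: ae2S (ae2I (H i) IH) => x [h1 h2] k; rewrite inE => /orP[/eqP ->//|]; exact: h2.
Qed.

End AlmostEverywhere.

(** * Cutoff functions and the mean value of a divergence *)

Section Cutoff.
Variable R : realType.
Implicit Types (D : set (R * R)) (phi psi : R * R -> R).

Lemma C1cD D phi psi : C1c D phi -> C1c D psi -> C1c D (fun x => phi x + psi x).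
Proof.
move=> [d1 c1 k1 s1] [d2 c2 k2 s2].
have sub : closure [set x | phi x + psi x != 0] `<=`
    closure [set x | phi x != 0] `|` closure [set x | psi x != 0].
  rewrite -closureU; apply: closureS => x /= h.
  have [p0|p0] := eqVneq (phi x) 0; last by left.
  by right; move: h; rewrite p0 add0r.
split.
- by move=> x; exact: (@differentiableD _ _ _ phi psi x).
- move=> j; rewrite (_ : partial j _ = fun x => partial j phi x + partial j psi x).
    by move=> x; apply: cvgD; [exact: c1|exact: c2].
  apply/funext => x; apply: (@deriveD _ _ _ phi psi x); exact: diff_derivable.
- apply: subclosed_compact sub; first exact: closed_closure.
  exact: compactU.
- by move=> x /sub[]; [exact: s1|exact: s2].
Qed.

Lemma C1c0 D : C1c D (fun=> 0).
Proof.
apply: (@C1c_intro _ D set0 _ (fun=> 0)) => //.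
- exact: has_grad_cst.
- by move=> x; exact: cvg_cst.
- by move=> x; exact: cvg_cst.
- exact: compact0.
Qed.

Lemma C1c_sum D (J : Type) (r : seq J) (F : J -> R * R -> R) :
  (forall i, C1c D (F i)) -> C1c D (fun x => \sum_(i <- r) F i x).
Proof.
move=> HF; elim: r => [|i r IH].
  rewrite (_ : (fun x => _) = (fun=> 0)); first exact: C1c0.
  by apply/funext => x; rewrite big_nil.
rewrite (_ : (fun x => _) = (fun x => F i x + \sum_(i <- r) F i x)).
  exact: C1cD.
by apply/funext => x; rewrite big_cons.
Qed.

(** Sums of integer translates telescope, which yields a C^1 partition of unity. *)
Definition hat (t : R) : R := smoothstep (t + 1) - smoothstep t.

Lemma hat_ge0 t : 0 <= hat t.
Proof.
rewrite /hat; have [t0|/ltW t0] := leP t 0.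
  by rewrite (smoothstep_le0 t0) subr0 smoothstep_ge0.
by rewrite (@smoothstep_ge1 _ (t + 1)) ?subr_ge0 ?smoothstep_le1 // lerDr.
Qed.

Lemma hat_neq0 t : hat t <> 0 -> -1 < t < 1.
Proof.
move=> h; apply/andP; split; rewrite ltNge; apply/negP => t1; apply: h.
  by rewrite /hat !smoothstep_le0 ?subrr //; lra.
by rewrite /hat !smoothstep_ge1 ?subrr //; lra.
Qed.

Lemma sum_hat K t : \sum_(k < K) hat (t - k%:R) = smoothstep (t + 1) - smoothstep (t + 1 - K%:R).
Proof.
elim: K => [|K IH]; first by rewrite big_ord0 subr0 subrr.
rewrite big_ord_recr /= IH /hat.
have -> : t - K%:R + 1 = t + 1 - K%:R by ring.
have -> : t + 1 - K.+1%:R = t - K%:R by rewrite -natr1; ring.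
by ring.
Qed.

Lemma sum_hat_le1 K t : \sum_(k < K) hat (t - k%:R) <= 1.
Proof.
by rewrite sum_hat; have := smoothstep_le1 (t + 1); have := smoothstep_ge0 (t + 1 - K%:R); lra.
Qed.

Lemma sum_hat_eq1 K t : 0 <= t -> t <= K%:R - 1 -> \sum_(k < K) hat (t - k%:R) = 1.
Proof. by move=> h1 h2; rewrite sum_hat smoothstep_ge1 ?smoothstep_le0 ?subr0 //; lra. Qed.

(** The supports of the translates meet in end points only, so at most one term is nonzero; the
    bound is therefore uniform in [K], and so is the gradient bound of the cutoff. The induction
    carries the vanishing for [t <= 0] along. *)
Lemma sum_tent K (t : R) : \sum_(k < K) tent (t - k%:R) <= 2.
Proof.
suff [] : (\sum_(k < K) tent (t - k%:R) <= 2) /\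
   (t <= 0 -> \sum_(k < K) tent (t - k%:R) = 0) by [].
elim: K t => [|K IH] t; first by rewrite big_ord0; split.
have E : \sum_(k < K) tent (t - (bump 0 k)%:R) = \sum_(k < K) tent ((t - 1) - k%:R).
  by apply: eq_bigr => k _; congr tent; rewrite /bump /= add1n -natr1; ring.
rewrite big_ord_recl /= E; have [IH1 IH2] := IH (t - 1); rewrite subr0.
split.
  have [t1|t1] := leP t 1.
    by rewrite IH2 ?addr0 ?tent_le2 // subr_le0.
  by rewrite tent_eq0 ?add0r //; right; exact: ltW.
by move=> t0; rewrite IH2 ?tent_eq0 ?addr0 //; [left|lra].
Qed.

Variables (e : R) (N : nat).
Hypothesis e0 : 0 < e.

(** The bump of width [e] centred at [e * (k - N)]; the shift by [N] lets natural indices reach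
    negative coordinates. *)
Definition ghat (k : nat) (s : R) : R := hat (e^-1 * s + N%:R - k%:R).
Definition dghat (k : nat) (s : R) : R :=
  tent (e^-1 * s + (N%:R - k%:R + 1)) * e^-1 - tent (e^-1 * s + (N%:R - k%:R)) * e^-1.

Lemma is_derive_ghat k (s : R) : is_derive s (1:R) (ghat k) (dghat k s).
Proof.
rewrite (_ : ghat k = fun s => smoothstep (e^-1 * s + (N%:R - k%:R + 1)) -
                      smoothstep (e^-1 * s + (N%:R - k%:R))).
  exact: (is_deriveB (is_derive_smoothstep_affine _ _ s) (is_derive_smoothstep_affine _ _ s)).
by apply/funext => t; rewrite /ghat /hat; congr (smoothstep _ - smoothstep _); ring.
Qed.

Lemma continuous_dghat k : continuous (dghat k).
Proof.
have ct c : continuous (fun s : R => tent (e^-1 * s + c) * e^-1).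
  move=> t; apply: cvgM; last exact: cvg_cst.
  apply: (@continuous_comp _ _ _ (fun t => e^-1 * t + c) (@tent R)).
    exact: continuous_affine.
  exact: continuous_tent.
by move=> t; apply: cvgB; exact: ct.
Qed.

Lemma ghat_neq0 k s : ghat k s <> 0 ->
  e * (k%:R - N%:R - 1) < s < e * (k%:R - N%:R + 1).
Proof.
move=> /hat_neq0/andP[h1 h2].
have es : e * (e^-1 * s) = s by rewrite mulrA mulfV ?gt_eqF // mul1r.
by apply/andP; split; rewrite -{}es ltr_pM2l //; lra.
Qed.

Lemma sum_dghat_le K s : \sum_(k < K) `|dghat k s| <= 4 / e.
Proof.
have ei : 0 <= e^-1 by rewrite invr_ge0 ltW.
apply: (@le_trans _ _ (\sum_(k < K) (tent (e^-1 * s + N%:R + 1 - k%:R) +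
      tent (e^-1 * s + N%:R - k%:R)) * e^-1)).
  apply: ler_sum => k _; rewrite /dghat -mulrBl normrM (ger0_norm ei) ler_wpM2r //.
  rewrite (_ : e^-1 * s + (N%:R - k%:R + 1) = e^-1 * s + N%:R + 1 - k%:R); last by ring.
  rewrite addrA (le_trans (ler_normB _ _)) //.
  by rewrite !ger0_norm ?tent_ge0.
rewrite -mulr_suml ler_wpM2r // big_split /=.
by have := sum_tent K (e^-1 * s + N%:R + 1); have := sum_tent K (e^-1 * s + N%:R); lra.
Qed.

Definition cell (p : nat * nat) : R * R * (R * R) :=
  ((e * (p.1%:R - N%:R - 1), e * (p.1%:R - N%:R + 1)),
   (e * (p.2%:R - N%:R - 1), e * (p.2%:R - N%:R + 1))).
Definition gtens (p : nat * nat) (x : R * R) : R := ghat p.1 x.1 * ghat p.2 x.2.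

Lemma C1c_gtens D p : cbox (cell p) `<=` D -> C1c D (gtens p).
Proof.
move=> pD; apply: (@C1c_tensor _ D (ghat p.1) (dghat p.1) (ghat p.2) (dghat p.2) (cell p)).
- exact: is_derive_ghat.
- exact: is_derive_ghat.
- exact: continuous_dghat.
- exact: continuous_dghat.
- by move=> t /ghat_neq0/andP[/ltW h1 /ltW h2]; apply/andP.
- by move=> t /ghat_neq0/andP[/ltW h1 /ltW h2]; apply/andP.
- exact: pD.
Qed.

Lemma partial_gtens_le p x j : `|partial j (gtens p) x| <=
  `|dghat p.1 x.1| * ghat p.2 x.2 + ghat p.1 x.1 * `|dghat p.2 x.2|.
Proof.
have h := has_grad_tensor (is_derive_ghat p.1 x.1) (is_derive_ghat p.2 x.2).
rewrite (has_grad_partial j h) /gcomp.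
have g1 : 0 <= ghat p.1 x.1 by exact: hat_ge0.
have g2 : 0 <= ghat p.2 x.2 by exact: hat_ge0.
by case: (val j) => [|m] /=; rewrite normrM ?(ger0_norm g1) ?(ger0_norm g2);
  rewrite ?lerDl ?lerDr mulr_ge0.
Qed.

Lemma gtens_ge0 p x : 0 <= gtens p x.
Proof. by rewrite mulr_ge0 // hat_ge0. Qed.

Lemma sum_gtensE K x : \sum_(p : 'I_K * 'I_K) gtens (val p.1, val p.2) x =
  (\sum_(k < K) ghat k x.1) * \sum_(k < K) ghat k x.2.
Proof.
rewrite big_distrlr /= pair_big /=; exact: eq_bigr.
Qed.

Lemma sum_ghat_le1 K s : \sum_(k < K) ghat k s <= 1.
Proof. exact: sum_hat_le1. Qed.

End Cutoff.

Section ZeroMean.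
Variable R : realType.
Implicit Types (D : set (R * R)) (phi : R * R -> R).

Lemma gcomp_sum (J : Type) (r : seq J) (G : J -> R * R) j :
  gcomp j (\sum_(i <- r) G i) = \sum_(i <- r) gcomp j (G i).
Proof.
elim: r => [|i r IH]; first by rewrite !big_nil /gcomp; case: (val j).
by rewrite !big_cons -IH /gcomp; case: (val j).
Qed.

(** [phi] adds up those bumps of a square grid whose cell lies in [D]. In each product one factor
    contributes at most [4 / e] and the other at most 1 after summation; the two terms of
    [partial_gtens_le] give [8 / e], whatever the number of cells. *)
Lemma cutoff D (M e : R) : open D -> (forall x, D x -> `|x| <= M) -> 0 < e ->
  exists phi, [/\ C1c D phi, forall x, 0 <= phi x <= 1,
    forall j x, `|partial j phi x| <= 8 / e &
    forall x, (forall z, `|x - z| < 4 * e -> D z) ->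
      phi x = 1 /\ forall j, partial j phi x = 0].
Proof.
move=> oD DM e0.
(* The centres [e * (k - N)] with [k <= 2 * N] span an interval containing [[-M, M]]. *)
pose N := (Num.bound (M / e)).+1; pose K := (N + N).+1.
pose F (p : 'I_K * 'I_K) : R * R -> R :=
  if `[< cbox (cell e N (val p.1, val p.2)) `<=` D >] then gtens e N (val p.1, val p.2)
  else (fun=> 0).
have FC p : C1c D (F p).
  by rewrite /F; case: asboolP => h; [exact: C1c_gtens|exact: C1c0].
pose phi x := \sum_(p : 'I_K * 'I_K) F p x.
have Cphi : C1c D phi by exact: C1c_sum.
have F0 p x : 0 <= F p x by rewrite /F; case: asboolP => h //; exact: gtens_ge0.
have FT p x : F p x <= gtens e N (val p.1, val p.2) x.
  by rewrite /F; case: asboolP => h //; exact: gtens_ge0.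
have s0 s : 0 <= \sum_(k < K) ghat e N k s by apply: sumr_ge0 => k _; exact: hat_ge0.
have phi1 x : phi x <= 1.
  apply: (@le_trans _ _ (\sum_(p : 'I_K * 'I_K) gtens e N (val p.1, val p.2) x)).
    by apply: ler_sum => p _; exact: FT.
  by rewrite sum_gtensE mulr_ile1 // sum_ghat_le1.
(* A bump that is nonzero at [x] has its cell within [2 * e] of [x], so no bump contributing at [x]
   has been discarded and the full partition of unity is seen there. *)
have one x : (forall z, `|x - z| < 3 * e -> D z) -> phi x = 1.
  move=> xD; have Dx : D x by apply: xD; rewrite subrr normr0 mulr_gt0.
  have xM := DM _ Dx.
  have -> : phi x = \sum_(p : 'I_K * 'I_K) gtens e N (val p.1, val p.2) x.
    apply: eq_bigr => p _; rewrite /F; case: asboolP => // h.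
    apply/esym/eqP; apply: contrapT => /negP; rewrite mulf_eq0 negb_or.
    move=> /andP[/eqP/(ghat_neq0 e0)/andP[a1 a2] /eqP/(ghat_neq0 e0)/andP[b1 b2]].
    apply: h => z [] /=; rewrite !in_itv /= => /andP[c1 c2] /andP[d1 d2].
    apply: xD; rewrite prod_normE gt_max !ltr_norml /=.
    have q : (x - z).1 = x.1 - z.1 by []. have r : (x - z).2 = x.2 - z.2 by [].
    by apply/andP; split; apply/andP; split; rewrite ?q ?r; nra.
  have big s : `|s| <= M -> \sum_(k < K) ghat e N k s = 1.
    move=> sM; have h : `|e^-1 * s| <= N%:R.
      rewrite normrM gtr0_norm ?invr_gt0 // mulrC.
      have M0 : 0 <= M / e by rewrite divr_ge0 ?(ltW e0) // (le_trans (normr_ge0 s)).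
      apply: (@le_trans _ _ (M / e)); first by rewrite ler_wpM2r // invr_ge0 ltW.
      by rewrite (le_trans (ltW (archi_boundP M0))) // ler_nat.
    move: h; rewrite ler_norml => /andP[h1 h2].
    apply: sum_hat_eq1; first by lra.
    by rewrite /K -natr1 natrD; lra.
  move: xM; rewrite sum_gtensE prod_normE ge_max => /andP[x1 x2].
  by rewrite !big // mulr1.
exists phi; split => //.
- by move=> x; rewrite phi1 andbT; apply: sumr_ge0 => p _; exact: F0.
- move=> j x.
  have -> : partial j phi x = \sum_(p : 'I_K * 'I_K) partial j (F p) x.
    have h := @has_grad_sum R _ (index_enum _) F _ x (fun p => differentiable_has_grad (let: And4 d _ _ _ := FC p in d x)).
    rewrite (has_grad_partial j h) gcomp_sum; apply: eq_bigr => p _.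
    have [d _ _ _] := FC p; exact/esym/has_grad_partial/differentiable_has_grad.
  apply: (le_trans (ler_norm_sum _ _ _)).
  apply: (@le_trans _ _ (\sum_(p : 'I_K * 'I_K) 
     (`|dghat e N (val p.1) x.1| * ghat e N (val p.2) x.2 + ghat e N (val p.1) x.1 * `|dghat e N (val p.2) x.2|))).
    apply: ler_sum => p _; rewrite /F; case: asboolP => h; first exact: partial_gtens_le.
    rewrite /partial derive_cst normr0 addr_ge0 // mulr_ge0 //; exact: hat_ge0.
  rewrite big_split /= -(pair_bigA _ (fun i j : 'I_K => `|dghat e N i x.1| * ghat e N j x.2)) /=.
  rewrite -(pair_bigA _ (fun i j : 'I_K => ghat e N i x.1 * `|dghat e N j x.2|)) /=.
  rewrite -!big_distrlr /=.
  have e4 : 0 <= 4 / e by rewrite divr_ge0 // ltW.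
  have -> : 8 / e = 4 / e * 1 + 1 * (4 / e) by field; rewrite gt_eqF.
  have sd s : 0 <= \sum_(k < K) `|dghat e N k s| by exact: sumr_ge0.
  by apply: lerD; apply: ler_pM => //; first [exact: sum_dghat_le|exact: sum_ghat_le1].
- move=> x xD.
  (* The additional [e] makes [phi] equal to 1 on a whole ball around [x], which gives the vanishing
     of the derivatives. *)
  have D3 y : `|x - y| < e -> forall z, `|y - z| < 3 * e -> D z.
    move=> xy z yz; apply: xD; have := ler_normD (x - y) (y - z).
    by rewrite addrA subrK; lra.
  split; first by apply: one; apply: D3; rewrite subrr normr0.
  move=> j; rewrite /partial (@near_eq_derive _ _ _ phi (cst 1)) ?derive_cst //.
  by apply/nbhs_ballP; exists e => //= y; rewrite -ball_normE /= => /D3/one.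
Qed.

Lemma integrable2_bounded D (f : R * R -> R) (C : R) : measurable D ->
  (@mu2 R D < +oo)%E -> measurable_fun D f -> (forall x, D x -> `|f x| <= C) ->
  (@mu2 R).-integrable D (EFin \o f).
Proof.
move=> mD Dfin mf fC; apply: measurable_bounded_integrable => //.
exists C; split; first exact: num_real.
by move=> c Cc x Dx; exact: le_trans (fC x Dx) (ltW Cc).
Qed.

(** By [|f| <= 1 + f ^+ 2] and finiteness of the measure of [D]. *)
Lemma in_L2_integrable D (f : R * R -> R) : measurable D -> (@mu2 R D < +oo)%E ->
  in_L2 D f -> (@mu2 R).-integrable D (EFin \o f).
Proof.
move=> mD Dfin [mf f2].
have i1 : (@mu2 R).-integrable D (EFin \o cst (1:R)).
  by apply: (@integrable2_bounded _ _ 1) => // x _ /=; rewrite normr1.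
have i2 : (@mu2 R).-integrable D (EFin \o (fun x => f x ^+ 2)).
  apply/integrableP; split; first by apply/measurable_EFinP; exact: measurable_funX.
  by under eq_integral do rewrite /= ger0_norm ?sqr_ge0 //.
have i3 := integrable2D mD i1 i2.
apply: (@integrable2_le _ D _ (fun x => 1 + f x ^+ 2)) => //.
move=> x Dx; rewrite [leRHS]ger0_norm ?addr_ge0 ?sqr_ge0 //.
by rewrite ler_norml; apply/andP; split; nra.
Qed.

(** With cutoffs [phi n], the integral of [g * phi n] tends to that of [g] and equals minus the
    integral of [u] against the gradient of [phi n]. The latter integrand tends to 0 pointwise, and
    linear decay of [u] at the complement of [D] keeps it bounded. *)
Lemma integral_Hdiv_eq0 D (u : R * R -> R * R) (g : R * R -> R) (M C : R) :
  open D -> (forall x, D x -> `|x| <= M) -> Hdiv_with D u g ->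
  {ae @mu2 R, forall x, D x -> forall j z, ~ D z -> `|Defs.comp j u x| <= C * `|x - z|} ->
  \int[@mu2 R]_(x in D) g x = 0.
Proof.
move=> oD DM [uL2 gL2 ug] uC.
have mD := open_measurable2 oD; have Dfin := mu2_bounded_lty mD DM.
have gi := in_L2_integrable mD Dfin gL2.
have mg : measurable_fun D g by case: gL2.
have e0 n : 0 < n.+1%:R^-1 :> R by rewrite invr_gt0.
have [phi P] := choice (fun n => cutoff oD DM (e0 n)).
have mphi n : measurable_fun D (phi n).
  apply: (@measurable_funS _ _ _ _ setT) => //; apply: continuous_measurable_fun2.
  by have [Cp _ _ _] := P n; exact: C1c_continuous Cp.
have mdphi n j : measurable_fun D (partial j (phi n)).
  apply: (@measurable_funS _ _ _ _ setT) => //; apply: continuous_measurable_fun2.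
  by have [[_ cp _ _] _ _ _] := P n.
have near1 x : D x -> \forall n \near \oo, phi n x = 1 /\ forall j, partial j (phi n) x = 0.
  move=> Dx; have [r r0 xr] := open_ballP oD Dx.
  have r4 : 0 < r / 4 by rewrite divr_gt0.
  near=> n; have [_ _ _ h] := P n; apply: h => z xz; apply: xr; apply: lt_trans xz _.
  rewrite -ltr_pdivlMl // mulrC.
  by near: n; exact: (near_infty_natSinv_lt (PosNum r4)).
have [] := @dominated_convergence _ _ _ (@mu2 R) D mD
  (fun n x => (g x * phi n x)%:E) (fun x => (g x)%:E) (fun x => `|g x|%:E).
- by move=> n; apply/measurable_EFinP; exact: (measurable_funM mg (mphi n)).
- exact/measurable_EFinP.
- apply: aeW => x Dx; apply: cvg_near_cst; have := near1 x Dx.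
  by apply: filterS => n [-> _]; rewrite mulr1.
- by move/integrable_norm: gi.
- apply: aeW => x n Dx /=; rewrite lee_fin normrM ler_piMr //.
  by have [_ /(_ x)/andP[h1 h2] _ _] := P n; rewrite ger0_norm.
move=> _ _ cvg1.
pose h n x := \sum_j Defs.comp j u x * partial j (phi n) x.
have mh n : measurable_fun D (h n).
  apply: (@measurable_sum _ _ _ _ _ _ (fun j x => Defs.comp j u x * partial j (phi n) x)) => j.
  have [mu _] := uL2 j; exact: (measurable_funM mu (mdphi n j)).
(* If some [z] outside [D] is closer than [4 / n.+1], each of the two products is at most [4 * 8]
   times [|C|]; otherwise the gradient vanishes. This explains the constant 64. *)
have [] := @dominated_convergence _ _ _ (@mu2 R) D mD
  (fun n x => (h n x)%:E) (cst 0%E) (EFin \o cst (`|C| * 64 : R)).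
- by move=> n; apply/measurable_EFinP; exact: mh.
- exact: measurable_cst.
- apply: aeW => x Dx; apply: cvg_near_cst; have := near1 x Dx.
  by apply: filterS => n [_ h0]; rewrite /h big1 // => j _; rewrite h0 mulr0.
- by apply: (@integrable2_bounded _ _ (`|C| * 64)) => // x _ /=; rewrite ger0_norm // mulr_ge0.
- apply: ae2S uC => x uC n Dx /=; rewrite lee_fin.
  have [_ _ b1 b2] := P n.
  have [hx|/existsNP[z /not_implyP[xz nDz]]] :=
     pselect (forall z, `|x - z| < 4 * n.+1%:R^-1 -> D z).
    by have [_ h0] := b2 x hx; rewrite /h big1 ?normr0 ?mulr_ge0 // => j _; rewrite h0 mulr0.
  rewrite /h (le_trans (ler_norm_sum _ _ _)) //.
  apply: (@le_trans _ _ (\sum_(j < 2) `|C| * 32)).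
    apply: ler_sum => j _; rewrite normrM.
    have -> : `|C| * 32 = (`|C| * (4 * n.+1%:R^-1)) * (8 / n.+1%:R^-1) by field.
    apply: ler_pM => //; rewrite (le_trans (uC Dx j z nDz)) //.
    by rewrite (le_trans (ler_wpM2r _ (ler_norm C))) // ler_wpM2l // ltW.
  by rewrite !big_ord_recl big_ord0; lra.
move=> _ _ cvg2.
have c1 : \int[@mu2 R]_(x in D) (g x * phi n x) @[n --> \oo] --> \int[@mu2 R]_(x in D) g x.
  by apply: fine_cvg; rewrite -EFin_Rintegral2 in cvg1.
have c2 : \int[@mu2 R]_(x in D) h n x @[n --> \oo] --> (0 : R).
  by apply: fine_cvg; rewrite integral0 in cvg2.
have E : (fun n => \int[@mu2 R]_(x in D) h n x) = (fun n => - \int[@mu2 R]_(x in D) (g x * phi n x)).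
  by apply/funext => n; have [Cp _ _ _] := P n; exact: ug.
have c3 : \int[@mu2 R]_(x in D) h n x @[n --> \oo] --> - \int[@mu2 R]_(x in D) g x.
  by rewrite E; exact: cvgN c1.
have := cvg_lim (@Rhausdorff R) c3; rewrite (cvg_lim (@Rhausdorff R) c2).
by move=> /(_ _)/eqP; rewrite eq_sym oppr_eq0 => /eqP.
Unshelve. all: by end_near. Qed.
End ZeroMean.

(** * Quadratic maps and the Piola transform *)

Section Quadratic.
Variable R : realType.
Implicit Types (x y : R * R).

(** Explicit coefficients turn Taylor, midpoint and Lagrange formulas into polynomial identities. *)
Record quad := Quad { q00 : R; q10 : R; q01 : R; q20 : R; q11 : R; q02 : R }.
Implicit Types q p : quad.

Definition qev q x : R := q00 q + q10 q * x.1 + q01 q * x.2 +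
  q20 q * x.1 ^+ 2 + q11 q * (x.1 * x.2) + q02 q * x.2 ^+ 2.
Definition qdx q x : R := q10 q + 2 * q20 q * x.1 + q11 q * x.2.
Definition qdy q x : R := q01 q + q11 q * x.1 + 2 * q02 q * x.2.

Lemma poly_le2_quad (f : R * R -> R) : poly_le 2 f -> exists q, f = qev q.
Proof.
move=> [c fc]; exists (Quad (c 0%N 0%N) (c 1%N 0%N) (c 0%N 1%N) (c 2%N 0%N) (c 1%N 1%N) (c 0%N 2%N)).
apply/funext => x; rewrite fc !big_ord_recl !big_ord0 /= /qev /=.
by rewrite /bump /= !add1n; ring.
Qed.

Lemma poly_le1_affine (a b c : R) : poly_le 1 (fun x : R * R => a + b * x.1 + c * x.2).
Proof.
exists (fun i j => match i, j with 0%N, 0%N => a | 1%N, 0%N => b | _, _ => c end).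
by move=> x; rewrite !big_ord_recl !big_ord0 /= /bump /=; ring.
Qed.

Lemma qev_affine q (a b c a' b' c' : R) : exists q', forall x,
  qev q (a + b * x.1 + c * x.2, a' + b' * x.1 + c' * x.2) = qev q' x.
Proof.
exists (Quad (qev q (a, a')) (b * qdx q (a, a') + b' * qdy q (a, a'))
  (c * qdx q (a, a') + c' * qdy q (a, a'))
  (q20 q * b ^+ 2 + q11 q * b * b' + q02 q * b' ^+ 2)
  (2 * q20 q * b * c + q11 q * (b * c' + b' * c) + 2 * q02 q * b' * c')
  (q20 q * c ^+ 2 + q11 q * c * c' + q02 q * c' ^+ 2)).
by move=> x; rewrite /qev /qdx /qdy /=; ring.
Qed.

(** For quadratics the mean value theorem is exact with the gradient taken at the midpoint. *)
Lemma qev_sub q x y : qev q x - qev q y =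
  qdx q (2^-1 *: (x + y)) * (x.1 - y.1) + qdy q (2^-1 *: (x + y)) * (x.2 - y.2).
Proof.
case: x y => [x1 x2] [y1 y2]; rewrite /qev /qdx /qdy /= /GRing.scale /=.
by field.
Qed.

Lemma qev_taylor q x (h : R * R) : qev q (x + h) = qev q x +
  (qdx q x * h.1 + qdy q x * h.2) +
  (q20 q * h.1 ^+ 2 + q11 q * (h.1 * h.2) + q02 q * h.2 ^+ 2).
Proof. by case: x h => [x1 x2] [h1 h2]; rewrite /qev /qdx /qdy /=; ring. Qed.

Lemma has_grad_remainder (f : R * R -> R) x g (C r : R) : 0 < r ->
  (forall h, `|h| < r -> `|f (h + x) - f x - lin2 g h| <= C * `|h| ^+ 2) ->
  has_grad f x g.
Proof.
move=> r0 H; apply/has_gradP => e e0.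
have C0 : 0 < `|C| + 1 by rewrite ltr_pwDr.
exists (Num.min r (e / (`|C| + 1))); first by rewrite lt_min r0 divr_gt0.
move=> h; rewrite lt_min => /andP[/H h1]; rewrite ltr_pdivlMr // => h2.
rewrite (le_trans h1) // expr2 mulrA ler_wpM2r //.
have := normr_ge0 h; have := ler_norm C; nra.
Qed.

Lemma ler_normp1 x : `|x.1| <= `|x|.
Proof. by rewrite prod_normE le_max lexx. Qed.
Lemma ler_normp2 x : `|x.2| <= `|x|.
Proof. by rewrite prod_normE le_max lexx orbT. Qed.

Lemma has_grad_qev q x : has_grad (qev q) x (qdx q x, qdy q x).
Proof.
apply: (@has_grad_remainder _ _ _ (`|q20 q| + `|q11 q| + `|q02 q|) 1) => // h _.
rewrite [h + x]addrC qev_taylor /lin2 /=.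
set l := qdx q x * h.1 + _; set s := q20 q * _ + _ + _.
rewrite (_ : _ - _ - _ = s); last by ring.
have h1 := ler_normp1 h; have h2 := ler_normp2 h.
have n1 := normr_ge0 h.1; have n2 := normr_ge0 h.2.
rewrite /s (le_trans (ler_normD _ _)) // !mulrDl lerD //.
  rewrite (le_trans (ler_normD _ _)) // lerD //; rewrite normrM ler_wpM2l // ?normrX ?normrM.
    by rewrite ler_pXn2r // nnegrE.
  by rewrite expr2 ler_pM.
by rewrite normrM ler_wpM2l // normrX ler_pXn2r // nnegrE.
Qed.

Lemma continuous_qev q : continuous (qev q).
Proof. by move=> x; exact: has_grad_continuous (has_grad_qev q x). Qed.

Lemma qdxE q : qdx q = qev (Quad (q10 q) (2 * q20 q) (q11 q) 0 0 0).
Proof. by apply/funext => x; rewrite /qdx /qev /=; ring. Qed.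
Lemma qdyE q : qdy q = qev (Quad (q01 q) (q11 q) (2 * q02 q) 0 0 0).
Proof. by apply/funext => x; rewrite /qdy /qev /=; ring. Qed.

Lemma has_grad_qdx q x : has_grad (qdx q) x (2 * q20 q, q11 q).
Proof.
rewrite qdxE; apply: has_grad_eq (has_grad_qev _ x) _.
by rewrite /qdx /qdy /=; congr pair; ring.
Qed.
Lemma has_grad_qdy q x : has_grad (qdy q) x (q11 q, 2 * q02 q).
Proof.
rewrite qdyE; apply: has_grad_eq (has_grad_qev _ x) _.
by rewrite /qdx /qdy /=; congr pair; ring.
Qed.

Lemma ler_normD_le (a b A B : R) : `|a| <= A -> `|b| <= B -> `|a + b| <= A + B.
Proof. by move=> ha hb; rewrite (le_trans (ler_normD _ _)) // lerD. Qed.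

Definition qbound q (M : R) : R := `|q00 q| + `|q10 q| * M + `|q01 q| * M +
  `|q20 q| * M ^+ 2 + `|q11 q| * M ^+ 2 + `|q02 q| * M ^+ 2.

Lemma qev_bound q M x : `|x| <= M -> `|qev q x| <= qbound q M.
Proof.
move=> xM.
have h1 := le_trans (ler_normp1 x) xM; have h2 := le_trans (ler_normp2 x) xM.
have n1 := normr_ge0 x.1; have n2 := normr_ge0 x.2.
have M0 : 0 <= M by exact: le_trans n1 h1.
rewrite /qev /qbound; repeat apply: ler_normD_le; rewrite // normrM ler_wpM2l // ?normrX ?normrM.
- by rewrite ler_pXn2r // nnegrE.
- by rewrite expr2 ler_pM.
- by rewrite ler_pXn2r // nnegrE.
Qed.

End Quadratic.

(** * Coercivity and local surjectivity of quadratic maps *)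

Section QuadraticMap.
Variable R : realType.
Implicit Types (x y : R * R).
Variables q p : quad R.

Definition qmap x : R * R := (qev q x, qev p x).
Definition qjac x : R := qdx q x * qdy p x - qdy q x * qdx p x.

(** By [qev_sub], the difference of images is DF(m) applied to [x - y]; Cramer's rule inverts DF(m),
    with entries at most [A] and determinant at least [d] in absolute value. *)
Lemma qmap_coercive x y (A d : R) : let m := 2^-1 *: (x + y) in
  0 < d -> d <= `|qjac m| ->
  [/\ `|qdx q m| <= A, `|qdy q m| <= A, `|qdx p m| <= A & `|qdy p m| <= A] ->
  `|x - y| <= (2 * A / d) * `|qmap x - qmap y|.
Proof.
move=> m d0 dJ [a1 a2 a3 a4].
have A0 : 0 <= A by exact: le_trans a1.
have e1 : (qmap x - qmap y).1 = qdx q m * (x.1 - y.1) + qdy q m * (x.2 - y.2).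
  exact: qev_sub.
have e2 : (qmap x - qmap y).2 = qdx p m * (x.1 - y.1) + qdy p m * (x.2 - y.2).
  exact: qev_sub.
have f1 : qjac m * (x.1 - y.1) = qdy p m * (qmap x - qmap y).1 - qdy q m * (qmap x - qmap y).2.
  by rewrite e1 e2 /qjac; ring.
have f2 : qjac m * (x.2 - y.2) = - qdx p m * (qmap x - qmap y).1 - (- qdx q m) * (qmap x - qmap y).2.
  by rewrite e1 e2 /qjac; ring.
set E := qmap x - qmap y in e1 e2 f1 f2 *.
have E1 := ler_normp1 E; have E2 := ler_normp2 E.
have key (s u v : R) : qjac m * s = u * E.1 - v * E.2 -> `|u| <= A -> `|v| <= A ->
    `|s| <= 2 * A / d * `|E|.
  move=> h uA vA; rewrite mulrAC ler_pdivlMr // mulrC.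
  apply: (@le_trans _ _ `|qjac m * s|); first by rewrite normrM ler_wpM2r.
  rewrite h (le_trans (ler_normB _ _)) // !normrM.
  have := normr_ge0 E.1; have := normr_ge0 E.2; have := normr_ge0 u; have := normr_ge0 v.
  have := normr_ge0 E; nra.
rewrite prod_normE ge_max; apply/andP; split; apply: key.
- exact: f1.
- exact: a4.
- exact: a2.
- exact: f2.
- by rewrite normrN.
- by rewrite normrN.
Qed.

Definition qpart (r : quad R) : quad R * quad R :=
  (Quad (q10 r) (2 * q20 r) (q11 r) 0 0 0, Quad (q01 r) (q11 r) (2 * q02 r) 0 0 0).
Definition jacbound (M : R) : R :=
  qbound (qpart q).1 M + qbound (qpart q).2 M + qbound (qpart p).1 M + qbound (qpart p).2 M.

Lemma qbound_ge0 (r : quad R) M : 0 <= M -> 0 <= qbound r M.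
Proof. by move=> M0; rewrite /qbound !addr_ge0 ?mulr_ge0 ?exprn_ge0. Qed.

Lemma jacbound_ge0 M : 0 <= M -> 0 <= jacbound M.
Proof.
move=> M0; rewrite /jacbound.
by do 2! (apply: addr_ge0; last exact: qbound_ge0); apply: addr_ge0; exact: qbound_ge0.
Qed.

Lemma jacboundP x M : `|x| <= M ->
  [/\ `|qdx q x| <= jacbound M, `|qdy q x| <= jacbound M,
      `|qdx p x| <= jacbound M & `|qdy p x| <= jacbound M].
Proof.
move=> xM; have M0 : 0 <= M by exact: le_trans xM.
have h1 := qev_bound (qpart q).1 xM; have h2 := qev_bound (qpart q).2 xM.
have h3 := qev_bound (qpart p).1 xM; have h4 := qev_bound (qpart p).2 xM.
have g1 := qbound_ge0 (qpart q).1 M0; have g2 := qbound_ge0 (qpart q).2 M0.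
have g3 := qbound_ge0 (qpart p).1 M0; have g4 := qbound_ge0 (qpart p).2 M0.
by rewrite !qdxE !qdyE /jacbound; split; rewrite /= in h1 h2 h3 h4 g1 g2 g3 g4 *; lra.
Qed.

Lemma continuous_qjac : continuous qjac.
Proof.
have c (r : quad R) : continuous (qdx r) /\ continuous (qdy r).
  by split=> x; [exact: has_grad_continuous (has_grad_qdx r x)
                |exact: has_grad_continuous (has_grad_qdy r x)].
move=> x; apply: cvgB; apply: cvgM; first [exact: (c _).1|exact: (c _).2].
Qed.

Lemma cvg_ball (f : R * R -> R) x (e : R) : {for x, continuous f} -> 0 < e ->
  exists2 r, 0 < r & forall y, `|x - y| < r -> `|f x - f y| < e.
Proof.
move=> cf e0; have /cvgrPdist_lt/(_ _ e0)/nbhs_ballP[r /= r0 h] := cf.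
by exists r => // y xy; apply: h; rewrite -ball_normE.
Qed.

(* A minimiser [c] of |F - y|^2 over a small square is interior, and there DF(c)
   invertible yields a descent direction unless F c = y. *)
Lemma qmap_locally_onto x0 (r : R) : qjac x0 != 0 -> 0 < r ->
  exists2 rho, 0 < rho & forall y, `|y - qmap x0| < rho ->
    exists2 x, `|x - x0| < r & qmap x = y.
Proof.
move=> J0 r0.
have J2 : 0 < `|qjac x0| / 2 by rewrite divr_gt0 // normr_gt0.
have [s1 s10 hs1] := cvg_ball (@continuous_qjac x0) J2.
pose s := Num.min (r / 2) (s1 / 2).
have s0 : 0 < s by rewrite lt_min !divr_gt0.
have sr : s < r by rewrite gt_min; apply/orP; left; lra.
have ss1 : s < s1 by rewrite gt_min; apply/orP; right; lra.
have Jx x : `|x - x0| <= s -> `|qjac x0| / 2 <= `|qjac x|.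
  move=> xs; have := hs1 x; rewrite distrC => /(_ (le_lt_trans xs ss1)) h.
  by have := ler_normD (qjac x0 - qjac x) (qjac x); rewrite subrK; lra.
pose M := `|x0| + s.
have M0 : 0 <= M by rewrite addr_ge0 // ltW.
have xM x : `|x - x0| <= s -> `|x| <= M.
  by move=> h; have := ler_normD (x - x0) x0; rewrite subrK /M; lra.
pose K := 2 * (jacbound M + 1) / (`|qjac x0| / 2).
have jb0 := jacbound_ge0 M0.
have K0 : 0 < K by rewrite divr_gt0 // mulr_gt0 // ltr_pwDr.
have coer x : `|x - x0| <= s -> `|x - x0| <= K * `|qmap x - qmap x0|.
  move=> xs; apply: qmap_coercive => //.
    apply: Jx; rewrite (_ : _ - _ = 2^-1 *: (x - x0)); last first.
      case: (x) (x0) => [a b] [c d]; rewrite /GRing.scale /=.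
      by congr pair; rewrite /= /GRing.scale /=; field.
    by rewrite normrZ gtr0_norm ?invr_gt0 //; have := normr_ge0 (x - x0); lra.
  have m : `|2^-1 *: (x + x0)| <= M.
    have := xM x xs; have : `|x0| <= M by rewrite /M lerDl ltW.
    have := ler_normD x x0.
    by rewrite normrZ gtr0_norm ?invr_gt0 //; lra.
  by have [b1 b2 b3 b4] := jacboundP m; split; lra.
(* Call this radius [rho]. On the boundary of the square, coercivity puts [F x] at distance at least
   [s / K = 4 * rho] from [F x0], hence at least [3 * rho] from [y]. The value of [G] there is at
   least [9 * rho ^+ 2], against at most [2 * rho ^+ 2] at [x0], so no minimiser lies on the
   boundary. *)
exists (s / (4 * K)); first by rewrite divr_gt0 // mulr_gt0.
move=> y yx0.
pose G x := (qev q x - y.1) ^+ 2 + (qev p x - y.2) ^+ 2.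
have cG : continuous G.
  move=> x; apply: cvgD; apply: (@cvg_comp _ _ _ _ (fun t => t ^+ 2) _ (nbhs _));
    try exact: exprn_continuous; apply: cvgB; try exact: cvg_cst; exact: continuous_qev.
pose B := cbox ((x0.1 - s, x0.1 + s), (x0.2 - s, x0.2 + s)).
have BP x : x \in B <-> `|x - x0| <= s.
  rewrite inE prod_normE ge_max /= !ler_distl; split.
    by move=> [] /=; rewrite !in_itv /= => -> ->.
  by move=> /andP[h1 h2]; split; rewrite /= in_itv.
have B0 : B !=set0 by exists x0; apply/set_mem/BP; rewrite subrr normr0 ltW.
have [c /BP cs cmin] := compact_EVT_min B0 (@compact_cbox R _) (continuous_subspaceT cG).
set rho := s / (4 * K) in yx0 *.
have rho0 : 0 < rho by rewrite divr_gt0 // mulr_gt0.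
have Krho : K * (4 * rho) = s by rewrite /rho; field; rewrite gt_eqF.
have [y1 y2] : `|y.1 - qev q x0| < rho /\ `|y.2 - qev p x0| < rho.
  by move: yx0; rewrite prod_normE gt_max => /andP[].
have sq (a b : R) : 0 <= b -> `|a| <= b -> a ^+ 2 <= b ^+ 2.
  by move=> b0; rewrite ler_norml => /andP[h1 h2]; nra.
have sq' (a b : R) : 0 <= b -> b <= `|a| -> b ^+ 2 <= a ^+ 2.
  by move=> b0 h; rewrite -[leRHS]real_normK ?num_real // ler_pXn2r // nnegrE.
have Gx0 : G x0 <= 2 * rho ^+ 2.
  rewrite /G mulr2n mulrDl !mul1r lerD // sq ?ltW //; by rewrite distrC.
have cint : `|c - x0| < s.
  rewrite lt_neqAle cs andbT; apply/negP => /eqP ce.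
  have h4 : 4 * rho <= `|qmap c - qmap x0|.
    by have := coer c cs; rewrite ce -[X in X <= _]Krho ler_pM2l.
  have Gc : G c <= G x0 by apply: cmin; apply/BP; rewrite subrr normr0 ltW.
  have r3 : 0 <= 3 * rho by rewrite mulr_ge0 // ltW.
  have r9 : 2 * rho ^+ 2 < (3 * rho) ^+ 2 by nra.
  move: h4; rewrite prod_normE le_max => /orP[] h4.
    have /(sq' _ _ r3) h5 : 3 * rho <= `|qev q c - y.1|.
      have := ler_normD (qev q c - y.1) (y.1 - qev q x0); rewrite addrA subrK.
      by move: h4; rewrite /=; lra.
    have := sqr_ge0 (qev p c - y.2).
    by move: Gc Gx0 r9 h5; rewrite /G; lra.
  have /(sq' _ _ r3) h5 : 3 * rho <= `|qev p c - y.2|.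
    have := ler_normD (qev p c - y.2) (y.2 - qev p x0); rewrite addrA subrK.
    by move: h4; rewrite /=; lra.
  have := sqr_ge0 (qev q c - y.1).
  by move: Gc Gx0 r9 h5; rewrite /G; lra.
exists c; first exact: lt_trans cint sr.
apply: contrapT => nc.
set e1 := qev q c - y.1; set e2 := qev p c - y.2.
have E0 : 0 < e1 ^+ 2 + e2 ^+ 2.
  rewrite lt_neqAle addr_ge0 ?sqr_ge0 // andbT eq_sym; apply/negP.
  rewrite paddr_eq0 ?sqr_ge0 // !sqrf_eq0 !subr_eq0 => /andP[/eqP a1 /eqP a2].
  by apply: nc; rewrite /qmap a1 a2; case: (y).
have Jc : qjac c != 0 by rewrite -normr_gt0; exact: lt_le_trans J2 (Jx c cs).
(* [(h1, h2)] is the Newton step, DF(c) h = - (e1, e2). Along it the residual is exactly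
   [(1 - t) * e + t ^+ 2 * Q], with [Q] the second-order part. *)
pose h1 := - (qdy p c * e1 - qdy q c * e2) / qjac c.
pose h2 := - (qdx q c * e2 - qdx p c * e1) / qjac c.
pose Q1 := q20 q * h1 ^+ 2 + q11 q * (h1 * h2) + q02 q * h2 ^+ 2.
pose Q2 := q20 p * h1 ^+ 2 + q11 p * (h1 * h2) + q02 p * h2 ^+ 2.
have G' t : G (c + t *: (h1, h2)) = ((1 - t) * e1 + t ^+ 2 * Q1) ^+ 2 + ((1 - t) * e2 + t ^+ 2 * Q2) ^+ 2.
  rewrite /G !qev_taylor /Q1 /Q2 /= /GRing.scale /=.
  congr (_ ^+ 2 + _ ^+ 2); rewrite /h1 /h2 /e1 /e2; move: Jc; rewrite /qjac => Jc; field => //.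
pose S := e1 ^+ 2 + e2 ^+ 2 + 2 * `|e1 * Q1 + e2 * Q2| + (Q1 ^+ 2 + Q2 ^+ 2).
have S1 : e1 ^+ 2 + e2 ^+ 2 <= S.
  have := sqr_ge0 Q1; have := sqr_ge0 Q2; have := normr_ge0 (e1 * Q1 + e2 * Q2).
  by rewrite /S; lra.
have S0 : 0 < S by exact: lt_le_trans S1.
have d0 : 0 < s - `|c - x0| by rewrite subr_gt0.
have n0 : 0 < `|(h1, h2)| + 1 by rewrite ltr_pwDr.
(* The first bound gives [t ^+ 2 * S <= t * (e1 ^+ 2 + e2 ^+ 2)], so the linear decrease wins; the
   second keeps the new point in the square. *)
pose t := Num.min ((e1 ^+ 2 + e2 ^+ 2) / S) ((s - `|c - x0|) / (`|(h1, h2)| + 1)).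
have t0 : 0 < t by rewrite lt_min !divr_gt0.
have tS : t * S <= e1 ^+ 2 + e2 ^+ 2 by rewrite -ler_pdivlMr // ge_min lexx.
have th : t * (`|(h1, h2)| + 1) <= s - `|c - x0|.
  by rewrite -ler_pdivlMr // ge_min lexx orbT.
have tB : c + t *: (h1, h2) \in B.
  apply/BP; rewrite addrAC (le_trans (ler_normD _ _)) // normrZ gtr0_norm //.
  by rewrite -lerBrDl; apply: le_trans th; rewrite ler_wpM2l ?lerDl // ltW.
have := cmin _ tB; rewrite G'.
have t1 : t <= 1.
  by rewrite -(ler_pM2r S0) mul1r (le_trans tS).
have -> : G c = e1 ^+ 2 + e2 ^+ 2 by [].
have -> : ((1 - t) * e1 + t ^+ 2 * Q1) ^+ 2 + ((1 - t) * e2 + t ^+ 2 * Q2) ^+ 2 =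
  (e1 ^+ 2 + e2 ^+ 2) - 2 * t * (e1 ^+ 2 + e2 ^+ 2) + t ^+ 2 * (e1 ^+ 2 + e2 ^+ 2)
  + t ^+ 2 * (2 * (1 - t) * (e1 * Q1 + e2 * Q2)) + t ^+ 2 * (t ^+ 2 * (Q1 ^+ 2 + Q2 ^+ 2)).
  by ring.
apply/negP; rewrite -ltNge.
have w1 : 2 * (1 - t) * (e1 * Q1 + e2 * Q2) <= 2 * `|e1 * Q1 + e2 * Q2|.
  have := ler_norm (e1 * Q1 + e2 * Q2); have := normr_ge0 (e1 * Q1 + e2 * Q2).
  have : 0 <= 1 - t by rewrite subr_ge0.
  by nra.
have w2 : t ^+ 2 * (Q1 ^+ 2 + Q2 ^+ 2) <= Q1 ^+ 2 + Q2 ^+ 2.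
  by rewrite ler_piMl ?addr_ge0 ?sqr_ge0 // exprn_ile1 // ltW.
have w3 : t ^+ 2 * (2 * (1 - t) * (e1 * Q1 + e2 * Q2)) <= t ^+ 2 * (2 * `|e1 * Q1 + e2 * Q2|).
  by rewrite ler_wpM2l ?sqr_ge0.
have w4 : t ^+ 2 * (t ^+ 2 * (Q1 ^+ 2 + Q2 ^+ 2)) <= t ^+ 2 * (Q1 ^+ 2 + Q2 ^+ 2).
  by rewrite ler_wpM2l ?sqr_ge0.
have w5 : t * (t * S) <= t * (e1 ^+ 2 + e2 ^+ 2) by rewrite ler_wpM2l // ltW.
have w6 : 0 < t * (e1 ^+ 2 + e2 ^+ 2) by rewrite mulr_gt0.
move: w5; rewrite mulrA -expr2 /S !mulrDr => w5.
by move: w3 w4 w5 w6; rewrite !mulrDr; lra.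
Qed.

End QuadraticMap.

(** * Derivative of the inverse map and the Piola identity *)

Section QuadraticInverse.
Variable R : realType.
Implicit Types (x y : R * R).
Variables q p : quad R.
Local Notation F := (qmap q p).
Local Notation J := (qjac q p).

(** Solving the Taylor expansion of F at [x0] for [x - x0] by Cramer's rule leaves a term quadratic
    in [x - x0], hence quadratic in [F x - F x0] by the Lipschitz bound on the inverse. Local
    surjectivity ensures that every point near [F x0] is of the form [F x]. *)
Lemma qmap_inverse_grad (F' : R * R -> R * R) (O : set (R * R)) x0 (K rho : R) :
  J x0 != 0 -> O x0 -> (forall x, O x -> F' (F x) = x) -> 0 < rho ->
  (forall y, `|y - F x0| < rho -> exists2 x, O x & F x = y) ->
  (forall x, O x -> `|x - x0| <= K * `|F x - F x0|) ->
  has_grad (fun y => (F' y).1) (F x0) (qdy p x0 / J x0, - qdy q x0 / J x0) /\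
  has_grad (fun y => (F' y).2) (F x0) (- qdx p x0 / J x0, qdx q x0 / J x0).
Proof.
move=> J0 Ox0 F'K rho0 onto lip.
set a := qdx q x0; set b := qdy q x0; set c := qdx p x0; set d := qdy p x0.
have Jd : J x0 = a * d - b * c by [].
pose r1 k := q20 q * k.1 ^+ 2 + q11 q * (k.1 * k.2) + q02 q * k.2 ^+ 2 : R.
pose r2 k := q20 p * k.1 ^+ 2 + q11 p * (k.1 * k.2) + q02 p * k.2 ^+ 2 : R.
have rE (s : quad R) k : `|q20 s * k.1 ^+ 2 + q11 s * (k.1 * k.2) + q02 s * k.2 ^+ 2| <=
    (`|q20 s| + `|q11 s| + `|q02 s|) * `|k| ^+ 2.
  have h1 := ler_normp1 k; have h2 := ler_normp2 k.
  have n1 := normr_ge0 k.1; have n2 := normr_ge0 k.2.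
  rewrite !mulrDl; repeat apply: ler_normD_le; rewrite // normrM ler_wpM2l // ?normrX ?normrM.
  - by rewrite ler_pXn2r // nnegrE.
  - by rewrite expr2 ler_pM.
  - by rewrite ler_pXn2r // nnegrE.
pose Cq := `|q20 q| + `|q11 q| + `|q02 q|; pose Cp := `|q20 p| + `|q11 p| + `|q02 p|.
have K2 x : O x -> `|x - x0| ^+ 2 <= K ^+ 2 * `|F x - F x0| ^+ 2.
  by move=> /lip h; rewrite -exprMn ler_pXn2r // nnegrE ?(le_trans _ h).
have key h : `|h| < rho -> exists2 x, O x & [/\ h + F x0 = F x, 
    F x0 + h = F x &
    h.1 = a * (x - x0).1 + b * (x - x0).2 + r1 (x - x0) /\
    h.2 = c * (x - x0).1 + d * (x - x0).2 + r2 (x - x0)].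
  move=> hr; have [x Ox Fx] : exists2 x, O x & F x = h + F x0.
    by apply: onto; rewrite addrK.
  exists x => //; split => //; first by rewrite addrC.
  have e1 : h.1 = qev q x - qev q x0.
    have -> : h = F x - F x0 by rewrite Fx addrK.
    by [].
  have e2 : h.2 = qev p x - qev p x0.
    have -> : h = F x - F x0 by rewrite Fx addrK.
    by [].
  have xE : x = x0 + (x - x0) by rewrite addrC subrK.
  rewrite e1 e2 xE !qev_taylor -xE /r1 /r2 -/a -/b -/c -/d.
  by split; ring.
have bnd (u v : R) x h : O x -> h + F x0 = F x ->
    `|- (u * r1 (x - x0) - v * r2 (x - x0)) / J x0| <=
    (`|u| * Cq + `|v| * Cp) / `|J x0| * K ^+ 2 * `|h| ^+ 2.
  move=> Ox hF; have hE : h = F x - F x0 by rewrite -hF addrK.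
  rewrite normrM normfV normrN.
  have -> : (`|u| * Cq + `|v| * Cp) / `|J x0| * K ^+ 2 * `|h| ^+ 2 =
    (`|u| * Cq + `|v| * Cp) * (K ^+ 2 * `|h| ^+ 2) / `|J x0| by ring.
  rewrite ler_wpM2r ?invr_ge0 // (@le_trans _ _ ((`|u| * Cq + `|v| * Cp) * `|x - x0| ^+ 2)) //.
    rewrite mulrDl (le_trans (ler_normB _ _)) // lerD // normrM -mulrA ler_wpM2l //; exact: rE.
  by rewrite ler_wpM2l ?hE ?K2 // addr_ge0 // mulr_ge0 // !addr_ge0.
split.
  apply: (@has_grad_remainder _ _ _ _ ((`|d| * Cq + `|b| * Cp) / `|J x0| * K ^+ 2) rho) => // h hr.
  have [x Ox [hF _ [h1 h2]]] := key h hr.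
  rewrite hF !F'K // /lin2 /= (_ : _ - _ = - (d * r1 (x - x0) - b * r2 (x - x0)) / J x0).
    exact: bnd.
  rewrite h1 h2 /=.
  by move: J0; rewrite Jd => J0; field.
apply: (@has_grad_remainder _ _ _ _ ((`|- c| * Cq + `|- a| * Cp) / `|J x0| * K ^+ 2) rho) => // h hr.
have [x Ox [hF _ [h1 h2]]] := key h hr.
rewrite hF !F'K // /lin2 /= (_ : _ - _ = - (- c * r1 (x - x0) - (- a) * r2 (x - x0)) / J x0).
  exact: bnd.
rewrite h1 h2 /=.
by move: J0; rewrite Jd => J0; field.
Qed.

(* For [s = q] and [s = p], the two components of the Piola transform of [(w0, w1)]. *)
Definition pio (s : quad R) (w0 w1 : quad R) x : R :=
  (qdx s x * qev w0 x + qdy s x * qev w1 x) / J x.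

(** [pdx] and [pdy] are the partial derivatives of [pio s w0 w1] written out by the quotient
    rule. *)
Definition pdx (s w0 w1 : quad R) x : R :=
  ((2 * q20 s * qev w0 x + q11 s * qev w1 x + qdx s x * qdx w0 x + qdy s x * qdx w1 x) * J x
   - (qdx s x * qev w0 x + qdy s x * qev w1 x) *
     (2 * q20 q * qdy p x + qdx q x * q11 p - q11 q * qdx p x - qdy q x * (2 * q20 p))) / J x ^+ 2.
Definition pdy (s w0 w1 : quad R) x : R :=
  ((q11 s * qev w0 x + 2 * q02 s * qev w1 x + qdx s x * qdy w0 x + qdy s x * qdy w1 x) * J x
   - (qdx s x * qev w0 x + qdy s x * qev w1 x) *
     (q11 q * qdy p x + qdx q x * (2 * q02 p) - 2 * q02 q * qdx p x - qdy q x * q11 p)) / J x ^+ 2.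

Lemma has_grad_pio s w0 w1 x : J x != 0 ->
  has_grad (pio s w0 w1) x (pdx s w0 w1 x, pdy s w0 w1 x).
Proof.
move=> J0.
have gN := has_gradD (has_gradM (has_grad_qdx s x) (has_grad_qev w0 x))
                     (has_gradM (has_grad_qdy s x) (has_grad_qev w1 x)).
have gJ : has_grad J x (2 * q20 q * qdy p x + qdx q x * q11 p - q11 q * qdx p x - qdy q x * (2 * q20 p),
   q11 q * qdy p x + qdx q x * (2 * q02 p) - 2 * q02 q * qdx p x - qdy q x * q11 p).
  have h1 := has_gradM (has_grad_qdx q x) (has_grad_qdy p x).
  have h2 := has_gradM (has_grad_qdy q x) (has_grad_qdx p x).
  have h3 := has_gradM (has_grad_cst (-1) x) h2.
  apply: has_grad_near (has_grad_eq (has_gradD h1 h3) _) => //.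
  + by move=> y _; rewrite /qjac /cst; ring.
  + by rewrite /GRing.scale /= /GRing.scale /=; congr pair; rewrite /= /GRing.scale /=; ring.
have dV : is_derive (J x) (1:R) (fun t : R => t^-1) (- (J x ^- 2)).
  have := @is_deriveV R idfun (J x) 1 1 J0 (is_derive_id _ _).
  by move/is_derive_eq; apply; rewrite /GRing.scale /= mulr1.
have := has_gradM gN (has_grad_comp1 dV gJ).
move/has_grad_eq; apply.
by rewrite /pdx /pdy; congr pair; rewrite /= /GRing.scale /=; field.
Qed.

(** The left-hand side is the trace of the derivative of the Piola field times the inverse of DF,
    that is, the divergence in image coordinates. The columns of the cofactor matrix are
    divergence-free, so all second derivatives of F cancel. *)
Lemma piola_identity w0 w1 x : J x != 0 ->
  pdx q w0 w1 x * (qdy p x / J x) + pdy q w0 w1 x * (- qdx p x / J x) +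
  (pdx p w0 w1 x * (- qdy q x / J x) + pdy p w0 w1 x * (qdx q x / J x)) =
  (qdx w0 x + qdy w1 x) / J x.
Proof.
rewrite /pdx /pdy /qjac; move: (qdx q x) (qdy q x) (qdx p x) (qdy p x) => a b c d J0.
by field.
Qed.
End QuadraticInverse.

(** * Identification of a weak divergence on open pieces *)

Section WeakDivergence.
Variable R : realType.
Implicit Types (x y : R * R) (D S : set (R * R)).

Lemma near_ball x (P : set (R * R)) r : 0 < r -> (forall y, `|x - y| < r -> P y) ->
  \forall y \near x, P y.
Proof.
by move=> r0 h; apply/nbhs_ballP; exists r => //= y; rewrite -ball_normE; exact: h.
Qed.

Lemma continuous_near (f g : R * R -> R) x r : 0 < r ->
  (forall y, `|x - y| < r -> f y = g y) -> {for x, continuous f} -> {for x, continuous g}.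
Proof.
move=> r0 fg cf; have fgx : f x = g x by apply: fg; rewrite subrr normr0.
have nfg : \forall y \near x, f y = g y by apply: near_ball r0 _ => y /fg.
have : g y @[y --> x] --> f x by apply: cvg_trans cf; exact: near_eq_cvg nfg.
by rewrite fgx.
Qed.

Lemma restrict_in D (f : R * R -> R) x : D x -> (f \_ D) x = f x.
Proof. by move=> Dx; rewrite patchE mem_set. Qed.

Lemma restrict_out D (f : R * R -> R) x : ~ D x -> (f \_ D) x = 0.
Proof. by move=> Dx; rewrite patchE memNset. Qed.

Lemma continuous_restrict D S (f psi : R * R -> R) : open D -> closed S -> S `<=` D ->
  (forall x, D x -> {for x, continuous f}) -> continuous psi ->
  (forall x, ~ S x -> psi x = 0) -> continuous ((fun x => f x * psi x) \_ D).
Proof.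
move=> oD cS SD cf cpsi psi0 x.
have [Sx|nSx] := pselect (S x).
  have Dx := SD _ Sx; have [r r0 xr] := open_ballP oD Dx.
  apply: (@continuous_near (fun x => f x * psi x) _ _ r) => //.
    by move=> y /xr Dy; rewrite restrict_in.
  by apply: cvgM; [exact: cf|exact: cpsi].
have [r r0 xr] := open_ballP (closed_openC cS) nSx.
apply: (@continuous_near (fun=> 0) _ _ r) => //; last exact: cvg_cst.
move=> y /xr nSy; have [Dy|nDy] := pselect (D y).
  by rewrite restrict_in // psi0 ?mulr0.
by rewrite restrict_out.
Qed.

Lemma partial_outside_support D (phi : R * R -> R) j x : C1c D phi ->
  ~ closure [set x | phi x != 0] x -> partial j phi x = 0.
Proof.
move=> Cphi nSx; have [r r0 xr] := open_ballP (closed_openC (@closed_closure _ _)) nSx.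
rewrite /partial (@near_eq_derive _ _ _ phi (cst 0)) ?derive_cst //.
apply: near_ball r0 _ => y /xr nSy; apply: contrapT => /eqP h; apply: nSy.
exact: subset_closure.
Qed.

Lemma is_derive_near (f g : R * R -> R) x v (d r : R) : 0 < r ->
  (forall y, `|x - y| < r -> f y = g y) -> is_derive x v f d -> is_derive x v g d.
Proof.
move=> r0 fg [df dv]; have nfg : \forall y \near x, f y = g y by exact: near_ball r0 _.
split; last by rewrite -(near_eq_derive _ nfg).
by apply: near_eq_derivable df.
Qed.

Lemma C1c_sub D E (phi : R * R -> R) : D `<=` E -> C1c D phi -> C1c E phi.
Proof. by move=> DE [h1 h2 h3 h4]; split => //; exact: subset_trans DE. Qed.

(** [w] is controlled inside [D] only; the product [w * phi], extended by 0, has a continuous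
    derivative on the whole plane, and that derivative integrates to 0. *)
Lemma integral_by_parts_C1c D (w d phi : R * R -> R) (j : 'I_2) (M : R) :
  open D -> (forall x, D x -> `|x| <= M) -> C1c D phi ->
  (forall x, D x -> is_derive x (dirv R j) w (d x)) ->
  (forall x, D x -> {for x, continuous w}) -> (forall x, D x -> {for x, continuous d}) ->
  [/\ (@mu2 R).-integrable D (EFin \o (fun x => d x * phi x)),
      (@mu2 R).-integrable D (EFin \o (fun x => w x * partial j phi x)) &
      \int[@mu2 R]_(x in D) (d x * phi x) = - \int[@mu2 R]_(x in D) (w x * partial j phi x)].
Proof.
move=> oD DM Cphi dw cw cd; have mD := open_measurable2 oD.
have [dphi cdphi _ SD] := Cphi; set S := closure _ in SD.
have cS : closed S by exact: closed_closure.
have phi0 x : ~ S x -> phi x = 0.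
  by move=> nSx; apply: contrapT => /eqP h; apply: nSx; exact: subset_closure.
have pphi0 x : ~ S x -> partial j phi x = 0 by exact: (@partial_outside_support D phi j x Cphi).
have c1 := continuous_restrict oD cS SD cd (C1c_continuous Cphi) phi0.
have c2 := continuous_restrict oD cS SD cw (cdphi j) pphi0.
have out f x : M < `|x| -> (f \_ D) x = 0 :> R.
  by move=> Mx; rewrite restrict_out // => /DM; rewrite leNgt Mx.
have i1 := integrable_continuous_bounded_support c1 (out _).
have i2 := integrable_continuous_bounded_support c2 (out _).
have restr f : (@mu2 R).-integrable setT (EFin \o (f \_ D)) -> (@mu2 R).-integrable D (EFin \o f).
  move=> fi; have := integrable2S measurableT mD (@subsetT _ D) fi.
  apply: eq_integrable => // x; rewrite inE => Dx /=.
  by rewrite restrict_in.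
have I1 : (@mu2 R).-integrable D (EFin \o (fun x => d x * phi x)).
  exact: restr.
have I2 : (@mu2 R).-integrable D (EFin \o (fun x => w x * partial j phi x)).
  exact: restr.
split=> //; apply/eqP; rewrite -addr_eq0 -Rintegral2D //.
rewrite Rintegral_mkcond; apply/eqP.
apply: (@integral_partial_bounded_support _ j ((fun x => w x * phi x) \_ D) _ M).
- move=> x; have [Sx|nSx] := pselect (S x).
    have Dx := SD _ Sx; have [r r0 xr] := open_ballP oD Dx.
    rewrite restrict_in //.
    apply: (@is_derive_near (fun x => w x * phi x) _ _ _ _ r) => //.
      by move=> y /xr Dy; rewrite restrict_in.
    have hp : is_derive x (dirv R j) phi (partial j phi x).
      by split => //; exact: diff_derivable.
    have := is_deriveM (dw x Dx) hp; move/is_derive_eq; apply.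
    by rewrite /GRing.scale /=; ring.
  have [r r0 xr] := open_ballP (closed_openC cS) nSx.
  have -> : ((fun x => d x * phi x + w x * partial j phi x) \_ D) x = 0.
    rewrite patchE; case: ifP => // _; rewrite phi0 // pphi0 // !mulr0; exact: addr0.
  apply: (@is_derive_near (fun=> 0) _ _ _ _ r) => //.
    move=> y /xr nSy; rewrite patchE; case: ifP => // _; by rewrite phi0 // mulr0.
- rewrite [X in continuous X](_ : _ = fun x => ((fun x => d x * phi x) \_ D) x +
      ((fun x => w x * partial j phi x) \_ D) x).
    by move=> x; apply: cvgD; [exact: c1|exact: c2].
  by apply/funext => x; rewrite !patchE; case: ifP => // _; rewrite addr0.
- exact: out.
Qed.

Lemma Rintegral_subset D E (f : R * R -> R) : D `<=` E ->
  (forall x, E x -> ~ D x -> f x = 0) ->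
  \int[@mu2 R]_(x in E) f x = \int[@mu2 R]_(x in D) f x.
Proof.
move=> DE f0; rewrite Rintegral_mkcond [RHS]Rintegral_mkcond; congr Rintegral.
apply/funext => x; have [Dx|nDx] := pselect (D x).
  by rewrite !restrict_in //; exact: DE.
rewrite (restrict_out _ nDx); have [Ex|nEx] := pselect (E x).
  by rewrite restrict_in // f0.
exact: restrict_out.
Qed.

Lemma continuous_support_bounded (S : set (R * R)) (f : R * R -> R) : compact S ->
  continuous f -> (forall x, ~ S x -> f x = 0) -> exists2 B, 0 <= B & forall x, `|f x| <= B.
Proof.
move=> cS cf f0.
have [S0|nS] := pselect (S !=set0).
  have cn : {within S, continuous (fun x => `|f x|)}.
    by apply: continuous_subspaceT => x; apply: cvg_norm; exact: cf.
  have [c _ cmax] := compact_EVT_max S0 cS cn.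
  exists `|f c| => // x; have [Sx|/f0->] := pselect (S x); last by rewrite normr0.
  by apply: cmax; rewrite inE.
exists 0 => // x; rewrite f0 ?normr0 // => Sx; by apply: nS; exists x.
Qed.

Lemma C1c_bounded D (phi : R * R -> R) : C1c D phi -> exists B, forall x, `|phi x| <= B.
Proof.
move=> Cphi; have [_ _ cS _] := Cphi.
have [|B _ hB] := continuous_support_bounded cS (C1c_continuous Cphi); last by exists B.
move=> x nS; apply: contrapT => /eqP p0; apply: nS; exact: subset_closure.
Qed.

Lemma sum_I2 (F : 'I_2 -> R) : \sum_j F j = F ord0 + F ord_max.
Proof.
rewrite big_ord_recl big_ord_recl big_ord0 addr0; congr (_ + F _).
exact: val_inj.
Qed.

(** A test function of [D] is one of [Om], so the definition of [g] can be tested inside a single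
    piece. Integration by parts there shows that [g] minus the classical divergence annihilates all
    test functions; the bound [C] provides its integrability. *)
Lemma weak_divergence_ae Om D (u : R * R -> R * R) (g : R * R -> R)
    (w d : 'I_2 -> R * R -> R) (M C : R) :
  open Om -> (forall x, Om x -> `|x| <= M) -> Hdiv_with Om u g ->
  open D -> D `<=` Om ->
  (forall j x, D x -> Defs.comp j u x = w j x) ->
  (forall j x, D x -> is_derive x (dirv R j) (w j) (d j x)) ->
  (forall j x, D x -> {for x, continuous (w j)}) ->
  (forall j x, D x -> {for x, continuous (d j)}) ->
  (forall x, D x -> `|\sum_j d j x| <= C) ->
  {ae @mu2 R, forall x, D x -> g x = \sum_j d j x}.
Proof.
move=> oO OM [uL2 gL2 ug] oD DO uw dw cw cd dC.
have mO := open_measurable2 oO; have mD := open_measurable2 oD.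
have DM x : D x -> `|x| <= M by move=> /DO; exact: OM.
have gi : (@mu2 R).-integrable D (EFin \o g).
  apply: (integrable2S mO mD DO); apply: in_L2_integrable => //.
  exact: mu2_bounded_lty OM.
have E (f : 'I_2 -> R * R -> R) : (fun x => \sum_j f j x) = (fun x => f ord0 x + f ord_max x).
  by apply/funext => x; rewrite sum_I2.
have cS : forall x, D x -> {for x, continuous (fun x => \sum_j d j x)}.
  by move=> x Dx; rewrite E; apply: cvgD; exact: cd.
have mS : measurable_fun D (fun x => \sum_j d j x) by exact: open_continuous_measurable_fun2.
have di : (@mu2 R).-integrable D (EFin \o (fun x => \sum_j d j x)).
  exact: (integrable2_bounded mD (mu2_bounded_lty mD DM) mS dC).
have fi := integrable2B mD gi di.
suff : {ae @mu2 R, forall x, D x -> g x - \sum_j d j x = 0}.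
  by apply: ae2S => x h /h /eqP; rewrite subr_eq0 => /eqP.
apply: (du_bois_reymond oD fi) => phi Cphi.
have mphi : measurable_fun D phi.
  apply: (@measurable_funS _ _ _ _ setT) => //; apply: continuous_measurable_fun2.
  exact: C1c_continuous Cphi.
have out j := integral_by_parts_C1c oD DM Cphi (dw j) (cw j) (cd j).
have [i1 j1 e1] := out ord0; have [i2 j2 e2] := out ord_max.
have gphi : (@mu2 R).-integrable D (EFin \o (fun x => g x * phi x)).
  have [B phiB] := C1c_bounded Cphi.
  by apply: (integrable2_Mbounded mD gi mphi) => x _; exact: phiB.
have -> : (fun x => (g x - \sum_j d j x) * phi x) =
  (fun x => g x * phi x - (d ord0 x * phi x + d ord_max x * phi x)).
  by apply/funext => x; rewrite sum_I2; ring.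
rewrite Rintegral2B //; last exact: integrable2D.
rewrite Rintegral2D // e1 e2 -opprD -Rintegral2D // opprK.
have : \int[@mu2 R]_(x in Om) (\sum_j Defs.comp j u x * partial j phi x) =
    - \int[@mu2 R]_(x in Om) (g x * phi x) by exact: ug (C1c_sub DO Cphi).
have pphi0 x : ~ D x -> forall j, partial j phi x = 0.
  move=> nDx j; apply: (@partial_outside_support D) => // Sx.
  by have [_ _ _ sD] := Cphi; apply: nDx; exact: sD.
have -> : \int[@mu2 R]_(x in Om) (\sum_j Defs.comp j u x * partial j phi x) =
    \int[@mu2 R]_(x in D) (w ord0 x * partial ord0 phi x + w ord_max x * partial ord_max phi x).
  rewrite (@Rintegral_subset D Om (fun x => \sum_j Defs.comp j u x * partial j phi x)) //.
    by apply: eq_Rintegral => x; rewrite inE => Dx; rewrite sum_I2 !uw.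
  by move=> x _ nDx; rewrite big1 // => j _; rewrite pphi0 ?mulr0.
rewrite (@Rintegral_subset D Om (fun x => g x * phi x)) //.
  by move=> ->; rewrite addrN.
by move=> x _ nDx; rewrite (C1c_outside Cphi nDx) mulr0.
Qed.
End WeakDivergence.

(** * Barycentric coordinates on the reference triangle *)

Section Barycentric.
Variable R : realType.
Implicit Types (x y : R * R) (a b k : 'I_3).

Definition lam a x : R :=
  match val a with 0%N => x.1 | 1%N => x.2 | _ => 1 - x.1 - x.2 end.

Lemma I3P (P : 'I_3 -> Prop) : P (@Ordinal 3 0 isT) -> P (@Ordinal 3 1 isT) ->
  P (@Ordinal 3 2 isT) -> forall a, P a.
Proof.
move=> h0 h1 h2 [[|[|[|//]]] ha].
- by rewrite (_ : Ordinal ha = @Ordinal 3 0 isT) //; exact: val_inj.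
- by rewrite (_ : Ordinal ha = @Ordinal 3 1 isT) //; exact: val_inj.
- by rewrite (_ : Ordinal ha = @Ordinal 3 2 isT) //; exact: val_inj.
Qed.

Lemma sum_I3 (V : nmodType) (F : 'I_3 -> V) :
  \sum_a F a = F (@Ordinal 3 0 isT) + F (@Ordinal 3 1 isT) + F (@Ordinal 3 2 isT).
Proof.
rewrite !big_ord_recl big_ord0 addr0 addrA.
by congr (F _ + F _ + F _); exact: val_inj.
Qed.

Lemma sum_I3_perm (V : nmodType) (F : 'I_3 -> V) a b k :
  a != b -> a != k -> b != k -> \sum_c F c = F a + F b + F k.
Proof.
move=> ab ak bk; rewrite (bigD1 a) //= (bigD1 b) 1?eq_sym //= (bigD1 k) ?[k == _]eq_sym ?ak ?bk //=.
rewrite big1 ?addr0 ?addrA //; move: ab ak bk.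
elim/I3P: a; elim/I3P: b; elim/I3P: k => //= _ _ _; elim/I3P => //.
Qed.

Lemma other k : exists a, a != k.
Proof.
by elim/I3P: k; [exists (@Ordinal 3 1 isT)|exists (@Ordinal 3 0 isT)|exists (@Ordinal 3 0 isT)].
Qed.

Lemma third a b : a != b -> exists k, a != k /\ b != k.
Proof.
elim/I3P: a; elim/I3P: b => //= _; by
 first [by exists (@Ordinal 3 0 isT)|by exists (@Ordinal 3 1 isT)|by exists (@Ordinal 3 2 isT)].
Qed.

Lemma sum_lam x : \sum_a lam a x = 1.
Proof. by rewrite sum_I3 /lam /=; ring. Qed.

Lemma sum_lam_rv x : \sum_a lam a x *: rv R a = x.
Proof.
rewrite sum_I3 /lam /rv /=; case: x => x1 x2; rewrite /GRing.scale /=.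
by congr pair; rewrite /= /GRing.scale /=; ring.
Qed.

Lemma lam_comb (l : 'I_3 -> R) a : \sum_b l b = 1 -> lam a (\sum_b l b *: rv R b) = l a.
Proof.
rewrite !sum_I3 => h; elim/I3P: a; rewrite /lam /rv /= /GRing.scale /= /GRing.scale /=.
- by ring.
- by ring.
- by move: h; lra.
Qed.

Lemma lam_rv a b : lam a (rv R b) = (a == b)%:R.
Proof. by elim/I3P: a; elim/I3P: b; rewrite /lam /rv /=; ring. Qed.

Lemma lamD a t x y : lam a ((1 - t) *: x + t *: y) = (1 - t) * lam a x + t * lam a y.
Proof.
case: x y => [x1 x2] [y1 y2]; elim/I3P: a; rewrite /lam /= /GRing.scale /= /GRing.scale /=; ring.
Qed.

Lemma lam_edge_l a b t : a != b -> lam a ((1 - t) *: rv R a + t *: rv R b) = 1 - t.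
Proof. by move=> ab; rewrite lamD !lam_rv eqxx (negbTE ab) mulr1 mulr0 addr0. Qed.

Lemma lam_edge_r a b t : a != b -> lam b ((1 - t) *: rv R a + t *: rv R b) = t.
Proof. by move=> ab; rewrite lamD !lam_rv eqxx eq_sym (negbTE ab) mulr1 mulr0 add0r. Qed.

Lemma lam_edge_0 a b k t : a != k -> b != k -> lam k ((1 - t) *: rv R a + t *: rv R b) = 0.
Proof.
by move=> ak bk; rewrite lamD !lam_rv ![k == _]eq_sym (negbTE ak) (negbTE bk) !mulr0 addr0.
Qed.

Lemma lam_sub a x y : `|lam a x - lam a y| <= 2 * `|x - y|.
Proof.
have h1 := ler_normp1 (x - y); have h2 := ler_normp2 (x - y).
have e1 : (x - y).1 = x.1 - y.1 by []. have e2 : (x - y).2 = x.2 - y.2 by [].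
rewrite e1 e2 in h1 h2; have n := normr_ge0 (x - y).
elim/I3P: a; rewrite /lam /=; [lra|lra|].
have -> : 1 - x.1 - x.2 - (1 - y.1 - y.2) = - ((x.1 - y.1) + (x.2 - y.2)) by ring.
by rewrite normrN (le_trans (ler_normD _ _)) //; lra.
Qed.

Lemma ThatP x : @That R x <-> forall a, 0 <= lam a x.
Proof.
split=> [[l [l0 l1 ->]] a|h]; first by rewrite lam_comb.
by exists (fun a => lam a x); split => //; [exact: sum_lam|rewrite sum_lam_rv].
Qed.

(** With vertex [k] replaced by the barycentre, the weight [l k] is spread equally: the coordinate
    [k] becomes [l k / 3] and any other [l a + l k / 3]. The subtriangle is therefore where [lam k]
    is the smallest coordinate. *)
Lemma KhatP k x : @Khat R k x <-> 0 <= lam k x /\ forall a, lam k x <= lam a x.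
Proof.
split=> [[l [l0 l1 ->]]|[h0 h]].
  have E : \sum_a l a *: (if a == k then bary R else rv R a) =
     \sum_a (3^-1 * l k + (if a == k then 0 else l a)) *: rv R a.
    move: l1; rewrite !sum_I3 /bary !sum_I3; elim/I3P: k => /= l1;
      rewrite /rv /= /GRing.scale /= /GRing.scale /=; congr pair;
      rewrite /= /GRing.scale /=; by field.
  have S : \sum_a (3^-1 * l k + (if a == k then 0 else l a)) = 1.
    by move: l1; rewrite !sum_I3; elim/I3P: k {E} => /= l1; rewrite -[RHS]l1; by field.
  rewrite E; split=> [|a]; rewrite !lam_comb // eqxx addr0.
    by rewrite mulr_ge0.
  by case: ifP => _; rewrite ?addr0 // lerDl.
exists (fun a => if a == k then 3 * lam k x else lam a x - lam k x); split.
- by move=> a; case: ifP => _; rewrite ?mulr_ge0 // subr_ge0.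
- have := sum_lam x; rewrite !sum_I3; elim/I3P: k {h0 h} => /= h; rewrite -[RHS]h; ring.
- rewrite -[LHS]sum_lam_rv !sum_I3 /bary !sum_I3; elim/I3P: k {h0 h}; rewrite /lam /rv /=;
    case: x => x1 x2; rewrite /GRing.scale /= /GRing.scale /=; congr pair;
    rewrite /= /GRing.scale /=; by field.
Qed.

Definition Tint : set (R * R) := [set x | forall a, 0 < lam a x].
Definition Kint k : set (R * R) :=
  [set x | 0 < lam k x /\ forall a, a != k -> lam k x < lam a x].

Lemma Tint_That : Tint `<=` @That R.
Proof. by move=> x h; apply/ThatP => a; exact: ltW. Qed.

Lemma Kint_Tint k : Kint k `<=` Tint.
Proof.
move=> x [h0 h] a; have [->//|ak] := eqVneq a k.
exact: lt_trans h0 (h a ak).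
Qed.

Lemma Kint_Khat k : Kint k `<=` @Khat R k.
Proof.
move=> x [h0 h]; apply/KhatP; split; first exact: ltW.
by move=> a; have [->//|ak] := eqVneq a k; exact/ltW/h.
Qed.

Lemma Kint_disj k l x : Kint k x -> Kint l x -> k = l.
Proof.
move=> [_ h1] [_ h2]; apply/eqP/negPn/negP => kl.
have := h2 k kl; rewrite ltNge ltW // h1 // eq_sym //.
Qed.

Lemma open_lam_lt a (c : R) x : c < lam a x ->
  exists2 r, 0 < r & forall y, `|x - y| < r -> c < lam a y.
Proof.
move=> h; exists ((lam a x - c) / 2); first by rewrite divr_gt0 // subr_gt0.
by move=> y xy; have := lam_sub a x y; rewrite ler_norml => /andP[h1 h2]; lra.
Qed.

Lemma open_forall3 (P : 'I_3 -> set (R * R)) :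
  (forall a, open (P a)) -> open [set x | forall a, P a x].
Proof.
move=> oP; apply: openP => x h.
have H a : exists r : R, 0 < r /\ forall y, `|x - y| < r -> P a y.
  by have [r r0 xr] := open_ballP (oP a) (h a); exists r.
have [r rP] := choice H.
exists (Num.min (r (@Ordinal 3 0 isT)) (Num.min (r (@Ordinal 3 1 isT)) (r (@Ordinal 3 2 isT)))).
  by rewrite !lt_min !(rP _).1.
by move=> y; rewrite !lt_min => /and3P[h0 h1 h2]; elim/I3P; exact: (rP _).2.
Qed.

Lemma open_Tint : open Tint.
Proof.
by apply: (@open_forall3 (fun a => [set x | 0 < lam a x])) => a; apply: openP => x; exact: open_lam_lt.
Qed.

Lemma open_Kint k : open (Kint k).
Proof.
rewrite (_ : Kint k = [set x | forall a, (if a == k then 0 < lam k x else lam k x < lam a x)]).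
  apply: (@open_forall3 (fun a => [set x | (if a == k then 0 < lam k x else lam k x < lam a x)])) => a.
  apply: openP => x /=; case: ifP => _; first exact: open_lam_lt.
  move=> h; exists ((lam a x - lam k x) / 4); first by rewrite divr_gt0 // subr_gt0.
  move=> y xy; have := lam_sub a x y; have := lam_sub k x y.
  by rewrite !ler_norml => /andP[h1 h2] /andP[h3 h4]; lra.
apply/seteqP; split=> [x [h0 h] a|x h].
  by case: ifPn => // /h.
split; first by have := h k; rewrite eqxx.
by move=> a /negbTE ak; have := h a; rewrite ak.
Qed.

(** A nonconstant affine function that vanished at [x] would be negative after a short move against
    its gradient. This makes interior points satisfy strict inequalities. *)
Lemma affine_gt0 (al be ga r : R) x : 0 < r -> (be != 0) || (ga != 0) ->
  (forall y, `|x - y| < r -> 0 <= al + be * y.1 + ga * y.2) -> 0 < al + be * x.1 + ga * x.2.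
Proof.
move=> r0 bg h.
have n0 : 0 < be ^+ 2 + ga ^+ 2.
  rewrite lt_neqAle addr_ge0 ?sqr_ge0 // andbT eq_sym paddr_eq0 ?sqr_ge0 // !sqrf_eq0.
  by rewrite negb_and.
pose N := `|(be, ga)| + 1.
have N0 : 0 < N by rewrite ltr_pwDr.
pose t := r / N / 2.
have t0 : 0 < t by rewrite !divr_gt0.
have := h (x - t *: (be, ga)).
rewrite opprB addrC subrK normrZ gtr0_norm //.
have tn : t * `|(be, ga)| < r.
  have -> : r = t * (2 * N) by rewrite /t; field; rewrite gt_eqF.
  by rewrite ltr_pM2l // /N; have := normr_ge0 (be, ga); lra.
move=> /(_ tn) /=; rewrite /GRing.scale /=.
have : 0 < t * (be ^+ 2 + ga ^+ 2) by rewrite mulr_gt0.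
by lra.
Qed.

Lemma interior_ball (D : set (R * R)) x : D° x ->
  exists2 r : R, 0 < r & forall y, `|x - y| < r -> D y.
Proof.
move=> Dx; have [r r0 h] := open_ballP (@open_interior _ D) Dx.
by exists r => // y /h; exact: interior_subset.
Qed.

Lemma interior_That : (@That R)° = Tint.
Proof.
apply/seteqP; split=> [x /interior_ball[r r0 h] a|]; last first.
  by rewrite -open_subsetE; [exact: Tint_That|exact: open_Tint].
have H y : `|x - y| < r -> 0 <= lam a y by move=> /h/ThatP.
move: H; elim/I3P: a; rewrite /lam /= => H.
- have := @affine_gt0 0 1 0 r x r0; rewrite oner_neq0 => /(_ isT).
  by rewrite add0r mul1r mul0r addr0; apply => y /H; lra.
- have := @affine_gt0 0 0 1 r x r0; rewrite oner_neq0 orbT => /(_ isT).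
  by rewrite add0r mul1r mul0r add0r; apply => y /H; lra.
- have := @affine_gt0 1 (-1) (-1) r x r0; rewrite oppr_eq0 oner_neq0 => /(_ isT).
  by rewrite !mulN1r; apply => y /H; lra.
Qed.

Lemma interior_Khat k : (@Khat R k)° `<=` Kint k.
Proof.
move=> x /interior_ball[r r0 h].
have H y : `|x - y| < r -> 0 <= lam k y /\ forall a, lam k y <= lam a y by move=> /h/KhatP.
have A (al be ga : R) : (be != 0) || (ga != 0) ->
    (forall y, `|x - y| < r -> 0 <= al + be * y.1 + ga * y.2) -> 0 < al + be * x.1 + ga * x.2.
  exact: affine_gt0 r0.
have n1 : (1 : R) != 0 by rewrite oner_neq0.
have n2 : (-1 : R) != 0 by rewrite oppr_eq0 oner_neq0.
have n3 : (2 : R) != 0 by [].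
move: H; elim/I3P: k {h}; rewrite /lam /= => H; split.
- suff : 0 < 0 + 1 * x.1 + 0 * x.2 by lra.
  by apply: A; rewrite ?n1 // => y /H[]; lra.
- elim/I3P => //= _.
  + suff : 0 < 0 + (-1) * x.1 + 1 * x.2 by rewrite /lam /=; lra.
    by apply: A; rewrite ?n2 // => y /H[_ /(_ (@Ordinal 3 1 isT))]; rewrite /lam /=; lra.
  + suff : 0 < 1 + (- 2) * x.1 + (-1) * x.2 by rewrite /lam /=; lra.
    by apply: A; rewrite ?n2 ?orbT // => y /H[_ /(_ (@Ordinal 3 2 isT))]; rewrite /lam /=; lra.
- suff : 0 < 0 + 0 * x.1 + 1 * x.2 by lra.
  by apply: A; rewrite ?n1 ?orbT // => y /H[]; lra.
- elim/I3P => //= _.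
  + suff : 0 < 0 + 1 * x.1 + (-1) * x.2 by rewrite /lam /=; lra.
    by apply: A; rewrite ?n1 // => y /H[_ /(_ (@Ordinal 3 0 isT))]; rewrite /lam /=; lra.
  + suff : 0 < 1 + (-1) * x.1 + (- 2) * x.2 by rewrite /lam /=; lra.
    by apply: A; rewrite ?n2 // => y /H[_ /(_ (@Ordinal 3 2 isT))]; rewrite /lam /=; lra.
- suff : 0 < 1 + (-1) * x.1 + (-1) * x.2 by rewrite /lam /=; lra.
  by apply: A; rewrite ?n2 // => y /H[]; lra.
- elim/I3P => //= _.
  + suff : 0 < (-1) + 2 * x.1 + 1 * x.2 by rewrite /lam /=; lra.
    by apply: A; rewrite ?n3 // => y /H[_ /(_ (@Ordinal 3 0 isT))]; rewrite /lam /=; lra.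
  + suff : 0 < (-1) + 1 * x.1 + 2 * x.2 by rewrite /lam /=; lra.
    by apply: A; rewrite ?n1 // => y /H[_ /(_ (@Ordinal 3 1 isT))]; rewrite /lam /=; lra.
Qed.

End Barycentric.

(** * Quadratics in barycentric coordinates relative to an edge *)

Section EdgeQuadratic.
Variable R : realType.
Implicit Types (x h : R * R) (a b k : 'I_3) (s : quad R).

Definition emid a b : R * R := 2^-1 *: (rv R a + rv R b).
(** The affine cofactor of [lam k] in the P2 Lagrange expansion: it collects the three nodes off the
    edge opposite to vertex [k]. *)
Definition edge_m s a b k x : R := qev s (rv R k) * (2 * lam k x - 1) +
  4 * qev s (emid a k) * lam a x + 4 * qev s (emid b k) * lam b x.

Lemma qev_lagrange s a b k x : a != b -> a != k -> b != k ->
  qev s x = qev s (rv R a) * (lam a x * (2 * lam a x - 1)) +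
    qev s (rv R b) * (lam b x * (2 * lam b x - 1)) +
    4 * qev s (emid a b) * (lam a x * lam b x) + lam k x * edge_m s a b k x.
Proof.
case: x => x1 x2; elim/I3P: a; elim/I3P: b => //= _; elim/I3P: k => //= _ _;
  rewrite /edge_m /emid /lam /rv /qev /= /GRing.scale /= /GRing.scale /=; by field.
Qed.

Lemma lam_sym a x h : lam a (x + h) + lam a (x - h) = 2 * lam a x.
Proof.
by case: x h => [x1 x2] [h1 h2]; elim/I3P: a; rewrite /lam /=; ring.
Qed.

Lemma qev_edge s a b k x : a != b -> a != k -> b != k ->
  qev s (rv R a) = 0 -> qev s (rv R b) = 0 -> qev s (emid a b) = 0 ->
  qev s x = lam k x * edge_m s a b k x.
Proof.
by move=> ab ak bk e1 e2 e3; rewrite (qev_lagrange _ _ ab ak bk) e1 e2 e3; ring.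
Qed.

(** At such an [x] both factors of [lam k * edge_m] are affine and zero, hence odd in the increment
    [h]. Their product is even, so its linear part, the gradient of [s], vanishes. *)
Lemma edge_m_neq0 s a b k x : a != b -> a != k -> b != k ->
  qev s (rv R a) = 0 -> qev s (rv R b) = 0 -> qev s (emid a b) = 0 ->
  lam k x = 0 -> edge_m s a b k x = 0 -> qdx s x = 0 /\ qdy s x = 0.
Proof.
move=> ab ak bk e1 e2 e3 lk m0.
have E h : qdx s x * h.1 + qdy s x * h.2 = 0.
  have h1 := qev_taylor s x h; have h2 := qev_taylor s x (- h).
  have f1 := qev_edge (x + h) ab ak bk e1 e2 e3; have f2 := qev_edge (x - h) ab ak bk e1 e2 e3.
  have g1 : lam k (x - h) = - lam k (x + h) by have := lam_sym k x h; rewrite lk; lra.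
  have g2 : edge_m s a b k (x - h) = - edge_m s a b k (x + h).
    have := lam_sym k x h; have := lam_sym a x h; have := lam_sym b x h.
    move: m0; rewrite /edge_m; move: (lam k x) (lam a x) (lam b x) (lam k (x - h)) (lam a (x - h))
      (lam b (x - h)) (lam k (x + h)) (lam a (x + h)) (lam b (x + h)) => k0 a0 b0 k1 a1 b1 k2 a2 b2 m0 u1 u2 u3.
    have -> : k1 = 2 * k0 - k2 by lra.
    have -> : a1 = 2 * a0 - a2 by lra.
    have -> : b1 = 2 * b0 - b2 by lra.
    apply/eqP; rewrite -addr_eq0; apply/eqP; rewrite -[RHS](mulr0 2) -m0; ring.
  have : qev s (x + h) = qev s (x - h) by rewrite f1 f2 g1 g2 mulrNN.
  rewrite h1 h2.
  have -> : (- h).1 = - h.1 by []. have -> : (- h).2 = - h.2 by [].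
  rewrite !sqrrN mulrNN; lra.
by split; [have := E (1, 0)|have := E (0, 1)]; rewrite /=; lra.
Qed.

Lemma edge_m_bound s a b k : exists2 C, 0 <= C & forall x, @That R x -> `|edge_m s a b k x| <= C.
Proof.
exists (`|qev s (rv R k)| + `|4 * qev s (emid a k)| + `|4 * qev s (emid b k)|).
  by rewrite !addr_ge0.
move=> x /ThatP l0.
have l1 c : lam c x <= 1.
  have := sum_lam x; rewrite sum_I3; have := l0 (@Ordinal 3 0 isT).
  have := l0 (@Ordinal 3 1 isT); have := l0 (@Ordinal 3 2 isT).
  by elim/I3P: c; lra.
have lc c : `|lam c x| <= 1 by rewrite ger0_norm.
rewrite /edge_m; repeat apply: ler_normD_le; rewrite normrM ler_piMr //.
by rewrite ler_norml; have := l0 k; have := l1 k; lra.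
Qed.

Lemma That_norm x : @That R x -> `|x| <= 1.
Proof.
move=> /ThatP h; have := h (@Ordinal 3 0 isT); have := h (@Ordinal 3 1 isT).
have := h (@Ordinal 3 2 isT); rewrite /lam /= => h2 h1 h0.
by rewrite prod_normE ge_max !ger0_norm //; apply/andP; split; lra.
Qed.

Lemma That_conv x y t : @That R x -> @That R y -> 0 <= t <= 1 -> @That R ((1 - t) *: x + t *: y).
Proof.
move=> /ThatP hx /ThatP hy /andP[t0 t1]; apply/ThatP => a.
by rewrite lamD addr_ge0 // mulr_ge0 // subr_ge0.
Qed.

Lemma That_mid x y : @That R x -> @That R y -> @That R (2^-1 *: (x + y)).
Proof.
move=> hx hy; rewrite scalerDr (_ : 2^-1 *: x = (1 - 2^-1) *: x).
  by apply: That_conv => //; apply/andP; split; lra.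
by congr (_ *: _); lra.
Qed.

Lemma rv_That a : @That R (rv R a).
Proof. by apply/ThatP => b; rewrite lam_rv. Qed.

Lemma emid_That a b : @That R (emid a b).
Proof. by apply: That_mid; exact: rv_That. Qed.

End EdgeQuadratic.

(** * Lipschitz estimates along a path through finitely many closed sets *)

Section Chain.
Variable R : realType.

(** Induction on the number of sets: jump from [a] to the last parameter [s] at which [A i] is met,
    then continue with another set containing [s] and without [A i]. The sets may be disconnected,
    since the Lipschitz bound holds between any two of their points. *)
Lemma lipschitz_chain (J : finType) (S : {set J}) (A : J -> set R) (f : J -> R -> R) (L a b : R) :
  a <= b -> (forall j, closed (A j)) ->
  (forall t, a <= t <= b -> exists2 j, j \in S & A j t) ->
  (forall j s t, A j s -> A j t -> a <= s <= b -> a <= t <= b -> `|f j s - f j t| <= L * `|s - t|) ->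
  (forall i j t, A i t -> A j t -> a <= t <= b -> f i t = f j t) ->
  forall i j, i \in S -> j \in S -> A i a -> A j b -> `|f i a - f j b| <= L * (b - a).
Proof.
move: {2}#|S| (erefl #|S|) => n; elim: n S a => [|n IH] S a cS ab cA cov fL fE i j iS jS ia jb.
  by move: iS; rewrite (cards0_eq cS) inE.
pose B := A i `&` `[a, b].
have Ba : B a by split=> //=; rewrite in_itv /= lexx.
have cB : closed B by apply: closedI => //; exact: interval_closed.
have ubB : has_sup B.
  by split; [exists a|exists b => t [_ /=]; rewrite in_itv /= => /andP[]].
have Bs : B (sup B).
  by rewrite {1}(closure_id B).1 //; apply: closure_sup; [exists a|case: ubB].
have [is_ /= ] := Bs; set s := sup B in is_ *.
rewrite in_itv /= => /andP[as_ sb].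
have fis : `|f i a - f i s| <= L * (s - a).
  have := fL i a s ia is_; rewrite lexx ab as_ sb => /(_ isT isT).
  by rewrite (distrC a) (ger0_norm (_ : 0 <= s - a)) ?subr_ge0.
have [sb'|sb'] := eqVneq s b.
  by rewrite -(fE i j b) ?lexx ?ab // -?sb' // in fis *.
have sltb : s < b by rewrite lt_neqAle sb' sb.
have nB t : s < t -> t <= b -> ~ A i t.
  move=> st tb At; have : t <= s.
    apply: sup_ubound => //; first by case: ubB.
    by split=> //=; rewrite in_itv /= tb (le_trans as_ (ltW st)).
  by rewrite leNgt st.
(* Parameters just after [s] lie in the remaining sets, whose finite union is closed; hence it
   contains [s]. *)
have covs : exists2 k, k \in S :\ i & A k s.
  pose U := \bigcup_(k in [set` S :\ i]) A k.
  have cU : closed U by apply: closed_bigcup => // ; exact: finite_finset.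
  suff : U s by move=> [k /= kS ks]; exists k.
  rewrite (closure_id U).1 // => V /nbhs_ballP[e /= e0 eV].
  pose t := s + Num.min (e / 2) (b - s).
  have m0 : 0 < Num.min (e / 2) (b - s) by rewrite lt_min divr_gt0 //= subr_gt0.
  have tb : t <= b by rewrite /t -lerBrDl ge_min lexx orbT.
  have st : s < t by rewrite ltrDl.
  have [|k kS kt] := cov t; first by rewrite tb andbT (le_trans as_) // ltW.
  exists t; split.
    exists k => //=; rewrite !inE kS andbT; apply/eqP => ki.
    by apply: (nB t) => //; rewrite -ki.
  apply: eV; rewrite -ball_normE /= opprD addrA subrr add0r normrN gtr0_norm //.
  by rewrite gt_min; apply/orP; left; lra.
have [k kS ks] := covs.
have ji : j != i by apply: contra_notN (nB b sltb (lexx b)) => /eqP <-.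
have IHs : `|f k s - f j b| <= L * (b - s).
  apply: (IH (S :\ i)) => //.
  - by have := cardsD1 i S; rewrite iS cS => -[].
  - move=> t /andP[st tb].
    have [<-|ts] := eqVneq s t; first by exists k.
    have [|l lS lt_] := cov t; first by rewrite (le_trans as_ st).
    exists l => //; rewrite !inE lS andbT; apply/eqP => li.
    by apply: (nB t) => //; [rewrite lt_neqAle ts|rewrite -li].
  - by move=> l u v lu lv /andP[h1 h2] /andP[h3 h4]; apply: fL => //; apply/andP; split=> //; exact: le_trans as_ _.
  - by move=> l m t lt_ mt /andP[h1 h2]; apply: fE => //; rewrite h2 andbT (le_trans as_).
  - by rewrite !inE ji.
rewrite (fE i k s) ?as_ // in fis.
have -> : f i a - f j b = (f i a - f k s) + (f k s - f j b) by ring.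
by rewrite (le_trans (ler_normD _ _)) //; lra.
Qed.
End Chain.

(** * Topology of the curved mesh *)

Section CurvedMesh.
Variables (R : realType) (I : finType).
Implicit Types (x y z : R * R) (i j : I) (a b k : 'I_3).
Variables (vtx : I -> 'I_3 -> R * R) (q p : I -> quad R).
Local Notation F i := (qmap (q i) (p i)).
Local Notation T i := (F i @` @That R).

Definition shared i a b := exists j a' b',
  [/\ i != j, a' != b', vtx i a = vtx j a' & vtx i b = vtx j b'].

Hypothesis J_gt0 : forall i x, @That R x -> 0 < qjac (q i) (p i) x.
Hypothesis F_inj : forall i x y, @That R x -> @That R y -> F i x = F i y -> x = y.
Hypothesis F_rv : forall i a, F i (rv R a) = vtx i a.
Hypothesis F_disj : forall i j, i != j -> (T i)° `&` (T j)° = set0.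
Hypothesis F_edge : forall i a b (t : R), a != b -> shared i a b -> 0 <= t <= 1 ->
  F i ((1 - t) *: rv R a + t *: rv R b) = (1 - t) *: vtx i a + t *: vtx i b.

Lemma continuous_qmap i : continuous (F i).
Proof.
move=> x; apply: (@cvg_pair _ _ _ (nbhs x) (nbhs _) (nbhs _) _ _ _ (qev (q i)) (qev (p i)));
  exact: continuous_qev.
Qed.

Lemma closed_T i : closed (T i).
Proof.
apply: (@compact_closed _ _ _); first exact: norm_hausdorff.
apply: continuous_compact; first by apply: continuous_subspaceT; exact: continuous_qmap.
have -> : @That R = cbox ((-1, 1), (-1, 1)) `&` \bigcap_(a : 'I_3) [set x | 0 <= lam a x].
  apply/seteqP; split=> x.
    move=> Tx; split; last by move=> a _ /=; move/ThatP: Tx.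
    have := That_norm Tx; rewrite prod_normE ge_max !ler_norml => /andP[h1 h2].
    by split; rewrite /= in_itv.
  by move=> [_ h]; apply/ThatP => a; exact: h.
apply: compact_closedI; first exact: compact_cbox.
apply: closed_bigI => a _; rewrite -openC; apply: openP => x /= /negP; rewrite -ltNge => h.
exists (- lam a x / 2); first by rewrite divr_gt0 // oppr_gt0.
move=> y xy; apply/negP; rewrite -ltNge.
by have := lam_sub a x y; rewrite ler_norml => /andP[h1 h2]; lra.
Qed.

Lemma qmap_open i (O : set (R * R)) : open O -> O `<=` @Tint R -> open (F i @` O).
Proof.
move=> oO OT; apply: openP => _ [x Ox <-].
have [r r0 xr] := open_ballP oO Ox.
have J0 : qjac (q i) (p i) x != 0 by rewrite gt_eqF // J_gt0 //; apply/Tint_That/OT.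
have [rho rho0 h] := qmap_locally_onto J0 r0.
exists rho => // y; rewrite distrC => /h[x' xx' <-]; exists x' => //.
by apply: xr; rewrite distrC.
Qed.

Lemma Tint_interior i x : Tint x -> (T i)° (F i x).
Proof.
move=> Tx; have : F i @` @Tint R `<=` (T i)°.
  rewrite -open_subsetE; first by apply: image_subset; exact: Tint_That.
  by apply: qmap_open => //; exact: open_Tint.
by apply; exists x.
Qed.

Lemma bary_Tint : Tint (bary R).
Proof.
move=> a; rewrite /bary scaler_sumr.
rewrite (@lam_comb R (fun=> 3^-1)) ?invr_gt0 //.
by rewrite sum_I3; field.
Qed.

Lemma closure_Tint x (r : R) : @That R x -> 0 < r -> exists2 x', Tint x' & `|x - x'| < r.
Proof.
move=> Tx r0; pose N := `|x - bary R| + 1.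
have N0 : 0 < N by rewrite ltr_pwDr.
pose t := Num.min 1 (r / N / 2).
have t0 : 0 < t by rewrite lt_min ltr01 !divr_gt0.
have t1 : t <= 1 by rewrite ge_min lexx.
exists ((1 - t) *: x + t *: bary R).
  move=> a; rewrite lamD; have := bary_Tint a; move/ThatP: Tx => /(_ a) h1 h2.
  by rewrite ltr_wpDl // ?mulr_gt0 // mulr_ge0 // subr_ge0.
have -> : x - ((1 - t) *: x + t *: bary R) = t *: (x - bary R).
  case: (x) (bary R) => [x1 x2] [b1 b2].
  by congr pair; rewrite /= /GRing.scale /=; ring.
rewrite normrZ gtr0_norm //.
have : t * N <= r / 2.
  by rewrite -ler_pdivlMr // ge_min; apply/orP; right; rewrite mulrAC.
by rewrite /N; have := normr_ge0 (x - bary R); nra.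
Qed.

(** Every point of a curved triangle is a limit of images of interior points, so a point of [T i]
    interior to [T j] would make the two interiors overlap. *)
Lemma interior_T_disj i j x : @That R x -> (T j)° (F i x) -> i = j.
Proof.
move=> Tx Fx; apply/eqP/negPn/negP => ij.
have [r r0 h] := open_ballP (@open_interior _ _) Fx.
have [d d0 hd] : exists2 d, 0 < d & forall y, `|x - y| < d -> `|F i x - F i y| < r.
  have /cvgrPdist_lt/(_ _ r0)/nbhs_ballP[d /= d0 hd] := @continuous_qmap i x.
  by exists d => // y xy; apply: hd; rewrite -ball_normE.
have [x' Tx' xx'] := closure_Tint Tx d0.
have : ((T i)° `&` (T j)°) (F i x') by split; [exact: Tint_interior|apply/h/hd].
by rewrite F_disj.
Qed.

Lemma That3 a b k x : a != b -> a != k -> b != k ->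
  0 <= lam a x -> 0 <= lam b x -> 0 <= lam k x -> @That R x.
Proof.
move=> ab ak bk la lb lk; apply/ThatP => c; move: ab ak bk la lb lk.
by elim/I3P: a; elim/I3P: b => //= _; elim/I3P: k => //= _ _; elim/I3P: c.
Qed.

Lemma edge_m_lipschitz s a b k : exists2 C, 0 < C & forall x y,
  `|edge_m s a b k x - edge_m s a b k y| <= C * `|x - y|.
Proof.
pose A := 2 * qev s (rv R k); pose B := 4 * qev s (emid R a k); pose D := 4 * qev s (emid R b k).
exists ((`|A| + `|B| + `|D|) * 2 + 1).
  by rewrite ltr_wpDl // mulr_ge0 // !addr_ge0.
move=> x y.
have -> : edge_m s a b k x - edge_m s a b k y =
   A * (lam k x - lam k y) + B * (lam a x - lam a y) + D * (lam b x - lam b y).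
  by rewrite /edge_m /A /B /D; ring.
apply: (@le_trans _ _ ((`|A| + `|B| + `|D|) * (2 * `|x - y|))).
  have l c := lam_sub c x y; move: (A) (B) (D) (2 * `|x - y|) l => A' B' D' d l; rewrite !mulrDl.
  by repeat apply: ler_normD_le; rewrite normrM; apply: ler_wpM2l.
by rewrite mulrA ler_wpM2r // lerDl.
Qed.

Lemma edge_point a b k x : a != b -> a != k -> b != k -> lam k x = 0 ->
  x = (1 - lam b x) *: rv R a + lam b x *: rv R b.
Proof.
move=> ab ak bk lk; have := sum_lam x; rewrite (sum_I3_perm _ ab ak bk) lk addr0 => h.
rewrite -[LHS]sum_lam_rv (sum_I3_perm _ ab ak bk) lk scale0r addr0.
by congr (_ *: _ + _); rewrite -h; ring.
Qed.

Definition nrm (u w : R * R) : R * R := (- (w - u).2, (w - u).1).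
(** Up to the factor of the length of [w - u], the signed distance of [y] to the line through [u]
    and [w]. *)
Definition side (u w y : R * R) : R := (nrm u w).1 * (y - u).1 + (nrm u w).2 * (y - u).2.

Lemma side_edge u w (t : R) : side u w ((1 - t) *: u + t *: w) = 0.
Proof.
by case: u w => [u1 u2] [w1 w2]; rewrite /side /nrm /= /GRing.scale /=; ring.
Qed.

Lemma side_shift u w y (t : R) : side u w (y + t *: nrm u w) =
  side u w y + t * ((nrm u w).1 ^+ 2 + (nrm u w).2 ^+ 2).
Proof.
by case: u w y => [u1 u2] [w1 w2] [y1 y2]; rewrite /side /nrm /= /GRing.scale /=; ring.
Qed.

Lemma nrm_neq0 u w : u != w -> 0 < (nrm u w).1 ^+ 2 + (nrm u w).2 ^+ 2.
Proof.
move=> uw; rewrite lt_neqAle addr_ge0 ?sqr_ge0 // andbT eq_sym paddr_eq0 ?sqr_ge0 //.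
rewrite !sqrf_eq0 /nrm /= oppr_eq0; apply: contra uw => /andP[].
rewrite !subr_eq0 => /eqP h2 /eqP h1.
by case: u w h1 h2 => [? ?] [? ?] /= -> ->.
Qed.

Lemma vtx_neq i a b : a != b -> vtx i a != vtx i b.
Proof.
move=> ab; rewrite -!F_rv; apply: contra_neq ab => h.
have := F_inj (@rv_That R a) (@rv_That R b) h => e.
have : lam a (rv R a) = lam a (rv R b) by rewrite e.
by rewrite !lam_rv eqxx; case: eqP => // _ /eqP; rewrite oner_eq0.
Qed.

(* [side] composed with [F i] vanishes on the straight edge, hence factors through [lam k];
   the cofactor does not vanish on the edge because DF is invertible. *)
Lemma half_ball i a b k x : a != b -> a != k -> b != k -> shared i a b ->
  lam k x = 0 -> 0 < lam a x -> 0 < lam b x ->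
  exists2 s : R, s = 1 \/ s = -1 & exists2 rho, 0 < rho &
    forall y, `|y - F i x| < rho -> 0 <= s * side (vtx i a) (vtx i b) y -> T i y.
Proof.
move=> ab ak bk sh lk la lb.
have Tx : @That R x.
  by apply: (That3 ab ak bk); [exact: ltW|exact: ltW|rewrite lk].
pose n := nrm (vtx i a) (vtx i b); pose u := vtx i a.
pose s0 := Quad (n.1 * q00 (q i) + n.2 * q00 (p i) - (n.1 * u.1 + n.2 * u.2))
  (n.1 * q10 (q i) + n.2 * q10 (p i)) (n.1 * q01 (q i) + n.2 * q01 (p i))
  (n.1 * q20 (q i) + n.2 * q20 (p i)) (n.1 * q11 (q i) + n.2 * q11 (p i))
  (n.1 * q02 (q i) + n.2 * q02 (p i)).
have s0E z : qev s0 z = side (vtx i a) (vtx i b) (F i z).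
  rewrite /side -/n -/u; have -> : (F i z - u).1 = qev (q i) z - u.1 by [].
  have -> : (F i z - u).2 = qev (p i) z - u.2 by [].
  by rewrite /qev /=; ring.
have s0edge (t : R) : 0 <= t <= 1 -> qev s0 ((1 - t) *: rv R a + t *: rv R b) = 0.
  by move=> t01; rewrite s0E F_edge // side_edge.
have e1 : qev s0 (rv R a) = 0.
  by have := @s0edge 0; rewrite subr0 scale1r scale0r addr0; apply; rewrite lexx ler01.
have e2 : qev s0 (rv R b) = 0.
  by have := @s0edge 1; rewrite subrr scale1r scale0r add0r; apply; rewrite lexx ler01.
have e3 : qev s0 (emid R a b) = 0.
  have := @s0edge 2^-1; rewrite /emid scalerDr (_ : 1 - 2^-1 = 2^-1 :> R); last by lra.
  by apply; apply/andP; split; lra.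
have m0 : edge_m s0 a b k x != 0.
  apply/eqP => m0; have [d1 d2] := edge_m_neq0 ab ak bk e1 e2 e3 lk m0.
  have J0 := @J_gt0 i x Tx.
  have f1 : n.1 * qdx (q i) x + n.2 * qdx (p i) x = 0 by rewrite -d1 /qdx /=; ring.
  have f2 : n.1 * qdy (q i) x + n.2 * qdy (p i) x = 0 by rewrite -d2 /qdy /=; ring.
  have g1 : n.1 * qjac (q i) (p i) x = 0.
    have -> : n.1 * qjac (q i) (p i) x = qdy (p i) x * (n.1 * qdx (q i) x + n.2 * qdx (p i) x)
      - qdx (p i) x * (n.1 * qdy (q i) x + n.2 * qdy (p i) x) by rewrite /qjac; ring.
    by rewrite f1 f2 !mulr0 subr0.
  have g2 : n.2 * qjac (q i) (p i) x = 0.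
    have -> : n.2 * qjac (q i) (p i) x = qdx (q i) x * (n.1 * qdy (q i) x + n.2 * qdy (p i) x)
      - qdy (q i) x * (n.1 * qdx (q i) x + n.2 * qdx (p i) x) by rewrite /qjac; ring.
    by rewrite f1 f2 !mulr0 subr0.
  have := nrm_neq0 (@vtx_neq i a b ab).
  move/eqP: g1; rewrite mulf_eq0 (gt_eqF J0) orbF => /eqP; rewrite -/n => ->.
  move/eqP: g2; rewrite mulf_eq0 (gt_eqF J0) orbF => /eqP; rewrite -/n => ->.
  by rewrite expr0n /= addr0 ltxx.
have [s sE sm] : exists2 s : R, s = 1 \/ s = -1 & 0 < s * edge_m s0 a b k x.
  have [m_gt0|m_lt0|/eqP] := ltgtP 0 (edge_m s0 a b k x).
  - by exists 1; [left|rewrite mul1r].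
  - by exists (-1); [right|rewrite mulN1r oppr_gt0].
  - by rewrite eq_sym (negbTE m0).
exists s => //.
have [r1 r10 h1] : exists2 r, 0 < r & forall y, `|x - y| < r -> 0 < s * edge_m s0 a b k y.
  have [C C0 hC] := edge_m_lipschitz s0 a b k.
  exists (s * edge_m s0 a b k x / C); first by rewrite divr_gt0.
  move=> y; rewrite ltr_pdivlMr // => xy; have := hC x y; rewrite ler_norml => /andP[c1 c2].
  by case: sE sm xy => ->; lra.
have [r2 r20 h2] := open_lam_lt la; have [r3 r30 h3] := open_lam_lt lb.
have J0 : qjac (q i) (p i) x != 0 by rewrite gt_eqF // J_gt0.
pose r := Num.min r1 (Num.min r2 r3).
have r0 : 0 < r by rewrite !lt_min r10 r20.
have [rho rho0 onto] := qmap_locally_onto J0 r0.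
exists rho => // y /onto[z zx Fz] sy; exists z => //.
move: zx; rewrite distrC !lt_min => /and3P[z1 z2 z3].
have lkz : 0 <= lam k z.
  move: sy; rewrite -Fz -s0E (qev_edge z ab ak bk e1 e2 e3) mulrCA pmulr_lge0 //.
  exact: h1.
by apply: (That3 ab ak bk) => //; apply: ltW; [exact: h2|exact: h3].
Qed.

Lemma near_side_gt (s : R) (u w y0 : R * R) : 0 < s * side u w y0 ->
  \forall y \near y0, 0 < s * side u w y.
Proof.
pose n := nrm u w; pose c := Quad (- s * (n.1 * u.1 + n.2 * u.2)) (s * n.1) (s * n.2) 0 0 0.
have E y : s * side u w y = qev c y.
  rewrite /side -/n; have -> : (y - u).1 = y.1 - u.1 by [].
  by have -> : (y - u).2 = y.2 - u.2 by []; rewrite /qev /=; ring.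
rewrite E => h; have := @cvgr_gt _ _ (nbhs y0) (nbhs_filter y0) _ _ (@continuous_qev R c y0) 0 h.
by apply: filterS => y; rewrite E.
Qed.

(** Each of the two triangles contains a half ball at the point, bounded by the common straight
    edge. Equal sides would give overlapping interiors, so the halves are opposite and fill a
    ball. *)
Lemma shared_ball i j a b k a' b' x : a != b -> a != k -> b != k ->
  i != j -> a' != b' -> vtx i a = vtx j a' -> vtx i b = vtx j b' ->
  lam k x = 0 -> 0 < lam a x -> 0 < lam b x ->
  F j ((1 - lam b x) *: rv R a' + lam b x *: rv R b') = F i x /\
  exists2 rho, 0 < rho & forall y, `|y - F i x| < rho -> T i y \/ T j y.
Proof.
move=> ab ak bk ij ab' ea eb lk la lb.
have sh : shared i a b by exists j, a', b'.
have sh' : shared j a' b' by exists i, a, b; rewrite eq_sym.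
have [k' [ak' bk']] := third ab'.
have lab : 1 - lam b x = lam a x.
  by have := sum_lam x; rewrite (sum_I3_perm _ ab ak bk) lk addr0; lra.
have xE := edge_point ab ak bk lk; set t := lam b x in xE lab lb.
pose x' := (1 - t) *: rv R a' + t *: rv R b'.
have t01 : 0 <= t <= 1 by rewrite ltW //= -subr_ge0 lab ltW.
have FE : F j x' = F i x by rewrite xE /x' !F_edge // ea eb.
split; first exact: FE.
have lk' : lam k' x' = 0.
  exact: lam_edge_0.
have la' : 0 < lam a' x'.
  by rewrite /x' lam_edge_l // lab.
have lb' : 0 < lam b' x'.
  by rewrite /x' lam_edge_r.
have [s sE [rho rho0 h]] := half_ball ab ak bk sh lk la lb.
have [s' sE' [rho' rho0' h']] := half_ball ab' ak' bk' sh' lk' la' lb'.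
rewrite FE -ea -eb in h'.
have S0 : side (vtx i a) (vtx i b) (F i x) = 0 by rewrite xE F_edge // side_edge.
move: h h' S0; set u := vtx i a; set w := vtx i b => h h' S0.
pose r := Num.min rho rho'; have r0 : 0 < r by rewrite lt_min rho0.
have [ss|ss] : s' = - s \/ s' = s.
  by case: sE => ->; case: sE' => ->; rewrite ?opprK; auto.
  exists r => // y; rewrite lt_min => /andP[y1 y2].
  have [sy|sy] := leP 0 (s * side u w y); first by left; exact: h.
  by right; apply: h' => //; rewrite ss mulNr oppr_ge0 ltW.
have n0 : 0 < (nrm u w).1 ^+ 2 + (nrm u w).2 ^+ 2 by apply: nrm_neq0; exact: vtx_neq.
pose N := `|nrm u w| + 1; have N0 : 0 < N by rewrite ltr_pwDr.
pose d := r / N / 2; have d0 : 0 < d by rewrite !divr_gt0.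
(* If both half balls lay on the same side, this point pushed off the edge to that side would be
   interior to both triangles. *)
pose y0 := F i x + (d * s) *: nrm u w.
have ns : `|s| = 1 by case: sE => ->; rewrite ?normrN normr1.
have ss1 : s * s = 1 by case: sE => ->; ring.
have y0x : `|y0 - F i x| < r.
  rewrite /y0 addrAC subrr add0r normrZ normrM ns mulr1 gtr0_norm //.
  have -> : r = d * (2 * N) by rewrite /d; field; rewrite gt_eqF.
  by rewrite ltr_pM2l // /N; have := normr_ge0 (nrm u w); lra.
have sy0 : 0 < s * side u w y0.
  by rewrite /y0 side_shift S0 add0r -[d * s * _]mulrA mulrCA [s * (s * _)]mulrA ss1 mul1r mulr_gt0.
have nb : \forall y \near y0, `|y - F i x| < r.
  apply/nbhs_ballP; exists (r - `|y0 - F i x|); first by rewrite /= subr_gt0.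
  move=> y; rewrite -ball_normE /= => yy.
  have -> : y - F i x = (y - y0) + (y0 - F i x) by rewrite addrA subrK.
  by rewrite (le_lt_trans (ler_normD _ _)) // distrC -ltrBrDr.
have hT : ((T i)° `&` (T j)°) y0.
  have ns0 := near_side_gt sy0.
  split; apply: filterS2 nb ns0 => y; rewrite lt_min => /andP[y1 y2] /ltW y3.
  - exact: h.
  - by apply: h' => //; rewrite ss.
by move: hT; rewrite F_disj.
Qed.

Local Notation U := (\bigcup_i T i).

(** On the reference triangle, three times this function is the hat function of the barycentre for
    the split; it equals [lam k] on the subtriangle [k]. *)
Definition lam_min x := Num.min (lam (@Ordinal 3 0 isT) x)
  (Num.min (lam (@Ordinal 3 1 isT) x) (lam (@Ordinal 3 2 isT) x)).

Lemma lam_min_le k x : lam_min x <= lam k x.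
Proof. by elim/I3P: k; rewrite /lam_min !ge_min lexx ?orbT. Qed.

Lemma lam_min_eq x : exists k, lam_min x = lam k x.
Proof.
rewrite /lam_min; case: leP => _; first by exists (@Ordinal 3 0 isT).
by case: leP => _; [exists (@Ordinal 3 1 isT)|exists (@Ordinal 3 2 isT)].
Qed.

Lemma lam_min_sub x y : `|lam_min x - lam_min y| <= 2 * `|x - y|.
Proof.
have H u w : lam_min u - lam_min w <= 2 * `|u - w|.
  have [k ->] := lam_min_eq w; have := lam_sub k u w; rewrite ler_norml => /andP[_].
  by have := lam_min_le k u; lra.
by rewrite ler_norml H andbT; have := H y x; rewrite distrC; lra.
Qed.

Lemma lam_min_edge k x : @That R x -> lam k x = 0 -> lam_min x = 0.
Proof.
move=> /ThatP h k0; apply/eqP; rewrite eq_le; apply/andP; split.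
  by rewrite -k0 lam_min_le.
by have [a ->] := lam_min_eq x.
Qed.

Variable al : R * R -> R.
Hypothesis al01 : forall y, 0 <= al y <= 1.
Hypothesis al0 : forall i a b, a != b -> ~ shared i a b ->
  [/\ al (vtx i a) = 0, al (vtx i b) = 0 & al (2^-1 *: (vtx i a + vtx i b)) = 0].

(* With [al] the indicator of the nodes where the straight-mesh function does not vanish,
   [majorant i] dominates the reference function, depends on the nodes only (so that it is
   single-valued across edges) and vanishes on edges carrying no active node; [lam_min]
   accounts for the degrees of freedom inside the triangle. *)
Definition majorant i x := \sum_a al (vtx i a) * lam a x +
  \sum_a \sum_b al (2^-1 *: (vtx i a + vtx i b)) * (lam a x * lam b x) + lam_min x.

Lemma lam_le1 a x : @That R x -> lam a x <= 1.
Proof.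
move=> /ThatP h; have := sum_lam x; rewrite sum_I3; move: (h (@Ordinal 3 0 isT)) (h (@Ordinal 3 1 isT)) (h (@Ordinal 3 2 isT)).
by elim/I3P: a; lra.
Qed.

(** The three linear terms and [lam_min] have constant 2 each, the nine products constant 4 each: 44
    = 6 + 36 + 2. *)
Lemma majorant_lipschitz i x y : @That R x -> @That R y ->
  `|majorant i x - majorant i y| <= 44 * `|x - y|.
Proof.
move=> Tx Ty.
pose S1 := \sum_a al (vtx i a) * (lam a x - lam a y).
pose S2 := \sum_a \sum_b al (2^-1 *: (vtx i a + vtx i b)) * (lam a x * lam b x - lam a y * lam b y).
have -> : majorant i x - majorant i y = S1 + S2 + (lam_min x - lam_min y).
  rewrite /majorant /S1 /S2 !sum_I3; ring.
have al1 z (r d : R) : `|r| <= d -> `|al z * r| <= d.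
  move=> rd; have /andP[z0 z1] := al01 z; rewrite normrM (ger0_norm z0).
  by apply: le_trans rd; rewrite ler_piMl.
have sl a := lam_sub a x y.
have n := normr_ge0 (x - y); set d := `|x - y| in sl n *.
have h1 : `|S1| <= 6 * d.
  have -> : 6 * d = 2 * d + 2 * d + 2 * d by ring.
  by rewrite /S1 sum_I3; repeat apply: ler_normD_le; apply: al1.
have h2 a b : `|al (2^-1 *: (vtx i a + vtx i b)) * (lam a x * lam b x - lam a y * lam b y)| <= 4 * d.
  apply: al1.
  have -> : lam a x * lam b x - lam a y * lam b y =
    lam a x * (lam b x - lam b y) + lam b y * (lam a x - lam a y) by ring.
  have -> : 4 * d = 2 * d + 2 * d by ring.
  have k c z (r : R) : @That R z -> `|r| <= 2 * d -> `|lam c z * r| <= 2 * d.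
    move=> Tz rd; rewrite normrM ger0_norm; last by move/ThatP: Tz.
    by apply: le_trans rd; rewrite ler_piMl // lam_le1.
  by apply: ler_normD_le; apply: k.
have h3 : `|S2| <= 36 * d.
  have -> : 36 * d = (4 * d + 4 * d + 4 * d) + (4 * d + 4 * d + 4 * d) + (4 * d + 4 * d + 4 * d) by ring.
  rewrite /S2 !sum_I3; repeat apply: ler_normD_le; exact: h2.
have h4 := lam_min_sub x y; rewrite -/d in h4.
have -> : 44 * d = 6 * d + 36 * d + 2 * d by ring.
by repeat apply: ler_normD_le.
Qed.

(** Only the two end points and the midpoint of the edge enter, so two triangles sharing the edge
    assign the same values to it. *)
Lemma majorant_edge i a b (t : R) : a != b -> 0 <= t <= 1 ->
  majorant i ((1 - t) *: rv R a + t *: rv R b) =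
    al (vtx i a) * ((1 - t) + (1 - t) ^+ 2) + al (vtx i b) * (t + t ^+ 2) +
    2 * al (2^-1 *: (vtx i a + vtx i b)) * ((1 - t) * t).
Proof.
move=> ab t01; have [k [ak bk]] := third ab.
set x := _ + _.
have la : lam a x = 1 - t by exact: lam_edge_l.
have lb : lam b x = t by exact: lam_edge_r.
have lk : lam k x = 0 by exact: lam_edge_0.
have Tx : @That R x by apply: That_conv => //; exact: rv_That.
have half u : 2^-1 *: (u + u) = u :> R * R.
  by case: u => u1 u2; congr pair; rewrite /= /GRing.scale /=; field.
rewrite /majorant (lam_min_edge Tx lk) !(sum_I3_perm _ ab ak bk) la lb lk !half [vtx i b + vtx i a]addrC; ring.
Qed.

Lemma edge_case i x : @That R x -> ~ Tint x -> (forall a, F i x != vtx i a) ->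
  exists a b k, [/\ a != b, a != k & b != k] /\ [/\ lam k x = 0, 0 < lam a x & 0 < lam b x].
Proof.
move=> /ThatP Tx nT nv.
have [k lk] : exists k, lam k x = 0.
  apply: contrapT => h; apply: nT => a; rewrite lt_neqAle Tx andbT.
  by apply/eqP => e; apply: h; exists a.
have [a ak] := other k.
have [b [ab]] := third ak; rewrite eq_sym => bk.
have pos c d : c != d -> c != k -> d != k -> 0 < lam c x.
  move=> cd ck dk; rewrite lt_neqAle Tx andbT; apply/negP => /eqP e.
  have lkd : 1 - lam d x = 0.
    by rewrite -(sum_lam x) (sum_I3_perm _ cd ck dk) -e lk; ring.
  have /eqP := nv d; apply; rewrite {1}(edge_point cd ck dk lk) lkd scale0r add0r.
  by rewrite -F_rv; congr (F i _); rewrite -[RHS]scale1r; congr (_ *: _); lra.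
exists a, b, k; split=> //; split=> //; first exact: pos ab ak bk.
by apply: (pos b a) => //; rewrite eq_sym.
Qed.

(** By [shared_ball] the triangles [i] and [j0] fill a neighbourhood of the point. A further
    triangle through it would have interior points there, so [j] is [j0], and injectivity identifies
    [x']. *)
Lemma shared_match i j a b k x x' : a != b -> a != k -> b != k ->
  lam k x = 0 -> 0 < lam a x -> 0 < lam b x -> shared i a b ->
  i != j -> @That R x' -> F j x' = F i x ->
  exists a' b', [/\ a' != b', vtx i a = vtx j a', vtx i b = vtx j b' &
    x' = (1 - lam b x) *: rv R a' + lam b x *: rv R b'].
Proof.
move=> ab ak bk lk la lb [j0 [a' [b' [ij0 ab' ea eb]]]] ij Tx' Fx'.
have [FE [rho rho0 h]] := shared_ball ab ak bk ij0 ab' ea eb lk la lb.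
have [d d0 hd] : exists2 d, 0 < d & forall y, `|x' - y| < d -> `|F j x' - F j y| < rho.
  have /cvgrPdist_lt/(_ _ rho0)/nbhs_ballP[d /= d0 hd] := @continuous_qmap j x'.
  by exists d => // y xy; apply: hd; rewrite -ball_normE.
have [x2 Tx2 xx2] := closure_Tint Tx' d0.
have e : j = j0.
  have [||] := h (F j x2); first by rewrite distrC -Fx'; exact: hd.
    move=> [z Tz zE]; have := @interior_T_disj i j z Tz.
    by rewrite zE => /(_ (Tint_interior _ Tx2)) e; move: ij; rewrite e eqxx.
  move=> [z Tz zE]; have := @interior_T_disj j0 j z Tz.
  by rewrite zE => /(_ (Tint_interior _ Tx2)).
subst j0; exists a', b'; split=> //; apply: (@F_inj j) => //; last by rewrite FE.
apply: That_conv; [exact: rv_That|exact: rv_That|rewrite ltW //=].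
by apply: lam_le1; apply: (That3 ab ak bk); [exact: ltW|exact: ltW|rewrite lk].
Qed.

Lemma majorant_unshared i a b k x : a != b -> a != k -> b != k ->
  lam k x = 0 -> @That R x -> ~ shared i a b -> majorant i x = 0.
Proof.
move=> ab ak bk lk Tx ns; have [e1 e2 e3] := al0 ab ns.
rewrite (edge_point ab ak bk lk) majorant_edge //; first by rewrite e1 e2 e3; ring.
by rewrite lam_le1 // andbT; move/ThatP: Tx.
Qed.

Lemma majorant_match i j a b k x x' : a != b -> a != k -> b != k ->
  lam k x = 0 -> 0 < lam a x -> 0 < lam b x -> shared i a b ->
  i != j -> @That R x -> @That R x' -> F j x' = F i x -> majorant i x = majorant j x'.
Proof.
move=> ab ak bk lk la lb sh ij Tx Tx' Fx'.
have [a' [b' [ab' ea eb ->]]] := shared_match ab ak bk lk la lb sh ij Tx' Fx'.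
have t01 : 0 <= lam b x <= 1 by rewrite ltW //= lam_le1.
by rewrite {1}(edge_point ab ak bk lk) !majorant_edge // ea eb.
Qed.

(** A point common to two triangles lies on an open edge of each. If one of these edges is shared
    the values match through its nodes, and if neither is, both values are 0. Vertices are excluded
    because the local picture of [shared_ball] concerns open edges. *)
Lemma majorant_compat i j x x' : @That R x -> @That R x' -> F i x = F j x' ->
  (forall l a, F i x != vtx l a) -> majorant i x = majorant j x'.
Proof.
move=> Tx Tx' Fx nv; have [ij|ij] := eqVneq i j.
  by subst j; congr majorant; exact: (@F_inj i).
have nT : ~ Tint x.
  move=> /Tint_interior-/(_ i); rewrite Fx => /interior_T_disj-/(_ Tx') e.
  by rewrite e eqxx in ij.
have nT' : ~ Tint x'.
  move=> /Tint_interior-/(_ j); rewrite -Fx => /interior_T_disj-/(_ Tx) e.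
  by rewrite e eqxx in ij.
have [a [b [k [[ab ak bk] [lk la lb]]]]] := edge_case Tx nT (nv i).
have nv' c : F j x' != vtx j c by rewrite -Fx.
have [a' [b' [k' [[ab' ak' bk'] [lk' la' lb']]]]] := edge_case Tx' nT' nv'.
have [sh|sh] := pselect (shared i a b); first exact: (majorant_match ab ak bk).
have [sh'|sh'] := pselect (shared j a' b').
  by symmetry; apply: (majorant_match ab' ak' bk') => //; rewrite eq_sym.
by rewrite (majorant_unshared ab ak bk) // (majorant_unshared ab' ak' bk').
Qed.

(** On a shared edge [shared_ball] would make the point interior to the union; hence the edge is
    unshared and carries no active node. *)
Lemma majorant_bdry i x : @That R x -> ~ U° (F i x) -> (forall a, F i x != vtx i a) -> majorant i x = 0.
Proof.
move=> Tx nU nv.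
have nT : ~ Tint x.
  move=> /Tint_interior-/(_ i) h; apply: nU; apply: filterS h => y Ty.
  by exists i.
have [a [b [k [[ab ak bk] [lk la lb]]]]] := edge_case Tx nT nv.
have [sh|sh] := pselect (shared i a b); last exact: (majorant_unshared ab ak bk).
have [j [a' [b' [ij ab' ea eb]]]] := sh.
have [_ [rho rho0 h]] := shared_ball ab ak bk ij ab' ea eb lk la lb.
exfalso; apply: nU; apply/nbhs_ballP; exists rho => // y; rewrite -ball_normE /= distrC => /h[Ty|Ty].
  by exists i.
by exists j.
Qed.

Hypothesis J_ge : forall i, exists2 c : R, 0 < c &
  forall x, @That R x -> c <= qjac (q i) (p i) x.

(** The midpoint of two points of the convex reference triangle stays in it, where the determinant
    is bounded below. Summing the constants of the finitely many triangles makes the bound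
    uniform. *)
Lemma F_coercive : exists2 L, 0 <= L & forall i x y, @That R x -> @That R y ->
  `|x - y| <= L * `|F i x - F i y|.
Proof.
have H i : exists L, 0 <= L /\ forall x y, @That R x -> @That R y ->
  `|x - y| <= L * `|F i x - F i y|.
  have [c c0 hc] := J_ge i; exists (2 * jacbound (q i) (p i) 1 / c); split.
    by rewrite divr_ge0 ?mulr_ge0 ?jacbound_ge0 // ltW.
  move=> x y Tx Ty; have Tm := That_mid Tx Ty.
  apply: qmap_coercive => //; last exact/jacboundP/That_norm.
  by rewrite (le_trans (hc _ Tm)) // ler_norm.
have [L hL] := choice H.
have L0 j : 0 <= L j by case: (hL j).
exists (\sum_j L j); first by rewrite sumr_ge0.
move=> i x y Tx Ty; apply: le_trans ((hL i).2 x y Tx Ty) _.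
by rewrite ler_wpM2r // (bigD1 i) //= lerDl sumr_ge0.
Qed.

(** A small move along the normal leaves one line, and being off that line is an open condition, so
    the finitely many lines are treated in turn. It serves to choose segments that miss all
    vertices. *)
Lemma avoid_lines (s : seq ((R * R) * (R * R))) (W : set (R * R)) z : open W -> W z ->
  (forall u, u \in s -> u.1 != u.2) ->
  exists2 z', W z' & forall u, u \in s -> side u.1 u.2 z' != 0.
Proof.
elim: s W z => [|[u w] s IH] W z oW Wz hs; first by exists z.
have uw : u != w by apply: (hs (u, w)); rewrite mem_head.
have [r r0 zr] := open_ballP oW Wz.
have n0 := nrm_neq0 uw.
have [z1 Wz1 [e eE sz1]] : exists2 z1, W z1 & exists2 e : R, e = 1 \/ e = -1 & 0 < e * side u w z1.
  have [h|h|h] := ltgtP 0 (side u w z).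
  - by exists z => //; exists 1; [left|rewrite mul1r].
  - by exists z => //; exists (-1); [right|rewrite mulN1r oppr_gt0].
  pose N := `|nrm u w| + 1; have N0 : 0 < N by rewrite ltr_pwDr.
  pose d := r / N / 2; have d0 : 0 < d by rewrite !divr_gt0.
  exists (z + d *: nrm u w).
    apply: zr; rewrite opprD addrA subrr add0r normrN normrZ gtr0_norm //.
    have -> : r = d * (2 * N) by rewrite /d; field; rewrite gt_eqF.
    by rewrite ltr_pM2l // /N; have := normr_ge0 (nrm u w); lra.
  by exists 1; [left|rewrite mul1r side_shift -h add0r mulr_gt0].
have [W' /= hW' [oW' W'z1]] : exists2 W' : set (R * R), W' `<=` W /\ (forall y, W' y -> side u w y != 0)
    & open W' /\ W' z1.
  pose V := [set y | 0 < e * side u w y].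
  have oV : open V.
    apply: openP => y0 Vy0; have := near_side_gt Vy0 => /nbhs_ballP[d /= d0 hd].
    by exists d => // y xy; apply: hd; rewrite -ball_normE.
  exists (W `&` V).
    split=> [y []//|y [_]]; rewrite /V /= => hy; apply/eqP => h.
    by rewrite h mulr0 ltxx in hy.
  by split=> //; exact: openI.
have [|z' W'z' hz'] := IH W' z1 oW' W'z1.
  by move=> v vs; apply: hs; rewrite inE vs orbT.
exists z'; first exact: hW'.1.
move=> v; rewrite inE => /orP[/eqP->|]; last exact: hz'.
exact: hW'.2.
Qed.

Lemma closed_U : closed U.
Proof.
by apply: closed_bigcup => [|i _]; [exact: finite_finset|exact: closed_T].
Qed.

Lemma F_surj : exists Fi : I -> R * R -> R * R, forall j y, T j y ->
  @That R (Fi j y) /\ F j (Fi j y) = y.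
Proof.
have H (u : I * (R * R)) : exists x, T u.1 u.2 -> @That R x /\ F u.1 x = u.2.
  have [[x Tx xE]|h] := pselect (T u.1 u.2); first by exists x.
  by exists 0.
by have [Fi hFi] := choice H; exists (fun j y => Fi (j, y)) => j y /(hFi (j, y)).
Qed.

(** The last hypothesis says that no vertex is on the line from [F i x] to [z]. At the infimum [s]
    of the parameters outside the interior of the union, the point still belongs to the closed
    union, but not to its interior, so the majorant is 0 there; [lipschitz_chain] carries the
    estimate from [F i x] to that point. *)
Lemma majorant_exit i x z (L : R) : Tint x -> ~ U z -> 0 <= L ->
  (forall i x y, @That R x -> @That R y -> `|x - y| <= L * `|F i x - F i y|) ->
  (forall l a, side (F i x) (vtx l a) z != 0) ->
  majorant i x <= 44 * L * `|F i x - z|.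
Proof.
move=> Tx nUz L0 hL hside.
have [Fi hFi] := F_surj.
set y := F i x; pose w (t : R) := y + t *: (z - y); pose N := `|y - z|.
have wd s t : `|w s - w t| = `|s - t| * N.
  have -> : w s - w t = (s - t) *: (z - y).
    by rewrite /w opprD addrACA subrr add0r scalerBl.
  by rewrite normrZ /N (distrC y z).
have wv t l a : w t != vtx l a.
  apply/eqP => h; have /eqP := hside l a; apply; rewrite -h /w /side /nrm -/y.
  by case: (y) (z) => [y1 y2] [z1 z2]; rewrite /= /GRing.scale /=; ring.
have w1 : w 1 = z by rewrite /w scale1r addrC subrK.
have w0 : w 0 = y by rewrite /w scale0r addr0.
pose E := [set t : R | 0 <= t <= 1 /\ ~ U° (w t)].
have E1 : E 1.
  by split; [rewrite ler01 lexx|rewrite w1 => /interior_subset].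
have iE : has_inf E by split; [exists 1|exists 0 => t [/andP[]]].
pose s := inf E.
have s0 : 0 <= s by apply: lb_le_inf; [exists 1|move=> t [/andP[]]].
have s1 : s <= 1 by apply: ge_inf => //; case: iE.
have N1 : 0 < N + 1 by rewrite ltr_pwDr // /N normr_ge0.
have close (t r : R) : 0 < r -> `|s - t| < r / (N + 1) -> `|w s - w t| < r.
  move=> r0; rewrite wd ltr_pdivlMr // => h; apply: le_lt_trans h.
  by rewrite ler_wpM2l // lerDl.
have nUs : ~ U° (w s).
  move=> Us; have [r r0 hr] := open_ballP (@open_interior _ _) Us.
  have [t [t01 nUt] ts] : exists2 t, E t & t < s + r / (N + 1).
    by apply: inf_adherent => //; rewrite divr_gt0.
  apply/nUt/hr/close => //; rewrite distrC ger0_norm; first by rewrite ltrBlDl.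
  by rewrite subr_ge0; apply: ge_inf; [case: iE|].
have Ut t : 0 <= t -> t < s -> U (w t).
  move=> t0 ts; apply: contrapT => h; have : s <= t.
    apply: ge_inf; first by case: iE.
    split; first by rewrite t0 /= (le_trans (ltW ts)).
    by move=> /interior_subset.
  by rewrite leNgt ts.
have Us : U (w s).
  have [->|sn0] := eqVneq s 0; first by rewrite w0; exists i => //; exists x => //; exact: Tint_That.
  have sp : 0 < s by rewrite lt_neqAle eq_sym sn0.
  apply: contrapT => h.
  have oCU : open (~` U) by rewrite openC; exact: closed_U.
  have [r r0 hr] := open_ballP oCU h.
  pose d := Num.min s (r / (N + 1) / 2).
  have d0 : 0 < d by rewrite lt_min sp !divr_gt0.
  have : ~ U (w (s - d)).
    apply/hr/close => //; rewrite opprB addrC subrK gtr0_norm // gt_min; apply/orP; right.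
    by have : 0 < r / (N + 1) by [rewrite divr_gt0|]; lra.
  apply; apply: Ut; first by rewrite subr_ge0 ge_min lexx.
  by rewrite ltrBlDr ltrDl.
have [j _ Tj] := Us.
have cw : continuous w.
  move=> t; apply/cvgrPdist_lt => r r0; apply/nbhs_ballP; exists (r / (N + 1)).
    by rewrite /= divr_gt0.
  move=> t'; rewrite /ball_ /= wd ltr_pdivlMr // => h; apply: le_lt_trans h.
  by rewrite ler_wpM2l // lerDl.
have H := @lipschitz_chain R I [set: I]%SET (fun j => [set t | T j (w t)])
  (fun j t => majorant j (Fi j (w t))) (44 * L * N) 0 s s0.
have Tiy : T i (w 0) by rewrite w0; exists x => //; exact: Tint_That.
have := H _ _ _ _ i j; rewrite !inE subr0.
have -> : Fi i (w 0) = x.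
  have [h1 h2] := hFi i _ Tiy; apply: (@F_inj i) => //; first exact: Tint_That.
  by rewrite h2 w0.
have [h1 h2] := hFi j _ Tj.
rewrite (@majorant_bdry j (Fi j (w s))) ?h2 // subr0 => h.
apply: (@le_trans _ _ (44 * L * N * s)); last first.
  by rewrite -/N ler_piMr // mulr_ge0 ?mulr_ge0 // /N normr_ge0.
apply: le_trans (ler_norm _) _; apply: h => //.
- by move=> l; apply: (@closed_comp _ _ w (T l)) => [t _|]; [exact: cw|exact: closed_T].
- move=> t /andP[t0]; rewrite le_eqVlt => /orP[/eqP->|ts]; first by exists j; rewrite ?inE.
  by have [l _ Tl] := Ut t t0 ts; exists l; rewrite ?inE.
- move=> l t t' Tt Tt' _ _; have [g1 g2] := hFi l _ Tt; have [g3 g4] := hFi l _ Tt'.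
  apply: le_trans (majorant_lipschitz _ g1 g3) _.
  rewrite -!mulrA ler_wpM2l //; apply: le_trans (hL l _ _ g1 g3) _.
  by rewrite g2 g4 wd [N * _]mulrC.
- move=> l m t Tl Tm _; have [g1 g2] := hFi l _ Tl; have [g3 g4] := hFi m _ Tm.
  by apply: majorant_compat => // [|k a]; rewrite g2 ?g4.
Qed.

(** A point outside the interior of the union is a limit of points outside the union, and these can
    be moved off the finitely many lines joining [F i x] to vertices. The error [e] of this
    displacement is arbitrary. *)
Lemma majorant_le_dist : exists2 C, 0 <= C & forall i x z, Tint x -> ~ U° z ->
  majorant i x <= C * `|F i x - z|.
Proof.
have [L L0 hL] := F_coercive.
exists (44 * L); first by rewrite mulr_ge0.
move=> i x z Tx nUz; apply/ler_addgt0Pr => e e0.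
pose d := e / (44 * L + 1).
have L1 : 0 < 44 * L + 1 by rewrite ltr_wpDl // mulr_ge0.
have d0 : 0 < d by rewrite divr_gt0.
have nv l a : F i x != vtx l a.
  apply/eqP => h; have := @interior_T_disj l i _ (@rv_That R a).
  rewrite F_rv -h => /(_ (Tint_interior _ Tx)) li; subst l.
  move: h; rewrite -F_rv => /(@F_inj i)-/(_ (Tint_That Tx) (@rv_That R a)) xa.
  have [k ka] := other a.
  by have := Tx k; rewrite xa lam_rv (negbTE ka) ltxx.
have : closure (~` U) z by rewrite closure_setC.
move=> /(_ (ball z d)) [|z1 [nUz1]]; first exact: nbhsx_ballx.
rewrite -ball_normE /= => zz1.
pose W := [set y | `|z - y| < d] `&` ~` U.
have oW : open W.
  apply: openI; last by rewrite openC; exact: closed_U.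
  apply: openP => y /= yd; exists (d - `|z - y|); first by rewrite subr_gt0.
  move=> y' yy'; have -> : z - y' = (z - y) + (y - y') by rewrite addrA subrK.
  by rewrite (le_lt_trans (ler_normD _ _)) // addrC -ltrBrDr.
pose s := [seq (F i x, vtx u.1 u.2) | u <- enum {: I * 'I_3}].
have [||z' [zz' nUz'] hz'] := @avoid_lines s W z1 oW; first by split.
  by move=> u /mapP[[l a] _ ->] /=.
apply: le_trans (@majorant_exit i x z' L Tx nUz' L0 hL _) _.
  by move=> l a; apply: (hz' (F i x, vtx l a)); apply/mapP; exists (l, a); rewrite ?mem_enum.
have -> : F i x - z' = (F i x - z) + (z - z') by rewrite addrA subrK.
have h1 : `|F i x - z + (z - z')| <= `|F i x - z| + d by rewrite (le_trans (ler_normD _ _)) // lerD2l ltW.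
have h2 : 44 * L * d <= e.
  by rewrite /d mulrA ler_pdivrMr // mulrC ler_pM2l // lerDl.
apply: (@le_trans _ _ (44 * L * (`|F i x - z| + d))); first by rewrite ler_wpM2l // mulr_ge0.
by rewrite mulrDr lerD2l.
Qed.

(** On the subtriangle [k], [lam_min] is [lam k]. In the Lagrange expansion the nodes of the edge
    [a b] come with the weights of [majorant], and all other nodes come with the factor [lam k]; so
    only the nodal values on the outer edge have to be compared with [al]. *)
Lemma qev_le_majorant i a b k s (M : R) : a != b -> a != k -> b != k -> 0 <= M ->
  `|qev s (rv R a)| <= M * al (vtx i a) -> `|qev s (rv R b)| <= M * al (vtx i b) ->
  `|qev s (emid R a b)| <= M * al (2^-1 *: (vtx i a + vtx i b)) ->
  exists2 C, 0 <= C & forall x, @Khat R k x -> `|qev s x| <= C * majorant i x.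
Proof.
move=> ab ak bk M0 ha hb hm; have [Cm Cm0 hCm] := edge_m_bound s a b k.
exists (4 * M + Cm); first by rewrite addr_ge0 // mulr_ge0.
move=> x /KhatP[k0 kl].
have Tx : @That R x by apply/ThatP => c; exact: le_trans (kl c).
have l0 c : 0 <= lam c x by move/ThatP: Tx.
have l1 c := lam_le1 c Tx.
have a0 y : 0 <= al y by have /andP[] := al01 y.
have muE : lam_min x = lam k x.
  by apply/eqP; rewrite eq_le lam_min_le; have [c ->] := lam_min_eq x; exact: kl.
have WE : al (vtx i a) * lam a x + al (vtx i b) * lam b x +
    al (2^-1 *: (vtx i a + vtx i b)) * (lam a x * lam b x) + lam k x <= majorant i x.
  rewrite /majorant muE !(sum_I3_perm _ ab ak bk).
  have n c d : 0 <= al (2^-1 *: (vtx i c + vtx i d)) * (lam c x * lam d x).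
    by rewrite !mulr_ge0.
  have := n a a; have := n b b; have := n k k; have := n a k; have := n k a; have := n b k.
  have := n k b; have := n b a; have nk : 0 <= al (vtx i k) * lam k x by rewrite mulr_ge0.
  lra.
have q1 c : `|qev s (rv R c)| <= M * al (vtx i c) ->
    `|qev s (rv R c) * (lam c x * (2 * lam c x - 1))| <= M * (al (vtx i c) * lam c x).
  move=> h; rewrite normrM mulrA ler_pM // normrM (ger0_norm (l0 c)) ler_piMr //.
  by rewrite ler_norml; have := l0 c; have := l1 c; move=> u1 u2; apply/andP; split; lra.
have q2 : `|4 * qev s (emid R a b) * (lam a x * lam b x)| <=
    4 * M * (al (2^-1 *: (vtx i a + vtx i b)) * (lam a x * lam b x)).
  rewrite normrM [X in _ * X]ger0_norm ?mulr_ge0 // mulrA ler_wpM2r ?mulr_ge0 //.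
  by rewrite normrM ger0_norm // -mulrA ler_wpM2l.
have q3 : `|lam k x * edge_m s a b k x| <= Cm * lam k x.
  by rewrite normrM ger0_norm // mulrC ler_wpM2r // hCm.
rewrite (qev_lagrange _ _ ab ak bk).
have n1 : 0 <= al (vtx i a) * lam a x by rewrite mulr_ge0.
have n2 : 0 <= al (vtx i b) * lam b x by rewrite mulr_ge0.
have n3 : 0 <= al (2^-1 *: (vtx i a + vtx i b)) * (lam a x * lam b x) by rewrite !mulr_ge0.
move: (q1 a ha) (q1 b hb) q2 q3 => {ha hb hm hCm q1} r1 r2 r3 r4.
have tot := ler_normD_le (ler_normD_le (ler_normD_le r1 r2) r3) r4.
apply: le_trans tot _; apply: le_trans (_ : (4 * M + Cm) * (al (vtx i a) * lam a x + al (vtx i b) * lam b x +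
    al (2^-1 *: (vtx i a + vtx i b)) * (lam a x * lam b x) + lam k x) <= _); last first.
  by rewrite ler_wpM2l // addr_ge0 // mulr_ge0.
have k0' := l0 k.
move: (al (vtx i a) * lam a x) (al (vtx i b) * lam b x) (al (2^-1 *: (vtx i a + vtx i b)) * (lam a x * lam b x))
  (lam k x) n1 n2 n3 k0' => A B D E A0 B0 D0 E0.
have := mulr_ge0 M0 A0; have := mulr_ge0 M0 B0; have := mulr_ge0 M0 E0; have := mulr_ge0 M0 D0.
have := mulr_ge0 Cm0 A0; have := mulr_ge0 Cm0 B0; have := mulr_ge0 Cm0 D0.
lra.
Qed.
End CurvedMesh.

(** * Boundary values of functions in the closure of test functions *)

Section TraceZero.
Variable R : realType.
Implicit Types (x y : R * R) (D : set (R * R)).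
Local Notation mu := (@mu2 R).

Lemma C1cM D (phi h : R * R -> R) (gh : R * R -> R * R) : C1c D phi ->
  (forall x, has_grad h x (gh x)) ->
  continuous (fun x => (gh x).1) -> continuous (fun x => (gh x).2) ->
  C1c D (fun x => phi x * h x).
Proof.
move=> Cphi hh c1 c2; have [dphi cphi Kphi sphi] := Cphi.
have cph := C1c_continuous Cphi.
have ch : continuous h by move=> x; exact: has_grad_continuous (hh x).
apply: (@C1c_intro _ D (closure [set x | phi x != 0]) _
  (fun x => phi x *: gh x + h x *: (partial ord0 phi x, partial ord_max phi x))) => //.
- move=> x; apply: has_gradM => //; exact: differentiable_has_grad.
- by move=> x; apply: cvgD; apply: cvgM; [exact: cph|exact: c1|exact: ch|exact: cphi].
- by move=> x; apply: cvgD; apply: cvgM; [exact: cph|exact: c2|exact: ch|exact: cphi].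
- move=> x h0; apply: subset_closure => /=; apply/eqP => p0.
  by apply: h0; rewrite p0 mul0r.
Qed.

(** Stands in for the Cauchy-Schwarz inequality: an L^2 bound [k ^+ 2] yields an L^1 bound of order
    [k] on a set of finite measure. *)
Lemma ler_sqr_div (a k : R) : 0 < k -> `|a| <= a ^+ 2 / k + k.
Proof.
move=> k0; rewrite -real_normK ?num_real //; have := normr_ge0 a; set b := `|a| => b0.
have [bk|kb] := leP b k.
  by rewrite ler_wpDl // divr_ge0 ?sqr_ge0 // ltW.
rewrite ler_wpDr // ?ltW //; rewrite ltr_pdivlMr // expr2.
by rewrite ltr_pM2l //; exact: lt_trans kb.
Qed.

Lemma le_normr_Rintegral2 D (f g : R * R -> R) : measurable D ->
  mu.-integrable D (EFin \o f) -> mu.-integrable D (EFin \o g) ->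
  (forall x, D x -> `|f x| <= g x) ->
  `|\int[mu]_(x in D) f x| <= \int[mu]_(x in D) g x.
Proof.
move=> mD fi gi fg.
have h1 : `|\int[mu]_(x in D) f x| <= \int[mu]_(x in D) `|f x| by exact: le_normr_Rintegral.
apply: le_trans h1 _.
have ni : mu.-integrable D (EFin \o (fun x => `|f x|)) by exact: integrable_norm fi.
by apply: le_Rintegral.
Qed.

(** [psi] may be nonzero on the boundary of [D]: the boundary term is absent because [f] is a limit
    of compactly supported [phi], for which the identity is ordinary integration by parts. The error
    of the replacement is estimated by [ler_sqr_div]. *)
Lemma H10_by_parts D f (g : 'I_2 -> R * R -> R) psi (M : R) (j : 'I_2) :
  open D -> (forall x, D x -> `|x| <= M) -> C1c setT psi ->
  in_L2 D f -> (forall j, in_L2 D (g j)) ->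
  (forall eps : R, 0 < eps -> exists2 phi, C1c D phi &
     (\int[mu]_(x in D) ((f x - phi x) ^+ 2
              + \sum_j (g j x - partial j phi x) ^+ 2)%:E < eps%:E)%E) ->
  \int[mu]_(x in D) (f x * partial j psi x + g j x * psi x) = 0.
Proof.
move=> oD DM Cpsi fL gL H; have mD := open_measurable2 oD; have Dfin := mu2_bounded_lty mD DM.
have [dpsi cpsi Kpsi _] := Cpsi.
have [B0 hB0] := C1c_bounded Cpsi.
have B00 : 0 <= B0 by exact: le_trans (hB0 0).
have [B1 B10 hB1] := continuous_support_bounded Kpsi (cpsi j)
  (fun x => @partial_outside_support _ _ psi j x Cpsi).
pose B := B0 + B1.
have B_ge0 : 0 <= B by exact: addr_ge0.
have hB x : `|psi x| <= B by rewrite (le_trans (hB0 x)) // lerDl.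
have hB' x : `|partial j psi x| <= B by rewrite (le_trans (hB1 x)) // lerDr.
have mc (h : R * R -> R) : continuous h -> measurable_fun D h.
  by move=> ch; apply: (@measurable_funS _ _ _ _ setT) => //; exact: continuous_measurable_fun2.
have mpsi := mc _ (C1c_continuous Cpsi); have mdpsi := mc _ (cpsi j).
have fi := in_L2_integrable mD Dfin fL; have gi := in_L2_integrable mD Dfin (gL j).
have fpi := integrable2_Mbounded mD fi mdpsi (fun x _ => hB' x).
have gpi := integrable2_Mbounded mD gi mpsi (fun x _ => hB x).
set Del := \int[mu]_(x in D) _.
pose V := fine (mu D); have V0 : 0 <= V by exact: fine_ge0.
have main (k : R) : 0 < k -> `|Del| <= B * (1 + 2 * V) * k.
  (* The tolerance [k ^+ 2] turns the term [B / k * S] into one of order [k] after integration. *)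
  move=> k0; have [phi Cphi] := H (k ^+ 2) (exprn_gt0 _ k0).
  pose S x := (f x - phi x) ^+ 2 + \sum_j (g j x - partial j phi x) ^+ 2.
  have [_ cphi _ _] := Cphi.
  have mS : measurable_fun D S.
    rewrite /S; under eq_fun do rewrite sum_I2.
    have [mf _] := fL.
    have m2 i : measurable_fun D (fun x => (g i x - partial i phi x) ^+ 2).
      by have [mg _] := gL i; apply: measurable_funX; apply: measurable_funB => //; exact: mc (cphi i).
    apply: measurable_funD; last by apply: measurable_funD.
    by apply: measurable_funX; apply: measurable_funB => //; exact: mc (C1c_continuous Cphi).
  have S0 x : 0 <= S x by rewrite addr_ge0 ?sqr_ge0 // sumr_ge0 // => i _; exact: sqr_ge0.
  move=> Slt.
  have Si : mu.-integrable D (EFin \o S).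
    apply/integrableP; split; first exact/measurable_EFinP.
    apply: le_lt_trans (lt_trans Slt (ltry _)).
    by under eq_integral do rewrite /= ger0_norm //.
  have Slt' : \int[mu]_(x in D) S x < k ^+ 2.
    by rewrite -lte_fin EFin_Rintegral2.
  have dp x : is_derive x (dirv R j) psi (partial j psi x).
    by split => //; exact: diff_derivable.
  have [i1 i2 e1] : [/\ mu.-integrable D (EFin \o (fun x => partial j psi x * phi x)),
      mu.-integrable D (EFin \o (fun x => psi x * partial j phi x)) &
      \int[mu]_(x in D) (partial j psi x * phi x) = - \int[mu]_(x in D) (psi x * partial j phi x)].
    apply: (@integral_by_parts_C1c _ D psi (partial j psi) phi j M oD DM Cphi) => x _;
      last exact: cpsi.
    exact: (C1c_continuous Cpsi).
  pose T x := (f x - phi x) * partial j psi x + (g j x - partial j phi x) * psi x.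
  have TE : (fun x => f x * partial j psi x + g j x * psi x) =
    fun x => T x + (partial j psi x * phi x + psi x * partial j phi x).
    by apply/funext => x; rewrite /T; ring.
  have Ti : mu.-integrable D (EFin \o T).
    rewrite (_ : T = fun x => (f x * partial j psi x + g j x * psi x)
       - (partial j psi x * phi x + psi x * partial j phi x)); last first.
      by apply/funext => x; rewrite /T; ring.
    by apply: (integrable2B mD); apply: (integrable2D mD).
  have -> : Del = \int[mu]_(x in D) T x.
    rewrite /Del TE (Rintegral2D mD Ti) ?(Rintegral2D mD i1 i2); last exact: integrable2D.
    by rewrite e1 addrC addNr addr0 || (rewrite e1 addNr addr0).
  have bi : mu.-integrable D (EFin \o (fun x => B / k * S x + 2 * B * k)).
    apply: (integrable2D mD); first exact: integrable2Z.
    by apply: (@integrable2_bounded _ _ _ `|2 * B * k|) => // x _ /=.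
  apply: (@le_trans _ _ (\int[mu]_(x in D) (B / k * S x + 2 * B * k))).
    apply: (le_normr_Rintegral2 mD Ti bi).
    move=> x Dx.
    have h1 : `|T x| <= `|f x - phi x| * B + `|g j x - partial j phi x| * B.
      by apply: ler_normD_le; rewrite normrM ler_wpM2l.
    have h2 := ler_sqr_div (f x - phi x) k0; have h3 := ler_sqr_div (g j x - partial j phi x) k0.
    have h4 : (f x - phi x) ^+ 2 + (g j x - partial j phi x) ^+ 2 <= S x.
      rewrite /S lerD2l (bigD1 j) //= lerDl sumr_ge0 // => i _; exact: sqr_ge0.
    have h5 : (f x - phi x) ^+ 2 / k + (g j x - partial j phi x) ^+ 2 / k <= S x / k.
      by rewrite -mulrDl ler_wpM2r // invr_ge0 ltW.
    apply: le_trans h1 _; rewrite -mulrDl mulrC.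
    have -> : B / k * S x + 2 * B * k = B * (S x / k + 2 * k) by field; rewrite gt_eqF.
    by rewrite ler_wpM2l //; lra.
  rewrite (Rintegral2D mD) ?(Rintegral2Z mD _ Si); last 2 first.
  - exact: integrable2Z.
  - by apply: (@integrable2_bounded _ _ _ `|2 * B * k|) => // x _ /=.
  rewrite Rintegral_cst // -/V.
  have -> : B * (1 + 2 * V) * k = B / k * k ^+ 2 + 2 * B * k * V.
    by field; rewrite gt_eqF.
  rewrite lerD2r; apply: ler_wpM2l; last exact: ltW.
  by apply: divr_ge0 => //; exact: ltW.
apply/eqP; rewrite -normr_le0; apply/ler_addgt0Pr => e e0; rewrite add0r.
have c0 : 0 < B * (1 + 2 * V) + 1 by rewrite ltr_wpDl // mulr_ge0 // addr_ge0 // mulr_ge0.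
apply: le_trans (main (e / (B * (1 + 2 * V) + 1)) _) _; first by rewrite divr_gt0.
by rewrite mulrA ler_pdivrMr // mulrC ler_wpM2l ?lerDl // ltW.
Qed.

(** The area is the integral of the lengths of the vertical sections, each of which contains an
    interval of length [2 * w] when its abscissa lies in []a, b[]. *)
Lemma mu2_section_ge (A : set (R * R)) (a b w : R) : measurable A -> a <= b -> 0 <= w ->
  (forall s, a < s < b -> exists m, forall t, m - w < t < m + w -> A (s, t)) ->
  (((b - a) * (2 * w))%:E <= mu A)%E.
Proof.
move=> mA ab w0 h.
pose m1 := @lebesgue_measure R.
have mE : measurable (`]a, b[%classic : set R) by exact: measurable_itv.
have mf : measurable_fun setT (m1 \o xsection A) by exact: measurable_fun_xsection.
have -> : mu A = (\int[m1]_x (m1 \o xsection A) x)%E by [].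
apply: (@le_trans _ _ (\int[m1]_(x in `]a, b[) (2 * w)%:E)%E).
  rewrite integral_cst //= lebesgue_measure_itv /= lte_fin.
  have [lt_ab|] := ltP a b; first by rewrite -EFinD -EFinM mulrC.
  by move=> ba; rewrite mule0 (le_anti (introT andP (conj ab ba))) subrr mul0r.
apply: (@le_trans _ _ (\int[m1]_(x in `]a, b[) (m1 \o xsection A) x)%E); last first.
  by apply: ge0_subset_integral.
apply: ge0_le_integral => //.
- by move=> x _; rewrite lee_fin mulr_ge0.
- exact: measurable_funTS.
move=> s; rewrite /= in_itv /= => /h[m hm].
apply: (@le_trans _ _ (m1 `]m - w, m + w[%classic)).
  rewrite /m1 lebesgue_measure_itv /= lte_fin.
  case: ltP => mw; first by rewrite -EFinD lee_fin; lra.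
  by rewrite lee_fin; lra.
apply: le_measure; rewrite ?inE //.
- exact: measurable_xsection.
- by move=> t; rewrite /= in_itv /= => /hm; rewrite /xsection /= inE.
Qed.

(** The middle half of the slab of width [d] next to the line, cut down to a ball: there
    [tent (1 - l / d)] is at least 1, where [l] is the affine function. *)
Definition strip (al be ga rho : R) (x0 : R * R) (d : R) : set (R * R) :=
  [set x | `|x0 - x| < rho /\ d / 4 < al + be * x.1 + ga * x.2 < 3 * d / 4].

Lemma open_strip al be ga rho x0 d : open (strip al be ga rho x0 d).
Proof.
apply: openP => x [/= xr /andP[x1 x2]].
have c : continuous (qev (Quad al be ga 0 0 0)) by exact: continuous_qev.
have E z : qev (Quad al be ga 0 0 0) z = al + be * z.1 + ga * z.2 by rewrite /qev /=; ring.
pose e := Num.min (al + be * x.1 + ga * x.2 - d / 4) (3 * d / 4 - (al + be * x.1 + ga * x.2)).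
have e0 : 0 < e by rewrite lt_min !subr_gt0 x1.
have [r r0 hr] := cvg_ball (@c x) e0.
exists (Num.min r (rho - `|x0 - x|)); first by rewrite lt_min r0 subr_gt0.
move=> y; rewrite lt_min => /andP[y1 y2]; split.
  have -> : x0 - y = (x0 - x) + (x - y) by rewrite addrA subrK.
  by rewrite (le_lt_trans (ler_normD _ _)) // -ltrBrDl.
have := hr y y1; rewrite !E lt_min !ltr_norml => /andP[/andP[u1 u2] /andP[u3 u4]].
by apply/andP; split; lra.
Qed.

(** The area is at least proportional to the width [d], which matches the factor [1 / d] in the
    derivative of the test functions of [trace_zero]. *)
Lemma strip_measure (al be ga rho : R) (x0 : R * R) : (be != 0) || (ga != 0) -> 0 < rho ->
  al + be * x0.1 + ga * x0.2 = 0 ->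
  exists2 k, 0 < k & exists2 d0, 0 < d0 & forall d, 0 < d < d0 ->
    ((k * d)%:E <= mu (strip al be ga rho x0 d))%E.
Proof.
move=> bg rho0 l0.
have mA d : measurable (strip al be ga rho x0 d) by apply: open_measurable2; exact: open_strip.
have near x : `|x0.1 - x.1| < rho -> `|x0.2 - x.2| < rho -> `|x0 - x| < rho.
  by move=> h1 h2; rewrite prod_normE gt_max h1.
(* Sections are vertical. For a vertical line they are long and exist over a short interval of
   abscissas; otherwise they have length proportional to [d] over an interval of fixed length. *)
have [ga0|ga0] := eqVneq ga 0.
  rewrite ga0 eqxx orbF in bg; have b0 : 0 < `|be| by rewrite normr_gt0.
  exists (rho / `|be|); first by rewrite divr_gt0.
  exists (rho * `|be|); first by rewrite mulr_gt0.
  move=> d /andP[d0 dd].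
  pose w := d / (4 * `|be|); pose c := (d / 2 - al) / be.
  have w0 : 0 < w by rewrite divr_gt0 // mulr_gt0.
  have -> : rho / `|be| * d = ((c + w) - (c - w)) * (2 * rho).
    by rewrite /w; field; rewrite gt_eqF.
  apply: mu2_section_ge => //; [by lra|exact: ltW|].
  move=> s /andP[s1 s2]; exists x0.2 => t /andP[t1 t2].
  have bw : `|be| * w = d / 4 by rewrite /w; field; rewrite gt_eqF.
  have sc : `|s - c| < w by rewrite ltr_norml; apply/andP; split; lra.
  have h : `|be * s - be * c| < d / 4 by rewrite -mulrBr normrM -bw ltr_pM2l.
  have bc : be * c = d / 2 - al by rewrite /c; field.
  rewrite bc ltr_norml in h; case/andP: h => h1 h2.
  split; last by rewrite /= ga0; apply/andP; split; lra.
  apply: near => /=; last by rewrite ltr_norml; apply/andP; split; lra.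
  rewrite ga0 mul0r addr0 in l0.
  have h : `|be| * `|x0.1 - s| < `|be| * rho.
    by rewrite -normrM mulrBr [`|be| * rho]mulrC ltr_norml; apply/andP; split; lra.
  by move: h; rewrite ltr_pM2l.
have g0 : 0 < `|ga| by rewrite normr_gt0.
(* Within this horizontal distance the slope of the line contributes at most a quarter of the
   vertical room [rho], so sections of strips with [d] below [rho * |ga| / 2] stay in the ball. *)
pose r1 := Num.min rho (rho * `|ga| / (4 * (`|be| + 1))).
have b1 : 0 < 4 * (`|be| + 1) by rewrite mulr_gt0 // ltr_pwDr.
have r10 : 0 < r1 by rewrite lt_min rho0 divr_gt0 // mulr_gt0.
exists (r1 / `|ga|); first by rewrite divr_gt0.
exists (rho * `|ga| / 2); first by rewrite divr_gt0 // mulr_gt0.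
move=> d /andP[d0 dd].
pose w := d / (4 * `|ga|).
have w0 : 0 < w by rewrite divr_gt0 // mulr_gt0.
have -> : r1 / `|ga| * d = ((x0.1 + r1) - (x0.1 - r1)) * (2 * w).
  by rewrite /w; field; rewrite gt_eqF.
apply: mu2_section_ge => //; [by lra|exact: ltW|].
move=> s /andP[s1 s2]; pose m := (d / 2 - al - be * s) / ga; exists m => t /andP[t1 t2].
have gw : `|ga| * w = d / 4 by rewrite /w; field; rewrite gt_eqF.
have tm : `|t - m| < w by rewrite ltr_norml; apply/andP; split; lra.
have h : `|ga * t - ga * m| < d / 4 by rewrite -mulrBr normrM -gw ltr_pM2l.
have gm : ga * m = d / 2 - al - be * s by rewrite /m; field.
have l1 : `|x0.1 - s| < r1 by rewrite ltr_norml; apply/andP; split; lra.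
rewrite gm ltr_norml in h; case/andP: h => h1 h2.
split; last by rewrite /=; apply/andP; split; lra.
apply: near => /=; first by apply: lt_le_trans l1 _; rewrite ge_min lexx.
have h3 : `|be * (x0.1 - s)| <= rho * `|ga| / 4.
  rewrite normrM; apply: (@le_trans _ _ ((`|be| + 1) * r1)).
    apply: ler_pM => //; [by rewrite lerDl|exact: ltW].
  have : r1 <= rho * `|ga| / (4 * (`|be| + 1)) by rewrite ge_min lexx orbT.
  by rewrite ler_pdivlMr //; lra.
have h4 : `|ga| * `|x0.2 - t| < `|ga| * rho.
  rewrite -normrM mulrBr [`|ga| * rho]mulrC.
  rewrite ler_norml mulrBr in h3; case/andP: h3 => h3 h3'.
  by rewrite ltr_norml; apply/andP; split; lra.
by move: h4; rewrite ltr_pM2l.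
Qed.

Lemma tent_ge1 (v : R) : 4^-1 < v < 3 / 4 -> 1 <= tent (1 - v).
Proof.
have [t ->] : exists t, v = 1 - t by exists (1 - v); ring.
rewrite opprB addrCA subrr addr0 => /andP[]; rewrite /tent; have [[]|[]] := posE t; have [[]|[]] := posE (t - 2^-1);
  have [[]|[]] := posE (t - 1); move=> ? -> ? -> ? ->; lra.
Qed.

Lemma bump_fun (x0 : R * R) (r : R) : 0 < r -> exists eta : R * R -> R,
  [/\ C1c [set y | `|x0 - y| < r] eta, forall y, 0 <= eta y <= 1 &
      forall y, `|x0 - y| < r / 4 -> eta y = 1].
Proof.
move=> r0; pose h := r / 2.
pose n := Num.bound (4 / r).
have nr : 1 <= n%:R * (r / 4).
  have : 4 / r < n%:R by apply: archi_boundP; rewrite divr_ge0 // ltW.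
  rewrite ltr_pdivrMr // => /ltW; lra.
pose q := ((x0.1 - h, x0.1 + h), (x0.2 - h, x0.2 + h)).
exists (plateau2 q n); split.
- apply: C1c_plateau2 => y [/=]; rewrite !in_itv /= => /andP[h1 h2] /andP[h3 h4].
  have hr : h < r by rewrite /h; lra.
  by rewrite prod_normE gt_max !ltr_norml /=; apply/andP; split; apply/andP; split; lra.
- by move=> y; rewrite /plateau2; apply/andP; split; [apply: mulr_ge0|apply: mulr_ile1];
    rewrite ?plateau_ge0 ?plateau_le1.
- move=> y; rewrite prod_normE gt_max !ltr_norml /= => /andP[/andP[h1 h2] /andP[h3 h4]].
  have n0 : 0 <= n%:R :> R by [].
  have key (u : R) : r / 4 <= u -> smoothstep (n%:R * u) = 1.
    by move=> hu; apply: smoothstep_ge1; apply: le_trans nr _; exact: ler_wpM2l.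
  by rewrite /plateau2 /plateau !key ?mulr1 //= /h; lra.
Qed.

Lemma open_slab (al be ga d : R) : open [set y : R * R | 0 < al + be * y.1 + ga * y.2 < d].
Proof.
apply: openP => x /= /andP[x1 x2].
pose l (y : R * R) := al + be * y.1 + ga * y.2.
have c : continuous (qev (Quad al be ga 0 0 0)) by exact: continuous_qev.
have E z : qev (Quad al be ga 0 0 0) z = l z by rewrite /qev /l /=; ring.
pose e := Num.min (l x) (d - l x).
have e0 : 0 < e by rewrite lt_min subr_gt0 x1.
have [r r0 hr] := cvg_ball (@c x) e0; exists r => // y /hr.
rewrite !E lt_min !ltr_norml -/(l y) => /andP[/andP[u1 u2] /andP[u3 u4]].
by apply/andP; move: (l x) (l y) u1 u2 u3 u4 => a b *; split; lra.
Qed.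

(** A point with [l <= 0] is in no slab and one with [l > 0] leaves them eventually, so the
    indicators tend to 0 pointwise. *)
Lemma strip_small D (F : R * R -> R) (al be ga : R) : measurable D ->
  mu.-integrable D (EFin \o F) ->
  \int[mu]_(x in D) (F x * \1_[set y | 0 < al + be * y.1 + ga * y.2 < n.+1%:R^-1] x)
     @[n --> \oo] --> (0 : R).
Proof.
move=> mD iF; pose l (y : R * R) := al + be * y.1 + ga * y.2.
pose W n := [set y | 0 < l y < n.+1%:R^-1].
have mW n : measurable (W n) by apply: open_measurable2; exact: open_slab.
have mF : measurable_fun D F by exact: integrable2_measurable iF.
have mI n : measurable_fun D (\1_(W n) : R * R -> R) by exact: measurable_indic.
have [] := @dominated_convergence _ _ _ mu D mD
  (fun n x => (F x * \1_(W n) x)%:E) (cst 0%E) (fun x => `|F x|%:E).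
- by move=> n; apply/measurable_EFinP; exact: (measurable_funM mF (mI n)).
- exact: measurable_cst.
- apply: aeW => x Dx; apply: cvg_near_cst.
  have [l0|l0] := leP (l x) 0.
    by apply: nearW => n; rewrite indicE memNset ?mulr0 // /W /= ltNge l0.
  near=> n; rewrite indicE memNset ?mulr0 // /W /= => /andP[_]; apply/negP; rewrite -leNgt ltW //.
  by near: n; exact: (near_infty_natSinv_lt (PosNum l0)).
- by move/integrable_norm: iF.
- apply: aeW => x n Dx /=; rewrite lee_fin normrM ler_piMr // indicE.
  by case: (_ \in _); rewrite ?normr1 ?normr0.
by move=> _ _ cv; apply: fine_cvg; rewrite integral0 in cv.
Unshelve. all: by end_near. Qed.

(** Test with [psi = eta * smoothstep (1 - l / d)], which equals the bump [eta] on the boundary line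
    and lives in [l < d]. Its derivative has a part of size [1 / d] on a set of area of order [d],
    where [f] keeps the sign of [G x0]; if [G x0] were nonzero this part would stay away from 0. By
    [H10_by_parts] it equals an integral over shrinking slabs of a function with a fixed integrable
    majorant, which tends to 0. *)
Lemma trace_zero D f (al be ga r M : R) (x0 : R * R) (G : R * R -> R) :
  open D -> (forall x, D x -> `|x| <= M) -> in_H10 D f ->
  (be != 0) || (ga != 0) -> al + be * x0.1 + ga * x0.2 = 0 -> 0 < r ->
  (forall y, `|x0 - y| < r -> D y <-> 0 < al + be * y.1 + ga * y.2) ->
  (forall y, `|x0 - y| < r -> 0 < al + be * y.1 + ga * y.2 -> f y = G y) ->
  {for x0, continuous G} -> G x0 = 0.
Proof.
move=> oD DM [g [fL gL0 H]] bg l0 r0 DE fG cG; apply: contrapT => /eqP G0.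
have mD := open_measurable2 oD; have Dfin := mu2_bounded_lty mD DM.
have gL i : in_L2 D (g i) := (gL0 i).1.
pose l (y : R * R) := al + be * y.1 + ga * y.2.
have [e [en eG]] : exists e : R, `|e| = 1 /\ 0 < e * G x0.
  exists (Num.sg (G x0)); split; first by rewrite normr_sg G0.
  by rewrite -normrEsg normr_gt0.
pose c := e * G x0 / 2; have c0 : 0 < c by rewrite divr_gt0.
have [r' r'0 hr'] := cvg_ball cG c0.
pose r1 := Num.min r r'; have r10 : 0 < r1 by rewrite lt_min r0.
have r1r y : `|x0 - y| < r1 -> `|x0 - y| < r by rewrite lt_min => /andP[].
have Gc y : `|x0 - y| < r1 -> c <= e * G y.
  rewrite lt_min => /andP[_ /hr' h].
  have : `|e * (G x0 - G y)| < c by rewrite normrM en mul1r.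
  by rewrite mulrBr ltr_norml /c => /andP[_]; lra.
(* A coordinate direction transversal to the line, so that differentiating the ramp produces the
   factor [1 / d]. *)
have [j nj] : exists j : 'I_2, gcomp j (be, ga) != 0.
  by case/orP: bg => h; [exists ord0|exists ord_max].
set nj0 := gcomp j (be, ga) in nj.
have [eta [Ceta eta01 eta1]] := bump_fun x0 r10.
have [deta ceta Keta Seta] := Ceta.
have [B1 B10 hB1] := continuous_support_bounded Keta (ceta j)
  (fun x => @partial_outside_support _ _ eta j x Ceta).
pose K := B1 + 1.
pose s d := Quad (1 - al / d) (- be / d) (- ga / d) 0 0 0.
have sE d y : qev (s d) y = 1 - l y / d by rewrite /qev /l /=; ring.
pose dd n : R := n.+1%:R^-1.
have d0 n : 0 < dd n by rewrite invr_gt0.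
pose psi n y := eta y * smoothstep (qev (s (dd n)) y).
have hs n y : has_grad (fun y => smoothstep (qev (s (dd n)) y)) y
    (tent (qev (s (dd n)) y) *: (- be / dd n, - ga / dd n)).
  apply: has_grad_comp1; first exact: is_derive_smoothstep.
  by apply: (has_grad_eq (has_grad_qev _ _)); rewrite /qdx /qdy /=; congr pair; ring.
have ct n : continuous (fun y => tent (qev (s (dd n)) y)).
  by move=> y; apply: (@continuous_comp _ _ _ (qev (s (dd n))) (@tent R)); [exact: continuous_qev|exact: continuous_tent].
have Cpsi n : C1c setT (psi n).
  apply: (@C1c_sub _ [set y | `|x0 - y| < r1]) => //.
  apply: (C1cM Ceta (hs n)) => y; apply: cvgM; try exact: cvg_cst; exact: ct.
have dpsi n y : partial j (psi n) y = partial j eta y * smoothstep (qev (s (dd n)) y)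
    - nj0 / dd n * (eta y * tent (qev (s (dd n)) y)).
  have := has_gradM (differentiable_has_grad (deta y)) (hs n y).
  move/(has_grad_partial j) ->; rewrite /nj0 /gcomp; case: (j) => [[|[|//]] jj] /=; rewrite /GRing.scale /=.
    by rewrite (_ : Ordinal jj = ord0) ?/GRing.scale /=; [ring|exact: val_inj].
  by rewrite (_ : Ordinal jj = ord_max) ?/GRing.scale /=; [ring|exact: val_inj].
have key n := @H10_by_parts D f g (psi n) M j oD DM (Cpsi n) fL gL H.
have fi := in_L2_integrable mD Dfin fL; have gi := in_L2_integrable mD Dfin (gL j).
have mc (h : R * R -> R) : continuous h -> measurable_fun D h.
  by move=> ch; apply: (@measurable_funS _ _ _ _ setT) => //; exact: continuous_measurable_fun2.
have css n : continuous (fun y => smoothstep (qev (s (dd n)) y)).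
  by move=> y; exact: has_grad_continuous (hs n y).
have ceta0 := C1c_continuous Ceta.
pose P n y := f y * (eta y * tent (qev (s (dd n)) y)).
pose Q n y := f y * (partial j eta y * smoothstep (qev (s (dd n)) y)) + g j y * (eta y * smoothstep (qev (s (dd n)) y)).
pose F y := K * (`|f y| + `|g j y|).
have Fi : mu.-integrable D (EFin \o F).
  by apply: (integrable2Z mD); apply: (integrable2D mD); exact: integrable_norm.
have ss01 n y : `|smoothstep (qev (s (dd n)) y)| <= 1.
  by rewrite ger0_norm ?smoothstep_ge0 // smoothstep_le1.
have eta1' y : `|eta y| <= 1 by have /andP[? ?] := eta01 y; rewrite ger0_norm.
have Pi n : mu.-integrable D (EFin \o P n).
  apply: (@integrable2_Mbounded _ _ mD _ _ 2 fi).
    by apply: mc => y; apply: cvgM; [exact: ceta0|exact: ct].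
  move=> y _; rewrite normrM -[2]mul1r ler_pM // ger0_norm ?tent_ge0 // tent_le2 //.
have Qi n : mu.-integrable D (EFin \o Q n).
  apply: (integrable2D mD).
    apply: (@integrable2_Mbounded _ _ mD _ _ B1 fi).
      by apply: mc => y; apply: cvgM; [exact: ceta|exact: css].
    by move=> y _; rewrite normrM -[B1]mulr1 ler_pM.
  apply: (@integrable2_Mbounded _ _ mD _ _ 1 gi).
    by apply: mc => y; apply: cvgM; [exact: ceta0|exact: css].
  by move=> y _; rewrite normrM -[1]mulr1 ler_pM.
have PQ n : nj0 / dd n * \int[mu]_(x in D) P n x = \int[mu]_(x in D) Q n x.
  have := key n.
  have -> : (fun x => f x * partial j (psi n) x + g j x * psi n x) =
    (fun x => Q n x - nj0 / dd n * P n x).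
    by apply/funext => x; rewrite dpsi /Q /P /psi; ring.
  rewrite (Rintegral2B mD (Qi n)) ?(Rintegral2Z mD _ (Pi n)); last exact: integrable2Z.
  by move=> /eqP; rewrite subr_eq0 => /eqP.
have small := strip_small al be ga mD Fi.
pose I n := \int[mu]_(x in D) (F x * \1_[set y | 0 < l y < dd n] x).
have out y : ~ `|x0 - y| < r1 -> eta y = 0 /\ partial j eta y = 0.
  move=> ny; split; first exact: (C1c_outside Ceta).
  by apply: (@partial_outside_support _ _ eta j y Ceta) => Sy; apply: ny; exact: Seta.
have QI n : `|\int[mu]_(x in D) Q n x| <= I n.
  apply: (le_normr_Rintegral2 mD (Qi n)).
    apply: (@integrable2_Mbounded _ _ mD _ _ 1 Fi).
      by apply: measurable_indic; apply: open_measurable2; exact: open_slab.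
    by move=> y _; rewrite indicE; case: (_ \in _); rewrite ?normr1 ?normr0.
  move=> y Dy; have [yr|/out[e1 e2]] := pselect (`|x0 - y| < r1); last first.
    rewrite /Q e1 e2 !(mul0r, mulr0) addr0 normr0 indicE mulr_ge0 // /F mulr_ge0 ?addr_ge0 //.
  have ly : 0 < l y by apply/(DE _ (r1r _ yr)).
  have [ld|dl] := ltP (l y) (dd n); last first.
    have sm : smoothstep (qev (s (dd n)) y) = 0.
      by apply: smoothstep_le0; rewrite sE subr_le0 ler_pdivlMr // mul1r.
    by rewrite /Q sm !mulr0 addr0 normr0 indicE mulr_ge0 // /F mulr_ge0 ?addr_ge0.
  rewrite indicE mem_set ?mulr1 /F; last by rewrite /= ly.
  rewrite mulrDr; apply: ler_normD_le; rewrite normrM mulrC; apply: ler_wpM2r => //.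
    rewrite normrM /K -[_ + 1]mulr1; apply: ler_pM => //.
    by rewrite (le_trans (hB1 y)) // lerDl.
  by rewrite normrM /K; apply: le_trans (_ : 1 <= _); rewrite ?mulr_ile1 // lerDr.
have [k k0 [d1 d10 hk]] := strip_measure bg (divr_gt0 r10 (ltr0Sn R 3)) l0.
(* On the strip [eta] is 1, [tent] is at least 1 and [e * f] is at least [c]; elsewhere in [D] the
   integrand is nonnegative. *)
have PI n : dd n < d1 -> c * (k * dd n) <= \int[mu]_(x in D) (e * P n x).
  move=> dd1; pose S := strip al be ga (r1 / 4) x0 (dd n).
  have SD : S `<=` D.
    move=> y [yr /andP[y1 _]]; apply/(DE y); last by apply: lt_trans y1; rewrite divr_gt0.
    by apply: r1r; apply: lt_trans yr _; lra.
  have mS : measurable S by apply: open_measurable2; exact: open_strip.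
  have Sfin : (mu S < +oo)%E by apply: le_lt_trans Dfin; apply: le_measure; rewrite ?inE.
  have hS : k * dd n <= fine (mu S).
    have := hk (dd n); rewrite d0 dd1 => /(_ isT); rewrite -/S -(@fineK _ (mu S)) ?lee_fin //.
    by rewrite ge0_fin_numE.
  apply: (@le_trans _ _ (c * fine (mu S))); first by rewrite ler_pM2l.
  have cS : \int[mu]_(x in S) c = c * fine (mu S) by exact: Rintegral_cst.
  have E1 : \int[mu]_(x in D) (c * \1_S x) = \int[mu]_(x in S) (c * \1_S x).
    by apply: Rintegral_subset => // y _ nS; rewrite indicE memNset // mulr0.
  have E2 : \int[mu]_(x in S) (c * \1_S x) = \int[mu]_(x in S) c.
    by apply: eq_Rintegral => y yS; rewrite indicE yS mulr1.
  rewrite -cS -E2 -E1.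
  have i1 : mu.-integrable D (EFin \o (fun x => c * \1_S x)).
    apply: (@integrable2_bounded _ _ _ c mD Dfin).
      by apply: measurable_funM => //; exact: measurable_indic.
    move=> y _; rewrite indicE; case: (_ \in _); rewrite ?mulr1 ?mulr0 ?normr0; last exact: ltW.
    by rewrite gtr0_norm.
  have i2 : mu.-integrable D (EFin \o (fun x => e * P n x)) by exact: integrable2Z.
  suff : forall y, D y -> c * \1_S y <= e * P n y by move=> h; apply: le_Rintegral.
  move=> y Dy; have [yr|/out[e1 _]] := pselect (`|x0 - y| < r1); last first.
    rewrite /P e1 mul0r !mulr0 indicE memNset ?mulr0 // => -[yr _].
    have := Ceta; move: e1; rewrite eta1; first by move/eqP; rewrite oner_eq0.
    exact: yr.
  have ly : 0 < l y by apply/(DE _ (r1r _ yr)).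
  have ef : c <= e * f y by rewrite (fG y (r1r _ yr) ly) Gc.
  have /andP[et0 _] := eta01 y; have t0 := tent_ge0 (qev (s (dd n)) y).
  have p0 : 0 <= e * P n y.
    have ef0 : 0 <= e * f y by apply: le_trans ef; exact: ltW.
    by rewrite /P mulrA; apply: mulr_ge0 => //; exact: mulr_ge0.
  rewrite indicE; have [yS|nS] := pselect (S y); last by rewrite memNset ?mulr0.
  rewrite mem_set // mulr1 /P mulrA.
  have [yr4 /andP[y1 y2]] := yS.
  rewrite eta1 // mul1r; apply: le_trans ef _; rewrite ler_peMr //.
    by apply: le_trans (ltW c0) _; rewrite (fG y (r1r _ yr) ly) Gc.
  rewrite sE; apply: tent_ge1; have dn := d0 n.
  have u1 : 4^-1 < l y / dd n by rewrite ltr_pdivlMr // mulrC.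
  have u2 : l y / dd n < 3 / 4 by rewrite ltr_pdivrMr // mulrAC.
  by rewrite u1.
have L : 0 < `|nj0| * (c * k) by rewrite mulr_gt0 ?normr_gt0 // mulr_gt0.
have H1 : \forall n \near \oo, I n < `|nj0| * (c * k).
  exact: (@cvgr_lt _ _ _ _ _ _ small _ L).
have H2 : \forall n \near \oo, dd n < d1 by exact: (near_infty_natSinv_lt (PosNum d10)).
have [n [h1 h2]] : exists n, I n < `|nj0| * (c * k) /\ dd n < d1.
  by have [n [u1 u2]] := @filter_ex _ \oo _ _ (filterI H1 H2); exists n.
have h3 := PI n h2; rewrite (Rintegral2Z mD e (Pi n)) in h3.
have h4 : c * (k * dd n) <= `|\int[mu]_(x in D) P n x|.
  by apply: le_trans h3 _; rewrite -[leRHS]mul1r -en -normrM ler_norm.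
have h5 := QI n; rewrite -PQ normrM in h5.
have : `|nj0| * (c * k) <= I n.
  apply: le_trans h5; rewrite normrM normfV (gtr0_norm (d0 n)) -mulrA ler_wpM2l //.
  by rewrite [leRHS]mulrC ler_pdivlMr // -mulrA.
by rewrite leNgt h1.
Qed.
End TraceZero.

(** * The straight mesh and the nodes of its unshared edges *)

Section StraightMesh.
Variables (R : realType) (I : finType) (vtx : I -> 'I_3 -> R * R).
Implicit Types (x y z : R * R) (i j : I) (a b k : 'I_3).
Local Notation v0 i := (vtx i (@Ordinal 3 0 isT)).
Local Notation v1 i := (vtx i (@Ordinal 3 1 isT)).
Local Notation v2 i := (vtx i (@Ordinal 3 2 isT)).

Lemma FtilE i x : Ftil vtx i x = \sum_a lam a x *: vtx i a.
Proof. by []. Qed.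

Definition Ftil_q i := Quad (v2 i).1 ((v0 i).1 - (v2 i).1) ((v1 i).1 - (v2 i).1) 0 0 0.
Definition Ftil_p i := Quad (v2 i).2 ((v0 i).2 - (v2 i).2) ((v1 i).2 - (v2 i).2) 0 0 0.

Lemma Ftil_qmap i : Ftil vtx i = qmap (Ftil_q i) (Ftil_p i).
Proof.
apply/funext => -[x1 x2]; rewrite FtilE sum_I3 /lam /qmap /qev /Ftil_q /Ftil_p /=.
by case: (v0 i) (v1 i) (v2 i) => [? ?] [? ?] [? ?]; congr pair; rewrite /= /GRing.scale /=; ring.
Qed.

Lemma Ftil_rv i a : Ftil vtx i (rv R a) = vtx i a.
Proof.
rewrite FtilE (bigD1 a) //= lam_rv eqxx scale1r big1 ?addr0 // => b ba.
by rewrite lam_rv (negbTE ba) scale0r.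
Qed.

Lemma Ftil_comb i (t : R) x y : Ftil vtx i ((1 - t) *: x + t *: y) =
  (1 - t) *: Ftil vtx i x + t *: Ftil vtx i y.
Proof.
rewrite !FtilE !scaler_sumr -big_split /=; apply: eq_bigr => a _.
by rewrite lamD; case: (vtx i a) => u1 u2; congr pair; rewrite /= /GRing.scale /=; ring.
Qed.

Lemma Ttil_image i : Ttil vtx i = Ftil vtx i @` @That R.
Proof.
apply/seteqP; split=> [_ [l [l0 l1 ->]]|_ [x /ThatP l0 <-]].
  exists (\sum_a l a *: rv R a); first by exists l.
  by rewrite FtilE; apply: eq_bigr => a _; rewrite lam_comb.
by exists (fun a => lam a x); rewrite sum_lam.
Qed.

Hypothesis Ftil_inj : forall i x y, @That R x -> @That R y ->
  Ftil vtx i x = Ftil vtx i y -> x = y.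

Definition area i := ((v0 i).1 - (v2 i).1) * ((v1 i).2 - (v2 i).2) -
  ((v0 i).2 - (v2 i).2) * ((v1 i).1 - (v2 i).1).

Definition Ftil_inv i y : R * R :=
  (((y.1 - (v2 i).1) * ((v1 i).2 - (v2 i).2) - (y.2 - (v2 i).2) * ((v1 i).1 - (v2 i).1)) / area i,
   (((v0 i).1 - (v2 i).1) * (y.2 - (v2 i).2) - ((v0 i).2 - (v2 i).2) * (y.1 - (v2 i).1)) / area i).

(** A nonzero kernel vector of the affine map would displace the barycentre inside the triangle
    without changing its image. If the determinant were 0, the vectors of cofactors would be in the
    kernel, hence 0, and then every vector would be. *)
Lemma area_neq0 i : area i != 0.
Proof.
apply/eqP => A0.
have key (s t : R) : s * ((v0 i).1 - (v2 i).1) + t * ((v1 i).1 - (v2 i).1) = 0 ->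
    s * ((v0 i).2 - (v2 i).2) + t * ((v1 i).2 - (v2 i).2) = 0 -> s = 0 /\ t = 0.
  move=> h1 h2.
  have /interior_ball[r r0 hr] : (@That R)° (bary R) by rewrite interior_That; exact: bary_Tint.
  pose N := `|(s, t)| + 1; have N0 : 0 < N by rewrite ltr_pwDr.
  pose e := r / N / 2; have e0 : 0 < e by rewrite !divr_gt0.
  have Th : @That R (bary R + e *: (s, t)).
    apply: hr; rewrite opprD addrA subrr add0r normrN normrZ gtr0_norm //.
    have -> : r = e * (2 * N) by rewrite /e; field; rewrite gt_eqF.
    by rewrite ltr_pM2l // /N; have := normr_ge0 (s, t); lra.
  have Tb : @That R (bary R) by apply: Tint_That; exact: bary_Tint.
  have : Ftil vtx i (bary R + e *: (s, t)) = Ftil vtx i (bary R).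
    rewrite Ftil_qmap /qmap /qev /Ftil_q /Ftil_p /=; congr pair; rewrite /= /GRing.scale /=.
      have : e * (s * ((v0 i).1 - (v2 i).1) + t * ((v1 i).1 - (v2 i).1)) = 0 by rewrite h1 mulr0.
      by move: (\sum_(a < 3) rv R a) => w; lra.
    have : e * (s * ((v0 i).2 - (v2 i).2) + t * ((v1 i).2 - (v2 i).2)) = 0 by rewrite h2 mulr0.
    by move: (\sum_(a < 3) rv R a) => w; lra.
  move=> /(Ftil_inj Th Tb)/eqP; rewrite addrC -subr_eq0 addrK => /eqP[].
  rewrite /GRing.scale /= => /eqP; rewrite mulf_eq0 (gt_eqF e0) /= => /eqP -> /eqP.
  by rewrite mulf_eq0 (gt_eqF e0) /= => /eqP ->.
have [p1 p2] := key ((v1 i).2 - (v2 i).2) (- ((v0 i).2 - (v2 i).2)) ltac:(by rewrite -[RHS]A0 /area; ring) ltac:(ring).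
have [p3 p4] := key ((v1 i).1 - (v2 i).1) (- ((v0 i).1 - (v2 i).1)) ltac:(ring) ltac:(by rewrite -[RHS]oppr0 -A0 /area; ring).
have [/eqP] := key 1 0 ltac:(lra) ltac:(lra); by rewrite oner_eq0.
Qed.

Lemma Ftil_invK i y : Ftil vtx i (Ftil_inv i y) = y.
Proof.
have := area_neq0 i; rewrite Ftil_qmap /qmap /qev /Ftil_inv /Ftil_q /Ftil_p /area /= => A0.
by case: y => y1 y2; congr pair; rewrite /=; field.
Qed.

Lemma FtilK i x : Ftil_inv i (Ftil vtx i x) = x.
Proof.
have := area_neq0 i; rewrite Ftil_qmap /qmap /qev /Ftil_inv /Ftil_q /Ftil_p /area /= => A0.
by case: x => x1 x2; congr pair; rewrite /=; field.
Qed.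

(** Barycentric coordinates of a straight triangle as affine functions on the plane; they differ at
    two vertices, so they are not constant and can serve as boundary function in [trace_zero]. *)
Lemma lam_Ftil_inv i k : exists al be ga : R, ((be != 0) || (ga != 0)) /\
  forall y, lam k (Ftil_inv i y) = al + be * y.1 + ga * y.2.
Proof.
have [al [be [ga E]]] : exists al be ga : R, forall y, lam k (Ftil_inv i y) = al + be * y.1 + ga * y.2.
  have A0 := area_neq0 i.
  pose b1 := ((v1 i).2 - (v2 i).2) / area i; pose g1 := - ((v1 i).1 - (v2 i).1) / area i.
  pose b2 := - ((v0 i).2 - (v2 i).2) / area i; pose g2 := ((v0 i).1 - (v2 i).1) / area i.
  pose a1 := - (b1 * (v2 i).1 + g1 * (v2 i).2); pose a2 := - (b2 * (v2 i).1 + g2 * (v2 i).2).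
  elim/I3P: k.
  - by exists a1, b1, g1 => y; rewrite /lam /Ftil_inv /a1 /b1 /g1 /=; field.
  - by exists a2, b2, g2 => y; rewrite /lam /Ftil_inv /a2 /b2 /g2 /=; field.
  - by exists (1 - a1 - a2), (- b1 - b2), (- g1 - g2) => y; rewrite /lam /Ftil_inv /a1 /a2 /b1 /b2 /g1 /g2 /=; field.
exists al, be, ga; split=> //; rewrite -negb_and; apply/negP => /andP[/eqP be0 /eqP ga0].
have [c ck] := other k.
have := E (Ftil vtx i (rv R k)); have := E (Ftil vtx i (rv R c)).
rewrite !FtilK !lam_rv eqxx eq_sym (negbTE ck) be0 ga0 !mul0r !addr0 => <- /eqP.
by rewrite oner_eq0.
Qed.

Lemma continuous_Ftil_inv i : continuous (Ftil_inv i).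
Proof.
have E k := lam_Ftil_inv i k.
have [al [be [ga [_ e1]]]] := E (@Ordinal 3 0 isT); have [al' [be' [ga' [_ e2]]]] := E (@Ordinal 3 1 isT).
have -> : Ftil_inv i = qmap (Quad al be ga 0 0 0) (Quad al' be' ga' 0 0 0).
  apply/funext => y; rewrite [LHS]surjective_pairing /qmap /qev /=; congr pair.
    by have := e1 y; rewrite /lam /= => ->; ring.
  by have := e2 y; rewrite /lam /= => ->; ring.
exact: (@continuous_qmap R unit (fun=> _) (fun=> _) tt).
Qed.

Lemma closed_Ttil i : closed (Ttil vtx i).
Proof.
rewrite Ttil_image (_ : Ftil vtx i = qmap (Ftil_q i) (Ftil_p i)); last exact: Ftil_qmap.
exact: (@closed_T R unit (fun=> Ftil_q i) (fun=> Ftil_p i) tt).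
Qed.

Lemma Ftil_edge i a b (t : R) :
  Ftil vtx i ((1 - t) *: rv R a + t *: rv R b) = (1 - t) *: vtx i a + t *: vtx i b.
Proof. by rewrite Ftil_comb !Ftil_rv. Qed.

Lemma shared_sym i a b : shared vtx i a b -> shared vtx i b a.
Proof. by move=> [j [a' [b' [h1 h2 h3 h4]]]]; exists j, b', a'; rewrite (eq_sym b'). Qed.

Hypothesis conf : conforming vtx.

(** Conformity leaves an empty intersection, a vertex or a common edge. A relative interior point of
    the edge [a b] is no vertex and lies on no other edge, so only a common edge [a b] could contain
    it, and that would make the edge shared. *)
Lemma unshared_outside i j a b (t : R) : a != b -> ~ shared vtx i a b -> 0 < t < 1 ->
  i != j -> ~ Ttil vtx j ((1 - t) *: vtx i a + t *: vtx i b).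
Proof.
move=> ab ns /andP[t0 t1] ij; rewrite -Ftil_edge; set x := _ + _ => Tj.
have t01 : 0 <= t <= 1 by rewrite !ltW.
have Tx : @That R x by apply: That_conv => //; exact: rv_That.
have Ti : Ttil vtx i (Ftil vtx i x) by rewrite Ttil_image; exists x.
have la : lam a x = 1 - t by exact: lam_edge_l.
have lb : lam b x = t by exact: lam_edge_r.
have [h|[c [d [_ h]]]|[c [c' [d [d' [cc dd e1 e2 h]]]]]] := conf ij.
- by have : (Ttil vtx i `&` Ttil vtx j) (Ftil vtx i x) by []; rewrite h.
- have : (Ttil vtx i `&` Ttil vtx j) (Ftil vtx i x) by [].
  rewrite h /= -Ftil_rv => /(Ftil_inj Tx (rv_That R _)) xc.
  move: la lb; rewrite xc !lam_rv; case: eqP => [ac|_]; case: eqP => [bc|_] /= la lb; lra.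
- have : (Ttil vtx i `&` Ttil vtx j) (Ftil vtx i x) by [].
  rewrite h => -[s [s01]]; rewrite -Ftil_edge.
  move=> /(Ftil_inj Tx (That_conv (rv_That R _) (rv_That R _) s01)) xs.
  have sh : shared vtx i c c' by exists j, d, d'.
  have mem e : lam e x != 0 -> e = c \/ e = c'.
    rewrite xs lamD !lam_rv; have [|_] := eqVneq e c; first by left.
    by have [|_] := eqVneq e c'; [right|rewrite !mulr0 addr0 eqxx].
  have ma : lam a x != 0 by rewrite la subr_eq0 gt_eqF.
  have mb : lam b x != 0 by rewrite lb gt_eqF.
  case: (mem a ma) => ac; case: (mem b mb) => bc; apply: ns; rewrite ac bc //.
  + by move: ab; rewrite ac bc eqxx.
  + exact: shared_sym.
  + by move: ab; rewrite ac bc eqxx.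
Qed.

Lemma bounded_Omtil : exists M, forall y, Omtil vtx y -> `|y| <= M.
Proof.
exists (\sum_i (qbound (Ftil_q i) 1 + qbound (Ftil_p i) 1)) => y /interior_subset[i _].
rewrite Ttil_image => -[x Tx <-]; have x1 := That_norm Tx.
have q0 j : 0 <= qbound (Ftil_q j) 1 + qbound (Ftil_p j) 1 by rewrite addr_ge0 ?qbound_ge0.
rewrite (bigD1 i) //= ler_wpDr ?sumr_ge0 // Ftil_qmap prod_normE ge_max /qmap /=.
by apply/andP; split; (apply: le_trans (qev_bound _ x1) _); rewrite ?lerDl ?lerDr qbound_ge0.
Qed.

(** Near a relative interior point of an unshared edge the domain coincides with the half-plane
    [lam k > 0], and [f] is a single quadratic on it, which is the setting of [trace_zero]. *)
Lemma H10_edge f i a b k (s : quad R) (t : R) : in_H10 (Omtil vtx) f ->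
  a != b -> a != k -> b != k -> ~ shared vtx i a b ->
  (forall z, @Khat R k z -> f (Ftil vtx i z) = qev s z) -> 0 < t < 1 ->
  qev s ((1 - t) *: rv R a + t *: rv R b) = 0.
Proof.
move=> fH ab ak bk ns fs t01; have /andP[t0 t1] := t01.
set x := _ + _; pose y0 := Ftil vtx i x.
have la : lam a x = 1 - t by exact: lam_edge_l.
have lb : lam b x = t by exact: lam_edge_r.
have lk : lam k x = 0 by exact: lam_edge_0.
have [al [be [ga [bg E]]]] := lam_Ftil_inv i k.
have [M hM] := bounded_Omtil.
have near_N (P : set (R * R)) z : open P -> P (Ftil_inv i z) ->
    exists2 r, 0 < r & forall y, `|z - y| < r -> P (Ftil_inv i y).
  move=> oP Pz; have oN : open (Ftil_inv i @^-1` P).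
    by apply: open_comp => // y _; exact: continuous_Ftil_inv.
  exact: (open_ballP oN).
(* The other triangles form a closed set that misses the point, so a ball around it meets triangle
   [i] alone. *)
have [r1 r10 h1] : exists2 r, 0 < r & forall j y, j != i -> `|y0 - y| < r -> ~ Ttil vtx j y.
  have cl : closed (\bigcup_(j in [set j | j != i]) Ttil vtx j).
    by apply: closed_bigcup => [|j _]; [exact: finite_finset|exact: closed_Ttil].
  have op : open (~` (\bigcup_(j in [set j | j != i]) Ttil vtx j)) by rewrite openC.
  have [|r r0 hr] := @open_ballP R _ y0 op.
    move=> [j /= ji]; rewrite /y0 /x Ftil_edge; apply: unshared_outside => //.
    by rewrite eq_sym.
  by exists r => // j y ji /hr h Tj; apply: h; exists j.
have oW : open [set z : R * R | lam k z < lam a z /\ lam k z < lam b z].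
  apply: openP => z /= [za zb].
  exists (Num.min ((lam a z - lam k z) / 4) ((lam b z - lam k z) / 4)).
    by rewrite lt_min !divr_gt0 // subr_gt0.
  move=> y; rewrite lt_min => /andP[]; have := lam_sub k z y; have := lam_sub a z y.
  have := lam_sub b z y; rewrite !ler_norml => /andP[? ?] /andP[? ?] /andP[? ?] ? ?.
  by split; lra.
have Nx : Ftil_inv i y0 = x by exact: FtilK.
(* Close to the point [lam k] is the smallest coordinate, so that the part of triangle [i] seen
   there belongs to the subtriangle [k]. *)
have [r2 r20 h2] := @near_N _ y0 oW ltac:(by rewrite Nx /= la lb lk subr_gt0).
have kmin z c : lam k z < lam a z -> lam k z < lam b z -> lam k z <= lam c z.
  move=> h3 h4; have : c = a \/ c = b \/ c = k.
    by move: ab ak bk; clear; elim/I3P: a; elim/I3P: b => //= _; elim/I3P: k => //= _ _; elim/I3P: c; auto.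
  by case=> [->|[->|->]] //; exact: ltW.
pose r := Num.min r1 r2.
have r0 : 0 < r by rewrite lt_min r10.
have : qev s (Ftil_inv i y0) = 0; last by rewrite Nx.
apply: (@trace_zero _ (Omtil vtx) f al be ga r M y0 (fun y => qev s (Ftil_inv i y))) => //.
- exact: open_interior.
- by rewrite -E Nx.
- move=> y; rewrite lt_min => /andP[y1 y2]; rewrite -E; split.
    move=> /interior_ball[d d0 hd].
    rewrite E; apply: (@affine_gt0 R al be ga (Num.min d (r1 - `|y0 - y|))) => //.
      by rewrite lt_min d0 subr_gt0.
    move=> z; rewrite lt_min => /andP[z1 z2]; rewrite -E.
    have [j _ Tj] := hd z z1.
    have ji : j = i.
      apply/eqP/negPn/negP => ji; apply: (h1 j z ji) Tj.
      have -> : y0 - z = (y0 - y) + (y - z) by rewrite addrA subrK.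
      by rewrite (le_lt_trans (ler_normD _ _)) // -ltrBrDl.
    move: Tj; rewrite ji Ttil_image => -[w /ThatP Tw <-].
    by rewrite FtilK.
  move=> ky; have [k1 k2] := h2 y y2.
  have Ty : Tint (Ftil_inv i y) by move=> c; apply: lt_le_trans ky _; exact: kmin.
  have [d d0 hd] := near_N _ y (@open_Tint R) Ty.
  apply/nbhs_ballP; exists d => // z; rewrite -ball_normE /= => /hd Tz.
  exists i => //; rewrite Ttil_image; exists (Ftil_inv i z); first exact: Tint_That.
  exact: Ftil_invK.
- move=> y; rewrite lt_min => /andP[y1 y2]; rewrite -E => ky.
  have [k1 k2] := h2 y y2.
  rewrite -{1}(Ftil_invK i y) fs //; apply/KhatP; split; first exact: ltW.
  by move=> c; exact: kmin.
- by move=> z; apply: continuous_comp; [exact: continuous_Ftil_inv|exact: continuous_qev].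
Qed.

(** [H10_edge] reaches relative interior points only. The restriction of [f] to the edge is
    quadratic, so vanishing at 1/4, 1/2 and 3/4 forces the two end values and the midpoint value to
    be 0. *)
Lemma unshared_zero f i a b : in_H10 (Omtil vtx) f -> a != b -> ~ shared vtx i a b ->
  (forall k, exists s : quad R, forall z, @Khat R k z -> f (Ftil vtx i z) = qev s z) ->
  [/\ f (vtx i a) = 0, f (vtx i b) = 0 & f (2^-1 *: (vtx i a + vtx i b)) = 0].
Proof.
move=> fH ab ns hs; have [k [ak bk]] := third ab; have [s sE] := hs k.
have H t := @H10_edge f i a b k s t fH ab ak bk ns sE.
pose A := qev s (rv R a); pose B := qev s (rv R b); pose m := qev s (emid R a b).
have L (t : R) : qev s ((1 - t) *: rv R a + t *: rv R b) =
    A * ((1 - t) * (2 * (1 - t) - 1)) + B * (t * (2 * t - 1)) + 4 * m * ((1 - t) * t).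
  rewrite (qev_lagrange s _ ab ak bk); set x := (1 - t) *: _ + _.
  have -> : lam a x = 1 - t by exact: lam_edge_l.
  have -> : lam b x = t by exact: lam_edge_r.
  have -> : lam k x = 0 by exact: lam_edge_0.
  by rewrite mul0r addr0.
have q1 := H (1 / 4) ltac:(apply/andP; split; lra); have q2 := H (1 / 2) ltac:(apply/andP; split; lra).
have q3 := H (3 / 4) ltac:(apply/andP; split; lra); rewrite !L in q1 q2 q3.
have [A0 [B0 m0]] : A = 0 /\ B = 0 /\ m = 0 by move: (A) (B) (m) q1 q2 q3 => u v w *; split; [lra|split; lra].
have K x : @That R x -> lam k x = 0 -> f (Ftil vtx i x) = qev s x.
  move=> /ThatP Tx k0; apply: sE; apply/KhatP; split=> [|c]; rewrite k0 //.
split.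
- by rewrite -Ftil_rv K ?lam_rv ?[k == _]eq_sym ?(negbTE ak) //; exact: rv_That.
- by rewrite -Ftil_rv K ?lam_rv ?[k == _]eq_sym ?(negbTE bk) //; exact: rv_That.
have hE : 2^-1 *: (vtx i a + vtx i b) = Ftil vtx i (emid R a b).
  have -> : emid R a b = (1 - 2^-1) *: rv R a + 2^-1 *: rv R b.
    by rewrite /emid scalerDr; congr (_ *: _ + _); lra.
  by rewrite Ftil_edge scalerDr; congr (_ *: _ + _); lra.
rewrite hE K //; first exact: emid_That.
have -> : emid R a b = (1 - 2^-1) *: rv R a + 2^-1 *: rv R b.
  by rewrite /emid scalerDr; congr (_ *: _ + _); lra.
by rewrite lamD !lam_rv ![k == _]eq_sym (negbTE ak) (negbTE bk) !mulr0 addr0.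
Qed.
End StraightMesh.

(** * Divergence on the pieces and the choice of the test function *)

Section PiolaPiece.
Variables (R : realType) (q p : quad R) (c : R) (F' : R * R -> R * R).
Implicit Types (x y : R * R) (k : 'I_3).
Local Notation F := (qmap q p).
Local Notation J := (qjac q p).
Hypothesis c_gt0 : 0 < c.
Hypothesis J_ge : forall x, @That R x -> c <= J x.
Hypothesis F'K : forall x, @That R x -> F' (F x) = x.

Lemma J_neq0 x : @That R x -> J x != 0.
Proof. by move=> Tx; rewrite gt_eqF // (lt_le_trans c_gt0) // J_ge. Qed.

Lemma open_qmap_image (O : set (R * R)) : open O -> O `<=` @Tint R -> open (F @` O).
Proof.
apply: (@qmap_open R unit (fun=> q) (fun=> p) _ tt) => _ x Tx.
by rewrite (lt_le_trans c_gt0) // J_ge.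
Qed.

Lemma has_grad_inverse x : Tint x ->
  has_grad (fun y => (F' y).1) (F x) (qdy p x / J x, - qdy q x / J x) /\
  has_grad (fun y => (F' y).2) (F x) (- qdx p x / J x, qdx q x / J x).
Proof.
move=> Tx; have Jx := J_neq0 (Tint_That Tx).
have [r r0 xr] := open_ballP (@open_Tint R) Tx.
have [rho rho0 onto] := qmap_locally_onto Jx r0.
have [L L0 hL] := @F_coercive R unit (fun=> q) (fun=> p) (fun=> ex_intro2 _ _ c c_gt0 J_ge).
apply: (@qmap_inverse_grad R q p F' (@Tint R) x L rho) => //.
- by move=> z Tz; apply: F'K; exact: Tint_That.
- move=> y /onto[z zx <-]; exists z => //; apply: xr; rewrite distrC //.
- by move=> z Tz; apply: (hL tt); exact: Tint_That.
Qed.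

Lemma continuous_inverse x : Tint x -> {for F x, continuous F'}.
Proof.
move=> Tx; have [h1 h2] := has_grad_inverse Tx.
have E : F' = fun y => ((F' y).1, (F' y).2) by apply/funext => y; rewrite -surjective_pairing.
rewrite E; apply: (@cvg_pair _ _ _ (nbhs (F x)) (nbhs _) (nbhs _) _ _ _ (fun y => (F' y).1) (fun y => (F' y).2)).
  exact: has_grad_continuous h1.
exact: has_grad_continuous h2.
Qed.

Lemma continuous_pdxy s w0 w1 x : @That R x ->
  {for x, continuous (pdx q p s w0 w1)} /\ {for x, continuous (pdy q p s w0 w1)}.
Proof.
move=> Tx; have J2 : J x ^+ 2 != 0 by rewrite expf_neq0 // J_neq0.
have ce (r : quad R) : {for x, continuous (qev r)} by exact: continuous_qev.
have cx (r : quad R) : {for x, continuous (qdx r)} by exact: has_grad_continuous (has_grad_qdx r x).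
have cy (r : quad R) : {for x, continuous (qdy r)} by exact: has_grad_continuous (has_grad_qdy r x).
have cJ : {for x, continuous J} by exact: continuous_qjac.
have cM (f g : R * R -> R) : {for x, continuous f} -> {for x, continuous g} ->
    {for x, continuous (fun z => f z * g z)} by move=> ? ?; exact: cvgM.
have cD (f g : R * R -> R) : {for x, continuous f} -> {for x, continuous g} ->
    {for x, continuous (fun z => f z + g z)} by move=> ? ?; exact: cvgD.
have cB (f g : R * R -> R) : {for x, continuous f} -> {for x, continuous g} ->
    {for x, continuous (fun z => f z - g z)} by move=> ? ?; exact: cvgB.
have cZ (a : R) (f : R * R -> R) : {for x, continuous f} ->
    {for x, continuous (fun z => a * f z)} by move=> ?; apply: cM => //; exact: cvg_cst.
have cZr (a : R) (f : R * R -> R) : {for x, continuous f} ->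
    {for x, continuous (fun z => f z * a)} by move=> ?; apply: cM => //; exact: cvg_cst.
have cV : {for x, continuous (fun z => (J z ^+ 2)^-1)}.
  by apply: cvgV => //; exact: (cM J J cJ cJ).
have cN := cD _ _ (cM _ _ (cx s) (ce w0)) (cM _ _ (cy s) (ce w1)).
split.
- exact: (cM _ _ (cB _ _ (cM _ _ (cD _ _ (cD _ _ (cD _ _ (cZ _ _ (ce w0)) (cZ _ _ (ce w1)))
    (cM _ _ (cx s) (cx w0))) (cM _ _ (cy s) (cx w1))) cJ)
    (cM _ _ cN (cB _ _ (cB _ _ (cD _ _ (cZ _ _ (cy p)) (cZr _ _ (cx q))) (cZ _ _ (cx p))) (cZr _ _ (cy q))))) cV).
- exact: (cM _ _ (cB _ _ (cM _ _ (cD _ _ (cD _ _ (cD _ _ (cZ _ _ (ce w0)) (cZ _ _ (ce w1)))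
    (cM _ _ (cx s) (cy w0))) (cM _ _ (cy s) (cy w1))) cJ)
    (cM _ _ cN (cB _ _ (cB _ _ (cD _ _ (cZ _ _ (cy p)) (cZr _ _ (cx q))) (cZ _ _ (cx p))) (cZr _ _ (cy q))))) cV).
Qed.

(** The field is the Piola expression composed with the inverse map; the chain rule and
    [piola_identity] give its classical divergence, which [weak_divergence_ae] identifies with
    [g]. *)
Lemma piece_divergence Om (u : R * R -> R * R) (g : R * R -> R) (w0 w1 : quad R) (M : R) k :
  open Om -> (forall x, Om x -> `|x| <= M) -> Hdiv_with Om u g ->
  F @` @Kint R k `<=` Om ->
  (forall x, Kint k x -> u (F x) = (pio q p q w0 w1 x, pio q p p w0 w1 x)) ->
  {ae @mu2 R, forall y, (F @` @Kint R k) y ->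
     g y = (qdx w0 (F' y) + qdy w1 (F' y)) / J (F' y)}.
Proof.
move=> oO OM ug DO uE.
set D := F @` @Kint R k.
have oD : open D by apply: open_qmap_image; [exact: open_Kint|exact: Kint_Tint].
pose s (j : 'I_2) := if val j is 0%N then q else p.
pose w j y := pio q p (s j) w0 w1 (F' y).
pose G1 (j : 'I_2) x := if val j is 0%N then qdy p x / J x else - qdy q x / J x.
pose G2 (j : 'I_2) x := if val j is 0%N then - qdx p x / J x else qdx q x / J x.
pose d j y := pdx q p (s j) w0 w1 (F' y) * G1 j (F' y) + pdy q p (s j) w0 w1 (F' y) * G2 j (F' y).
have KT x : Kint k x -> @That R x by move=> /Kint_Tint/Tint_That.
have dE y : D y -> \sum_j d j y = (qdx w0 (F' y) + qdy w1 (F' y)) / J (F' y).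
  move=> [x Kx <-]; rewrite sum_I2 /d /s /G1 /G2 /= (F'K (KT _ Kx)).
  by apply: piola_identity; apply: J_neq0; exact: KT.
have C1 (f : R * R -> R) y : D y -> continuous f -> {for y, continuous (fun y => f (F' y))}.
  move=> [x Kx <-] cf; apply: (@continuous_comp _ _ _ F' f); last exact: cf.
  by apply: continuous_inverse; exact: Kint_Tint Kx.
have C1' (f : R * R -> R) y : D y -> (forall x, @That R x -> {for x, continuous f}) ->
    {for y, continuous (fun y => f (F' y))}.
  move=> [x Kx <-] cf; apply: (@continuous_comp _ _ _ F' f).
    by apply: continuous_inverse; exact: Kint_Tint Kx.
  by rewrite (F'K (KT _ Kx)); apply: cf; exact: KT.
have cdx (r : quad R) : continuous (qdx r) by move=> x; exact: has_grad_continuous (has_grad_qdx r x).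
have cdy (r : quad R) : continuous (qdy r) by move=> x; exact: has_grad_continuous (has_grad_qdy r x).
have cJ x : {for x, continuous J} by exact: continuous_qjac.
have cV (f h : R * R -> R) x : @That R x -> {for x, continuous f} -> {for x, continuous h} -> h x != 0 ->
    {for x, continuous (fun x => f x / h x)}.
  by move=> Tx cf ch h0; apply: cvgM => //; apply: cvgV.
have C0 := jacbound_ge0 w0 w1 (@ler01 R).
have H : {ae @mu2 R, forall y, D y -> g y = \sum_j d j y}.
  (* The divergence is [(qdx w0 + qdy w1) / J]: each term of the numerator is at most
     [jacbound w0 w1 1], and the denominator is at least [c]. *)
  apply: (@weak_divergence_ae R Om D u g w d M ((jacbound w0 w1 1 + jacbound w0 w1 1) / c)) => //.
  - move=> j _ [x Kx <-]; rewrite /w (F'K (KT _ Kx)) /Defs.comp uE // /s.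
    by case: (val j).
  - move=> j _ [x Kx <-].
    have [h1 h2] := has_grad_inverse (Kint_Tint Kx).
    have Jx := J_neq0 (KT _ Kx).
    have := has_grad_pio (s j) w0 w1 Jx; rewrite -{1}(F'K (KT _ Kx)) [F' (F x)]surjective_pairing => h3.
    have := has_grad_is_derive j (has_grad_comp h1 h2 h3).
    have -> : (fun y => pio q p (s j) w0 w1 ((F' y).1, (F' y).2)) = w j.
      by apply/funext => y; rewrite -surjective_pairing.
    move/is_derive_eq; apply; rewrite /d (F'K (KT _ Kx)) /gcomp /G1 /G2.
    by case: (val j) => [|n]; rewrite /= /GRing.scale /=.
  - move=> j y Dy; apply: (C1' (pio q p (s j) w0 w1)) => // x Tx.
    exact: has_grad_continuous (has_grad_pio _ _ _ (J_neq0 Tx)).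
  - move=> j y Dy.
    apply: (C1' (fun x => pdx q p (s j) w0 w1 x * G1 j x + pdy q p (s j) w0 w1 x * G2 j x)) => // x Tx.
    have Jx := J_neq0 Tx; have J2 : J x ^+ 2 != 0 by rewrite expf_neq0.
    have ce (r : quad R) : {for x, continuous (qev r)} by exact: continuous_qev.
    have cx (r : quad R) : {for x, continuous (qdx r)} by exact: cdx.
    have cy (r : quad R) : {for x, continuous (qdy r)} by exact: cdy.
    have cJ2 : {for x, continuous (fun x => J x ^+ 2)} by apply: cvgM; exact: cJ.
    have cG1 : {for x, continuous (G1 j)}.
      rewrite /G1; case: (val j) => [|n]; apply: cV => //; try exact: cy; apply: cvgN; exact: cy.
    have cG2 : {for x, continuous (G2 j)}.
      by rewrite /G2; case: (val j) => [|n]; apply: cV => //; try exact: cx; apply: cvgN; exact: cx.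
    have [cpx cpy] := continuous_pdxy (s j) w0 w1 Tx.
    by apply: cvgD; apply: cvgM.
  - move=> y Dy; rewrite dE //; case: Dy => x Kx <-; rewrite (F'K (KT _ Kx)).
    have Tx := KT _ Kx; have [b1 b2 b3 b4] := jacboundP w0 w1 (That_norm Tx).
    rewrite normrM normfV ler_pM ?invr_ge0 //.
      exact: ler_normD_le.
    by rewrite lef_pV2 ?posrE ?normr_gt0 ?J_neq0 // (le_trans (J_ge Tx)) // ler_norm.
by apply: ae2S H => y h Dy; rewrite h // dE.
Qed.
End PiolaPiece.

(** * Functions given piece by piece on disjoint open sets *)

Section PiecewiseSum.
Variables (R : realType) (N : finType) (D : N -> set (R * R)) (f : N -> R * R -> R) (B : R).
Hypothesis oD : forall n, open (D n).
Hypothesis dD : forall m n y, D m y -> D n y -> m = n.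
Hypothesis cf : forall n y, D n y -> {for y, continuous (f n)}.
Hypothesis B_ge0 : 0 <= B.
Hypothesis fB : forall n y, D n y -> `|f n y| <= B.

(** A finite sum of extensions by 0 rather than a choice of piece: measurability is immediate, and
    the value off all pieces is 0. *)
Definition pwsum (y : R * R) : R := \sum_n (f n \_ (D n)) y.

Lemma pwsum_in n y : D n y -> pwsum y = f n y.
Proof.
move=> Dy; rewrite /pwsum (bigD1 n) //= restrict_in // big1 ?addr0 // => m mn.
by rewrite restrict_out // => Dm; move/eqP: mn; apply; exact: dD Dm Dy.
Qed.

Lemma measurable_pwsum (E : set (R * R)) : measurable E -> measurable_fun E pwsum.
Proof.
move=> mE; apply: (@measurable_funS _ _ _ _ setT) => //.
apply: (@measurable_sum _ _ _ _ _ _ (fun n y => (f n \_ (D n)) y)) => n.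
have mDn := open_measurable2 (@oD n).
apply/(measurable_restrictT (f n) mDn).
by apply: open_continuous_measurable_fun2 => // y Dy; exact: cf Dy.
Qed.

Lemma pwsum_bound y : `|pwsum y| <= B.
Proof.
have [[n Dy]|h] := pselect (exists n, D n y); first by rewrite (pwsum_in Dy) fB.
rewrite /pwsum big1 ?normr0 // => n _; rewrite restrict_out // => Dy.
by apply: h; exists n.
Qed.
Lemma pwsum_out y : (forall n, ~ D n y) -> pwsum y = 0.
Proof. by move=> h; rewrite /pwsum big1 // => n _; rewrite restrict_out. Qed.
End PiecewiseSum.

Section BoundedFunctions.
Variable R : realType.

Lemma in_L2_bounded D (f : R * R -> R) (B : R) : measurable D -> (@mu2 R D < +oo)%E ->
  measurable_fun D f -> (forall x, `|f x| <= B) -> in_L2 D f.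
Proof.
move=> mD Dfin mf fB; split=> //.
have : (@mu2 R).-integrable D (EFin \o (fun x => f x ^+ 2)).
  apply: (@integrable2_bounded _ _ _ (B ^+ 2)) => //; first exact: measurable_funX.
  by move=> x _; rewrite normrX lerXn2r ?nnegrE // (le_trans _ (fB x)).
move=> /integrableP[_]; under eq_integral do rewrite /= ger0_norm ?sqr_ge0 //.
by [].
Qed.

Lemma ae_ge0_integral_eq0 D (h : R * R -> R) : measurable D ->
  (@mu2 R).-integrable D (EFin \o h) -> {ae @mu2 R, forall x, D x -> 0 <= h x} ->
  \int[@mu2 R]_(x in D) h x = 0 -> {ae @mu2 R, forall x, D x -> h x = 0}.
Proof.
move=> mD hi h0 ih.
have mh := integrable2_measurable hi.
have mEh : measurable_fun D (EFin \o h) by exact/measurable_EFinP.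
have mEn : measurable_fun D (fun x => `|(EFin \o h) x|%E) by exact: measurableT_comp.
have E : (\int[@mu2 R]_(x in D) `|(EFin \o h) x|)%E = 0%E.
  have -> : (\int[@mu2 R]_(x in D) `|(EFin \o h) x|)%E = (\int[@mu2 R]_(x in D) (h x)%:E)%E.
    apply: (@ae_eq_integral _ _ R (@mu2 R)) => //.
    by apply: ae2S h0 => x hx Dx /=; rewrite ger0_norm // hx.
  by rewrite -EFin_Rintegral2 // ih.
have /(ae_eq_integral_abs _ mD mEh) := E.
by apply: ae2S => x hx Dx; have [] := hx Dx.
Qed.
End BoundedFunctions.

(** * The mesh maps as quadratic maps *)

Section MeshMaps.
Variables (R : realType) (I : finType) (vtx : I -> 'I_3 -> R * R)
  (Gh : I -> R * R -> R * R) (G : R * R -> R * R).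
Implicit Types (x y : R * R) (i : I) (a b : 'I_3).

Lemma quadratic_Fiso : nodal_interpolant vtx Gh G ->
  exists qp : I -> quad R * quad R, forall i, Fiso vtx Gh i = qmap (qp i).1 (qp i).2.
Proof.
move=> GhP.
suff H i : exists qp : quad R * quad R, Fiso vtx Gh i = qmap qp.1 qp.2.
  by have [qp hqp] := choice H; exists qp.
have [Gpoly _] := GhP i.
have [s0 e0] := poly_le2_quad (Gpoly ord0); have [s1 e1] := poly_le2_quad (Gpoly ord_max).
have Gi x : Gh i x = (qev s0 x, qev s1 x).
  by rewrite -e0 -e1 /Defs.comp /= -surjective_pairing.
have Fi x : Ftil vtx i x = ((Ftil_q vtx i).(q00) + (Ftil_q vtx i).(q10) * x.1 + (Ftil_q vtx i).(q01) * x.2,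
    (Ftil_p vtx i).(q00) + (Ftil_p vtx i).(q10) * x.1 + (Ftil_p vtx i).(q01) * x.2).
  by rewrite Ftil_qmap /qmap /qev /=; congr pair; ring.
have [r0 E0] := qev_affine s0 (Ftil_q vtx i).(q00) (Ftil_q vtx i).(q10) (Ftil_q vtx i).(q01)
  (Ftil_p vtx i).(q00) (Ftil_p vtx i).(q10) (Ftil_p vtx i).(q01).
have [r1 E1] := qev_affine s1 (Ftil_q vtx i).(q00) (Ftil_q vtx i).(q10) (Ftil_q vtx i).(q01)
  (Ftil_p vtx i).(q00) (Ftil_p vtx i).(q10) (Ftil_p vtx i).(q01).
exists (r0, r1); apply/funext => x.
by rewrite /Fiso /= Gi Fi E0 E1.
Qed.

Lemma Jac_qmap (q p : quad R) x : Jac (qmap q p) x =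
  \matrix_(i, j) gcomp j (if val i is 0%N then (qdx q x, qdy q x) else (qdx p x, qdy p x)).
Proof.
apply/matrixP => i j; rewrite !mxE; apply: has_grad_partial.
rewrite /Defs.comp; case: (val i) => [|n]; exact: has_grad_qev.
Qed.

Lemma det_Jac_qmap (q p : quad R) x : \det (Jac (qmap q p) x) = qjac q p x.
Proof.
rewrite (expand_det_row _ ord0) sum_I2 /cofactor !det_mx11 Jac_qmap !mxE /gcomp /=.
by rewrite /qjac expr0 expr1; ring.
Qed.

Lemma piola_qmap (q p w0 w1 : quad R) x (w : R * R) : w = (qev w0 x, qev w1 x) ->
  mxapp (piola (qmap q p) x) w = (pio q p q w0 w1 x, pio q p p w0 w1 x).
Proof.
move=> ->; rewrite /mxapp /piola det_Jac_qmap Jac_qmap !mxE /gcomp /= /pio.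
by congr pair; ring.
Qed.

(** Multiplication by the cofactor matrix undoes the Jacobian up to the factor J. A zero nodal value
    thus passes from the physical to the reference field. *)
Lemma piola_qmap_eq0 (q p : quad R) x (w : R * R) : qjac q p x != 0 ->
  mxapp (piola (qmap q p) x) w = 0 -> w = 0.
Proof.
move=> J0; case: w => w1 w2; rewrite /mxapp /piola det_Jac_qmap Jac_qmap !mxE /gcomp /=.
move=> [] /eqP; rewrite -!mulrA -mulrDr mulf_eq0 invr_eq0 (negbTE J0) /= => /eqP h1.
move=> /eqP; rewrite -mulrDr mulf_eq0 invr_eq0 (negbTE J0) /= => /eqP h2.
have g1 : w1 * qjac q p x = 0.
  have -> : w1 * qjac q p x = qdy p x * (qdx q x * w1 + qdy q x * w2) -
    qdy q x * (qdx p x * w1 + qdy p x * w2) by rewrite /qjac; ring.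
  by rewrite h1 h2 !mulr0 subr0.
have g2 : w2 * qjac q p x = 0.
  have -> : w2 * qjac q p x = qdx q x * (qdx p x * w1 + qdy p x * w2) -
    qdx p x * (qdx q x * w1 + qdy q x * w2) by rewrite /qjac; ring.
  by rewrite h1 h2 !mulr0 subr0.
move/eqP: g1; rewrite mulf_eq0 (negbTE J0) orbF => /eqP ->.
by move/eqP: g2; rewrite mulf_eq0 (negbTE J0) orbF => /eqP ->.
Qed.

Lemma hT_gt0 i : (forall x y, @That R x -> @That R y ->
    Ftil vtx i x = Ftil vtx i y -> x = y) -> 0 < hT vtx i.
Proof.
move=> inj; pose u := vtx i (@Ordinal 3 0 isT); pose w := vtx i (@Ordinal 3 1 isT).
have mem a : Ttil vtx i (vtx i a) by rewrite Ttil_image; exists (rv R a); [exact: rv_That|exact: Ftil_rv].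
have uw : u != w.
  apply/eqP => e; have := inj _ _ (rv_That R (@Ordinal 3 0 isT)) (rv_That R (@Ordinal 3 1 isT)).
  by rewrite !Ftil_rv => /(_ e)[] /eqP; rewrite oner_eq0.
have e0 : 0 < Defs.edist u w.
  rewrite sqrtr_gt0 lt_neqAle addr_ge0 ?sqr_ge0 // andbT eq_sym paddr_eq0 ?sqr_ge0 // !sqrf_eq0.
  apply: contra uw => /andP[]; rewrite !subr_eq0 => /eqP h1 /eqP h2.
  by rewrite [u]surjective_pairing [w]surjective_pairing h1 h2.
(* The diameter is a [sup], which dominates its elements for a bounded set only; hence the bound on
   coordinates that follows. *)
apply: lt_le_trans e0 _; apply: sup_ubound; last by exists u; [exact: mem|exists w; [exact: mem|]].
pose B := qbound (Ftil_q vtx i) 1 + qbound (Ftil_p vtx i) 1.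
have bd x : Ttil vtx i x -> `|x.1| <= B /\ `|x.2| <= B.
  rewrite Ttil_image => -[z Tz <-]; rewrite Ftil_qmap /qmap /=; have z1 := That_norm Tz.
  by split; (apply: le_trans (qev_bound _ z1) _); rewrite ?lerDl ?lerDr qbound_ge0.
exists (Num.sqrt ((2 * B) ^+ 2 + (2 * B) ^+ 2)) => _ [x /bd[x1 x2] [y /bd[y1 y2] <-]].
have key (s t : R) : `|s| <= B -> `|t| <= B -> (s - t) ^+ 2 <= (2 * B) ^+ 2.
  move=> hs ht; rewrite -[leLHS]real_normK ?num_real // lerXn2r ?nnegrE //.
    by rewrite mulr_ge0 // (le_trans _ hs).
  by rewrite (le_trans (ler_normB _ _)) //; lra.
by rewrite /Defs.edist ler_wsqrtr // lerD // key.
Qed.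
End MeshMaps.

(** * The open subtriangles cover the mesh up to a null set *)

Section NullEdges.
Variables (R : realType) (I : finType) (q p : I -> quad R).
Implicit Types (x y : R * R) (i : I) (a b k : 'I_3).
Local Notation F i := (qmap (q i) (p i)).

Lemma qmap_lipschitz i x y : @That R x -> @That R y ->
  `|F i x - F i y| <= 2 * jacbound (q i) (p i) 1 * `|x - y|.
Proof.
move=> Tx Ty; have [b1 b2 b3 b4] := jacboundP (q i) (p i) (That_norm (That_mid Tx Ty)).
have e1 : (F i x - F i y).1 = qev (q i) x - qev (q i) y by [].
have e2 : (F i x - F i y).2 = qev (p i) x - qev (p i) y by [].
have n1 := ler_normp1 (x - y); have n2 := ler_normp2 (x - y).
have f1 : (x - y).1 = x.1 - y.1 by []. have f2 : (x - y).2 = x.2 - y.2 by [].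
rewrite f1 in n1; rewrite f2 in n2.
have -> : 2 * jacbound (q i) (p i) 1 * `|x - y| =
   jacbound (q i) (p i) 1 * `|x - y| + jacbound (q i) (p i) 1 * `|x - y| by ring.
rewrite prod_normE ge_max e1 e2 !qev_sub.
by apply/andP; split; apply: ler_normD_le; rewrite normrM; apply: ler_pM.
Qed.

Lemma null_segment i (P Q : R * R) : @That R P -> @That R Q ->
  {ae @mu2 R, forall y, ~ ((fun t => F i ((1 - t) *: P + t *: Q)) @` `[0, 1]) y}.
Proof.
move=> TP TQ; pose g (t : R) := F i ((1 - t) *: P + t *: Q).
suff : {ae @mu2 R, forall y, ~ (g @` `[0, 1]) y} by [].
have cg : continuous g.
  have cl : continuous (fun t : R => (1 - t) *: P + t *: Q).
    move=> t; apply/cvgrPdist_lt => r r0; apply/nbhs_ballP; exists (r / (`|P - Q| + 1)).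
      by rewrite /= divr_gt0 // ltr_pwDr.
    move=> s; rewrite /ball_ /= ltr_pdivlMr ?ltr_pwDr // => h; apply: le_lt_trans h.
    have -> : (1 - t) *: P + t *: Q - ((1 - s) *: P + s *: Q) = (s - t) *: (P - Q).
      by case: P Q {TP TQ g} => [p1 p2] [q1 q2]; congr pair; rewrite /= /GRing.scale /=; ring.
    by rewrite normrZ distrC ler_wpM2l // lerDl.
  by move=> t; apply: (@continuous_comp _ _ _ (fun t : R => (1 - t) *: P + t *: Q) (F i));
    [exact: cl|exact: continuous_qmap].
apply: ae2_null.
  apply: closed_measurable2; apply: (@compact_closed _ _ _); first exact: norm_hausdorff.
  by apply: continuous_compact; [exact: continuous_subspaceT|exact: segment_compact].
apply: (@null_lipschitz_curve R g (2 * jacbound (q i) (p i) 1 * `|P - Q|)) => // s t s01 t01.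
apply: le_trans (qmap_lipschitz i _ _) _; [exact: That_conv|exact: That_conv|].
rewrite -[leRHS]mulrA; apply: ler_wpM2l; first by rewrite mulr_ge0 // jacbound_ge0.
have -> : (1 - s) *: P + s *: Q - ((1 - t) *: P + t *: Q) = (t - s) *: (P - Q).
  by case: P Q {TP TQ g cg} => [p1 p2] [q1 q2]; congr pair; rewrite /= /GRing.scale /=; ring.
by rewrite normrZ distrC mulrC.
Qed.

(** A point of the triangle in no open subtriangle either has a zero coordinate and is on an edge,
    or has its minimal coordinate attained twice and is on a median. Images of these finitely many
    segments are Lipschitz curves. *)
Lemma ae_Kint : {ae @mu2 R, forall y, (\bigcup_i F i @` @That R) y ->
  exists i k, (F i @` @Kint R k) y}.
Proof.
(* The flag [true] encodes edges. The flag [false] encodes whole medians, from a midpoint to the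
   opposite vertex, which contain the inner edges of the split. *)
pose PQ (e : 'I_3 * 'I_3 * 'I_3 * bool) : (R * R) * (R * R) :=
  if e.2 then (rv R e.1.1.1, rv R e.1.1.2) else (emid R e.1.1.1 e.1.1.2, rv R e.1.2).
have H : {ae @mu2 R, forall y, forall u : I * ('I_3 * 'I_3 * 'I_3 * bool),
    ~ ((fun t => F u.1 ((1 - t) *: (PQ u.2).1 + t *: (PQ u.2).2)) @` `[0, 1]) y}.
  apply: ae2_forall => -[i e]; apply: null_segment; rewrite /PQ /=; case: (e.2) => /=;
    first [exact: rv_That|exact: emid_That].
apply: ae2S H => y H [i _ [x Tx Fx]]; apply: contrapT => nK.
have l0 a : 0 <= lam a x by move/ThatP: Tx.
have [k lk] := lam_min_eq x.
have [h|h] : lam k x = 0 \/ exists a, a != k /\ lam a x = lam k x.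
  apply: contrapT => /not_orP[h1 h2]; apply: nK; exists i, k, x => //; split.
    by rewrite lt_neqAle l0 andbT; apply/eqP => e; apply: h1.
  move=> a ak; rewrite lt_neqAle -lk lam_min_le andbT lk; apply/eqP => e; apply: h2.
  by exists a.
- have [a ak] := other k.
  have [b [ab]] := third ak; rewrite eq_sym => bk.
  apply: (H (i, (a, b, k, true))); exists (lam b x).
    by rewrite /= in_itv /= l0 lam_le1.
  by rewrite /= -(edge_point ab ak bk h).
have [a [ak e]] := h; have [b [ab kb]] := third ak.
apply: (H (i, (a, k, b, false))); exists (lam b x).
  by rewrite /= in_itv /= l0 lam_le1.
rewrite /= -Fx; congr (F i _).
have S := sum_lam x; rewrite (sum_I3_perm _ ak ab kb) e in S.
have -> : 1 - lam b x = 2 * lam k x by lra.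
rewrite -[RHS]sum_lam_rv (sum_I3_perm _ ak ab kb) e /emid.
case: (rv R a) (rv R b) (rv R k) => [u1 u2] [v1 v2] [w1 w2].
by congr pair; rewrite /= /GRing.scale /=; field.
Qed.
End NullEdges.

(** * Decay of the velocity, the pressure test function and the conclusion *)

Section Assembly.
Variables (R : realType) (I : finType) (vtx : I -> 'I_3 -> R * R)
  (Gh : I -> R * R -> R * R) (q p : I -> quad R) (F' : I -> R * R -> R * R) (c : I -> R).
Implicit Types (x y z : R * R) (i : I) (a b k : 'I_3) (j : 'I_2).
Local Notation F i := (qmap (q i) (p i)).
Local Notation U := (\bigcup_i F i @` @That R).
Hypothesis FE : forall i, Fiso vtx Gh i = F i.
Hypothesis F'K : forall i x, @That R x -> F' i (F i x) = x.
Hypothesis c_gt0 : forall i, 0 < c i.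
Hypothesis J_ge : forall i x, @That R x -> c i <= qjac (q i) (p i) x.
Hypothesis F_rv : forall i a, F i (rv R a) = vtx i a.
Hypothesis F_disj : forall i i0, i != i0 -> (F i @` @That R)° `&` (F i0 @` @That R)° = set0.
Hypothesis F_edge : forall i a b (t : R), a != b -> shared vtx i a b -> 0 <= t <= 1 ->
  F i ((1 - t) *: rv R a + t *: rv R b) = (1 - t) *: vtx i a + t *: vtx i b.
Hypothesis Ftil_inj : forall i x y, @That R x -> @That R y ->
  Ftil vtx i x = Ftil vtx i y -> x = y.
Hypothesis conf : conforming vtx.

Lemma TisoE i : Tiso vtx Gh i = F i @` @That R.
Proof. by rewrite /Tiso FE. Qed.

Lemma OmhE : Omh vtx Gh = U°.
Proof. by rewrite /Omh (eq_bigcupr (fun i _ => TisoE i)). Qed.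

Lemma qjac_gt0 i x : @That R x -> 0 < qjac (q i) (p i) x.
Proof. by move=> Tx; exact: lt_le_trans (c_gt0 i) (J_ge i Tx). Qed.

Lemma qmap_injective i x y : @That R x -> @That R y -> F i x = F i y -> x = y.
Proof. by move=> Tx Ty e; rewrite -(F'K i Tx) e F'K. Qed.

Lemma Khat_That k x : @Khat R k x -> @That R x.
Proof. by move=> /KhatP[k0 kl]; apply/ThatP => a; exact: le_trans (kl a). Qed.

Lemma Vtri_quad v i j k : Vtri (vtx i) v ->
  exists s : quad R, forall z, @Khat R k z -> Defs.comp j v (Ftil vtx i z) = qev s z.
Proof.
move=> [wh [_ whP] hv]; have [f fpoly fE] := whP k j; have [s sE] := poly_le2_quad fpoly.
exists s => z Kz; rewrite -sE -fE // /Defs.comp hv //; exact: Khat_That Kz.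
Qed.

(** The second clause retains from the nodal correspondence that zeros of [v] at nodes are zeros of
    the reference quadratics, which is what the comparison with [majorant] uses. *)
Definition velocity_pieces (v u : R * R -> R * R) i (w : 'I_3 * 'I_2 -> quad R) : Prop :=
  (forall k x, Kint k x -> u (F i x) =
     (pio (q i) (p i) (q i) (w (k, ord0)) (w (k, ord_max)) x,
      pio (q i) (p i) (p i) (w (k, ord0)) (w (k, ord_max)) x)) /\
  (forall k j z, @Nhat R z -> @Khat R k z -> v (Ftil vtx i z) = 0 -> qev (w (k, j)) z = 0).

Lemma velocity_piecesP v u i : is_Psi vtx Gh v u -> exists w, velocity_pieces v u i w.
Proof.
move=> [_ /(_ i)[w [wh [_ whP] whE] [wn uw]]].
have H (kj : 'I_3 * 'I_2) : exists s : quad R,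
    forall x, @Khat R kj.1 x -> Defs.comp kj.2 wh x = qev s x.
  have [f fpoly fE] := whP kj.1 kj.2; have [s sE] := poly_le2_quad fpoly.
  by exists s => x Kx; rewrite -sE fE.
have [s sE] := choice H.
have whs k x : @Khat R k x -> wh x = (qev (s (k, ord0)) x, qev (s (k, ord_max)) x).
  move=> Kx; rewrite -(sE (k, ord0) x Kx) -(sE (k, ord_max) x Kx).
  by rewrite /Defs.comp /= -surjective_pairing.
exists s; split=> [k x Kx|k j z Nz Kz v0].
  have Tx : @That R x by exact/Tint_That/Kint_Tint/Kx.
  rewrite uw; last by rewrite TisoE; apply: Tint_interior; [exact: qjac_gt0|exact: Kint_Tint Kx].
  by rewrite -FE whE // FE; apply: piola_qmap; apply: whs; exact: Kint_Khat.
have Tz := Khat_That Kz.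
have : wh z = 0.
  apply: (@piola_qmap_eq0 R (q i) (p i) z); first by rewrite gt_eqF // qjac_gt0.
  by rewrite -FE -whE // -v0 wn.
rewrite (whs k) // => -[e0 e1].
have [->|->] : j = ord0 \/ j = ord_max; last 2 first.
- exact: e0.
- exact: e1.
by case: j => [[|[|//]] hj]; [left|right]; exact: val_inj.
Qed.

(** Plays the role of [al]: a function of the position alone, hence the same for all triangles
    containing a node. *)
Definition nodal_support (v : R * R -> R * R) y : R := (v y != 0)%:R.

Lemma nodal_support_unshared v i a b : Vtil vtx v -> a != b -> ~ shared vtx i a b ->
  [/\ nodal_support v (vtx i a) = 0, nodal_support v (vtx i b) = 0 &
      nodal_support v (2^-1 *: (vtx i a + vtx i b)) = 0].
Proof.
move=> [vH vT] ab ns.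
have H j := unshared_zero Ftil_inj conf (vH j) ab ns (fun k => Vtri_quad j k (vT i)).
have [a0 b0 m0] := H ord0; have [a1 b1 m1] := H ord_max.
have Z y : Defs.comp ord0 v y = 0 -> Defs.comp ord_max v y = 0 -> nodal_support v y = 0.
  rewrite /Defs.comp /= => e0 e1; rewrite /nodal_support.
  by rewrite [v y]surjective_pairing e0 e1 eqxx.
by split; apply: Z.
Qed.

Lemma Nhat_emid a b : @Nhat R (emid R a b).
Proof. by exists (rv R a), (rv R b); split=> //; right; [exists a|exists b]. Qed.

Lemma Nhat_rv a : @Nhat R (rv R a).
Proof.
exists (rv R a), (rv R a); split; [by right; exists a|by right; exists a|].
by case: (rv R a) => x1 x2; congr pair; rewrite /= /GRing.scale /=; field.
Qed.

Lemma Khat_edge a b k (t : R) : a != k -> b != k -> 0 <= t <= 1 ->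
  @Khat R k ((1 - t) *: rv R a + t *: rv R b).
Proof.
move=> ak bk t01; set x := _ + _.
have Tx : @That R x by apply: That_conv => //; exact: rv_That.
have lk : lam k x = 0 by exact: lam_edge_0.
by apply/KhatP; rewrite lk; split=> // e; move/ThatP: Tx.
Qed.

Lemma emid_edge a b : emid R a b = (1 - 2^-1) *: rv R a + 2^-1 *: rv R b.
Proof. by rewrite /emid scalerDr; congr (_ *: _ + _); lra. Qed.

(** On a subtriangle the reference quadratics are at most a multiple of [majorant], itself at most a
    multiple of the distance to any [z] outside; the Piola matrix contributes at most
    [jacbound / c]. Summation over triangles and subtriangles gives one constant. *)
Lemma velocity_bound v u w : Vtil vtx v -> (forall i, velocity_pieces v u i (w i)) ->
  exists C, forall i k x z, Kint k x -> ~ U° z ->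
    forall j, `|Defs.comp j u (F i x)| <= C * `|F i x - z|.
Proof.
move=> vV wP; pose al := nodal_support v.
have al01 y : 0 <= al y <= 1 by rewrite /al /nodal_support; case: eqP => _ /=; rewrite lexx ler01.
have al0 i a b : a != b -> ~ shared vtx i a b ->
    [/\ al (vtx i a) = 0, al (vtx i b) = 0 & al (2^-1 *: (vtx i a + vtx i b)) = 0].
  exact: nodal_support_unshared.
have [Cd Cd0 hCd] := majorant_le_dist qjac_gt0 qmap_injective F_rv F_disj F_edge al01 al0
  (fun i => ex_intro2 _ _ (c i) (c_gt0 i) (J_ge i)).
have B (n : I * ('I_3 * 'I_2)) : exists C, 0 <= C /\ forall x, @Khat R n.2.1 x ->
    `|qev (w n.1 n.2) x| <= C * majorant vtx al n.1 x.
  case: n => i [k j] /=.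
  have [a [b [ab ak bk]]] : exists a b, [/\ a != b, a != k & b != k].
    have [a ak] := other k.
    by have [b [ab kb]] := third ak; exists a, b; split; rewrite // eq_sym.
  set s := w i (k, j).
  pose M := `|qev s (rv R a)| + `|qev s (rv R b)| + `|qev s (emid R a b)|.
  have M0 : 0 <= M by rewrite !addr_ge0.
  (* Where [v] vanishes both sides are 0; at the other nodes [al] is 1 and [M] bounds the value. *)
  have K z : @Nhat R z -> @Khat R k z -> `|qev s z| <= M -> `|qev s z| <= M * al (Ftil vtx i z).
    move=> Nz Kz zM; rewrite /al /nodal_support; have [v0|v0] := eqVneq (v (Ftil vtx i z)) 0.
      by have [_ h] := wP i; rewrite (h k j z) // normr0 mulr0.
    by rewrite mulr1.
  have Ka : @Khat R k (rv R a).
    by have := @Khat_edge a b k 0 ak bk; rewrite subr0 scale1r scale0r addr0; apply; rewrite lexx ler01.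
  have Kb : @Khat R k (rv R b).
    by have := @Khat_edge b a k 0 bk ak; rewrite subr0 scale1r scale0r addr0; apply; rewrite lexx ler01.
  have Km : @Khat R k (emid R a b).
    by rewrite emid_edge; apply: Khat_edge => //; apply/andP; split; lra.
  have fm : Ftil vtx i (emid R a b) = 2^-1 *: (vtx i a + vtx i b).
    by rewrite emid_edge Ftil_edge scalerDr; congr (_ *: _ + _); lra.
  have [C C0 hC] := @qev_le_majorant R I vtx al al01 i a b k s M ab ak bk M0
    ltac:(by rewrite -Ftil_rv; apply: K => //; [exact: Nhat_rv|rewrite /M -addrA lerDl addr_ge0])
    ltac:(by rewrite -Ftil_rv; apply: K => //; [exact: Nhat_rv|rewrite /M addrAC lerDr addr_ge0])
    ltac:(by rewrite -fm; apply: K => //; [exact: Nhat_emid|rewrite /M lerDr addr_ge0]).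
  by exists C.
have [Cw hCw] := choice B.
pose A i := jacbound (q i) (p i) 1 / c i.
have A0 i : 0 <= A i by rewrite /A divr_ge0 ?jacbound_ge0 // ltW.
pose E i k := A i * (Cw (i, (k, ord0)) + Cw (i, (k, ord_max))) * Cd.
have Cw0 n : 0 <= Cw n by case: (hCw n).
have E0 i k : 0 <= E i k by apply: mulr_ge0 => //; apply: mulr_ge0 => //; exact: addr_ge0.
exists (\sum_i \sum_k E i k) => i k x z Kx nUz j.
have Kh := Kint_Khat Kx; have Tx := Khat_That Kh.
have Eik : E i k <= \sum_i \sum_k E i k.
  rewrite (bigD1 i) //= ler_wpDr //; first by rewrite sumr_ge0 // => l _; rewrite sumr_ge0.
  by rewrite (bigD1 k) //= lerDl sumr_ge0.
apply: (@le_trans _ _ (E i k * `|F i x - z|)); last by rewrite ler_wpM2r.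
have W := hCd i x z (Kint_Tint Kx) nUz.
have [b1 b2 b3 b4] := jacboundP (q i) (p i) (That_norm Tx).
have h0 := (hCw (i, (k, ord0))).2 x Kh; have h1 := (hCw (i, (k, ord_max))).2 x Kh; rewrite /= in h0 h1.
have P (g1 g2 : R) : `|g1| <= jacbound (q i) (p i) 1 -> `|g2| <= jacbound (q i) (p i) 1 ->
    `|(g1 * qev (w i (k, ord0)) x + g2 * qev (w i (k, ord_max)) x) / qjac (q i) (p i) x| <=
    E i k * `|F i x - z|.
  move=> g1A g2A; rewrite normrM normfV [X in _ / X]gtr0_norm ?qjac_gt0 //.
  have -> : E i k * `|F i x - z| = (jacbound (q i) (p i) 1 * (Cw (i, (k, ord0)) * (Cd * `|F i x - z|)) +
     jacbound (q i) (p i) 1 * (Cw (i, (k, ord_max)) * (Cd * `|F i x - z|))) / c i.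
    by rewrite /E /A; field; rewrite gt_eqF.
  apply: ler_pM => //; first by rewrite invr_ge0 ltW // qjac_gt0.
    apply: ler_normD_le; rewrite normrM; apply: ler_pM => //.
      by apply: le_trans h0 _; rewrite ler_wpM2l.
    by apply: le_trans h1 _; rewrite ler_wpM2l.
  by rewrite lef_pV2 ?posrE ?qjac_gt0 // J_ge.
have [wE _] := wP i; rewrite /Defs.comp (wE k) // /pio; case: (val j) => [|n]; exact: P.
Qed.

Lemma Ftil_disj i (i0 : I) x : Tint x -> Ttil vtx i0 (Ftil vtx i x) -> i = i0.
Proof.
move=> Tx Ti0; apply/eqP/negPn/negP => ne.
have Ti : Ttil vtx i (Ftil vtx i x) by rewrite Ttil_image; exists x => //; exact: Tint_That.
have edge a b (s : R) : 0 <= s <= 1 -> Ftil vtx i x = (1 - s) *: vtx i a + s *: vtx i b -> False.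
  move=> s01; rewrite -Ftil_edge => /(Ftil_inj (Tint_That Tx) (That_conv (rv_That R _) (rv_That R _) s01)) xs.
  have [k [ak bk]] : exists k, a != k /\ b != k.
    have [ab|ab] := eqVneq a b; last exact: third.
    by have [k ka] := other a; exists k; rewrite -ab eq_sym.
  have := Tx k; rewrite xs lamD !lam_rv ![k == _]eq_sym (negbTE ak) (negbTE bk) !mulr0 addr0.
  by rewrite ltxx.
have : (Ttil vtx i `&` Ttil vtx i0) (Ftil vtx i x) by [].
have [->|[a [b [_ ->]]]|[a [a' [b [b' [_ _ _ _ ->]]]]]] := conf ne => //.
- move=> /= e; apply: (edge a a 0); first by rewrite lexx ler01.
  by rewrite e subr0 scale1r scale0r addr0.
- by move=> [s [s01 e]]; exact: edge s01 e.
Qed.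

Lemma F_disj_int i (i0 : I) x y : Tint x -> @That R y -> F i x = F i0 y -> i0 = i /\ x = y.
Proof.
move=> Tx Ty e.
have ii : i0 = i.
  apply: (interior_T_disj qjac_gt0 F_disj Ty); rewrite -e.
  exact: (Tint_interior qjac_gt0).
by split=> //; subst i0; apply: (qmap_injective (Tint_That Tx) Ty e).
Qed.

Lemma open_piece i k : open (F i @` @Kint R k).
Proof.
by apply: qmap_open; [exact: qjac_gt0|exact: open_Kint|exact: Kint_Tint].
Qed.

Lemma open_straight_piece i k : open (Ftil vtx i @` @Kint R k).
Proof.
have -> : Ftil vtx i @` @Kint R k = Ftil_inv vtx i @^-1` @Kint R k.
  apply/seteqP; split=> [_ [x Kx <-]|y Ky]; first by rewrite /= FtilK.
  by exists (Ftil_inv vtx i y) => //; exact: Ftil_invK.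
apply: open_comp; last exact: open_Kint.
by move=> y _; exact: (continuous_Ftil_inv Ftil_inj).
Qed.

Lemma bounded_U : exists M, forall y, U y -> `|y| <= M.
Proof.
exists (\sum_i (qbound (q i) 1 + qbound (p i) 1)) => y [i _ [x Tx <-]].
have x1 := That_norm Tx.
have q0 l : 0 <= qbound (q l) 1 + qbound (p l) 1 by rewrite addr_ge0 ?qbound_ge0.
rewrite (bigD1 i) //= ler_wpDr ?sumr_ge0 // prod_normE ge_max /qmap /=.
by apply/andP; split; (apply: le_trans (qev_bound _ x1) _); rewrite ?lerDl ?lerDr qbound_ge0.
Qed.

(** One piecewise affine function [H i] per reference triangle is carried to the curved mesh as [P]
    and to the straight mesh as [S]. The constant [e] is the mean of [S] over the straight domain,
    so that [S - e] has zero mean and [P - e] is its image under Upsilon. *)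
Lemma test_function (al be ga : I * 'I_3 -> R) :
  let d n x := al n + be n * x.1 + ga n * x.2 in
  exists P : R * R -> R, exists e B : R,
  [/\ forall D, measurable D -> measurable_fun D P, forall y, `|P y| <= B,
      forall n y, (F n.1 @` @Kint R n.2) y -> P y = d n (F' n.1 y) &
      Qh vtx Gh (fun y => P y - e)].
Proof.
move=> d; pose B := \sum_n (`|al n| + `|be n| + `|ga n|).
have B0 : 0 <= B by rewrite sumr_ge0 // => n _; rewrite !addr_ge0.
have dB n x : @That R x -> `|d n x| <= B.
  move=> Tx; have := That_norm Tx; rewrite prod_normE ge_max => /andP[x1 x2].
  apply: (@le_trans _ _ (`|al n| + `|be n| + `|ga n|)).
    repeat apply: ler_normD_le; rewrite ?lexx // normrM ler_piMr //.
  by rewrite /B (bigD1 n) //= lerDl sumr_ge0 // => m _; rewrite !addr_ge0.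
have cd n : continuous (d n).
  have -> : d n = qev (Quad (al n) (be n) (ga n) 0 0 0).
    by apply/funext => y; rewrite /qev /d /=; ring.
  exact: continuous_qev.
have KT k x : @Kint R k x -> @That R x by move=> /Kint_Tint/Tint_That.
pose DF n := F n.1 @` @Kint R n.2; pose DS n := Ftil vtx n.1 @` @Kint R n.2.
pose fF n y := d n (F' n.1 y); pose fS n y := d n (Ftil_inv vtx n.1 y).
have dF (m n : I * 'I_3) y : DF m y -> DF n y -> m = n.
  move=> [x Kx <-] [x' Kx' e].
  have [ii xx] := F_disj_int (Kint_Tint Kx) (KT _ _ Kx') (esym e).
  subst x'; case: m n ii Kx Kx' {e} => [i k] [i' k'] /= -> Kx Kx'.
  by rewrite (Kint_disj Kx Kx').
have dS (m n : I * 'I_3) y : DS m y -> DS n y -> m = n.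
  move=> [x Kx <-] [x' Kx' e].
  have ii : m.1 = n.1.
    apply: (@Ftil_disj _ _ x); first exact: Kint_Tint Kx.
    by rewrite -e Ttil_image; exists x' => //; exact: KT Kx'.
  have xx : x = x'.
    by apply: (@Ftil_inj m.1); [exact: KT Kx|exact: KT Kx'|rewrite -e ii].
  subst x'; case: m n ii Kx Kx' {e} => [i k] [i' k'] /= -> Kx Kx'.
  by rewrite (Kint_disj Kx Kx').
have cF n y : DF n y -> {for y, continuous (fF n)}.
  move=> [x Kx <-]; apply: (@continuous_comp _ _ _ (F' n.1) (d n)); last exact: cd.
  apply: (@continuous_inverse R (q n.1) (p n.1) (c n.1)) => //; [exact: J_ge|exact: F'K|exact: Kint_Tint Kx].
have cS n y : DS n y -> {for y, continuous (fS n)}.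
  move=> _; apply: (@continuous_comp _ _ _ (Ftil_inv vtx n.1) (d n)); last exact: cd.
  exact: (continuous_Ftil_inv Ftil_inj).
have bF n y : DF n y -> `|fF n y| <= B.
  by move=> [x Kx <-]; rewrite /fF F'K ?dB //; exact: KT Kx.
have bS n y : DS n y -> `|fS n y| <= B.
  by move=> [x Kx <-]; rewrite /fS (FtilK Ftil_inj) dB //; exact: KT Kx.
pose P := pwsum DF fF; pose S := pwsum DS fS.
(* Off the open subtriangles [P], [S] and [H i] all take the value 0. They therefore correspond on
   the whole open triangle, as [is_Upsilon] and [Qtri] demand, and not just almost everywhere. *)
pose H i := pwsum (@Kint R) (fun k => d (i, k)).
have oF n : open (DF n) by exact: open_piece.
have oS n : open (DS n) by exact: open_straight_piece.
have mP D : measurable D -> measurable_fun D P by exact: measurable_pwsum.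
have mS D : measurable D -> measurable_fun D S by exact: measurable_pwsum.
have mH i D : measurable D -> measurable_fun D (H i).
  by apply: measurable_pwsum; [exact: open_Kint|move=> k x _; exact: cd].
have PB y : `|P y| <= B by exact: pwsum_bound.
have SB y : `|S y| <= B by exact: pwsum_bound.
have HB i y : `|H i y| <= B.
  apply: pwsum_bound => //; first by move=> k l x; exact: Kint_disj.
  by move=> k x Kx; apply: dB; exact: KT Kx.
have HE i k x : Kint k x -> H i x = d (i, k) x.
  by move=> Kx; rewrite /H (@pwsum_in R _ _ _ _ k) // => m n y; exact: Kint_disj.
have PH i x : Tint x -> P (F i x) = H i x.
  move=> Tx; have [[k Kx]|nK] := pselect (exists k, Kint k x).
    rewrite (HE i k) // /P (@pwsum_in R _ _ _ dF (i, k)); last by exists x.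
    by rewrite /fF F'K //; exact: Tint_That.
  rewrite /H /P !pwsum_out // => [k Kx|[l k] [y Ky /= e]]; first by apply: nK; exists k.
  have [_ xy] := F_disj_int Tx (KT _ _ Ky) (esym e).
  by apply: nK; exists k; rewrite xy.
have SH i x : Tint x -> S (Ftil vtx i x) = H i x.
  move=> Tx; have [[k Kx]|nK] := pselect (exists k, Kint k x).
    rewrite (HE i k) // /S (@pwsum_in R _ _ _ dS (i, k)); last by exists x.
    by rewrite /fS (FtilK Ftil_inj).
  rewrite /H /S !pwsum_out // => [k Kx|[l k] [y Ky /= e]]; first by apply: nK; exists k.
  have il : i = l by apply: (Ftil_disj Tx); rewrite -e Ttil_image; exists y => //; exact: KT Ky.
  subst l; apply: nK; exists k; rewrite -(Ftil_inj (KT _ _ Ky) (Tint_That Tx) e) //.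
have [M OM] := bounded_Omtil vtx.
have mO : measurable (Omtil vtx) by apply: open_measurable2; exact: open_interior.
have Ofin := mu2_bounded_lty mO OM.
pose m := fine (@mu2 R (Omtil vtx)).
pose e := (\int[@mu2 R]_(x in Omtil vtx) S x) / m.
have eB f : (forall y, `|f y| <= B) -> forall y : R * R, `|f y - e| <= B + `|e|.
  by move=> fB y; apply: le_trans (ler_normB _ _) _; rewrite lerD2r.
exists P, e, B; split=> //.
  by move=> n y Dy; rewrite /P (@pwsum_in R _ _ _ dF n).
exists (fun y => S y - e); last first.
  split; first by apply: measurable_funB => //; apply: mP; rewrite OmhE; apply: open_measurable2; exact: open_interior.
  by move=> i x; rewrite interior_That => Tx; rewrite FE PH // SH.
split.
- apply: (@in_L2_bounded R _ _ (B + `|e|) mO Ofin); last exact: eB.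
  by apply: measurable_funB => //; exact: mS.
- have Si : (@mu2 R).-integrable (Omtil vtx) (EFin \o S).
    by apply: (integrable2_bounded mO Ofin) => //; exact: mS.
  have ki (r : R) : (@mu2 R).-integrable (Omtil vtx) (EFin \o (fun=> r)).
    by apply: (@integrable2_bounded _ _ _ `|r| mO Ofin).
  apply: (etrans (Rintegral2B mO Si (ki e))).
  have cst (r : R) : \int[@mu2 R]_(x in Omtil vtx) r = r * m by exact: Rintegral_cst.
  (* For [m = 0] the quotient cannot be cancelled; there [e * m] is 0 and the integral of [S] is at
     most [B * m = 0] in absolute value. *)
  rewrite cst /e; have [m0|m0] := eqVneq m 0; last by field.
  rewrite m0 mulr0 subr0; apply/eqP; rewrite -normr_le0.
  apply: le_trans (le_normr_Rintegral2 mO Si (ki B) (fun x _ => SB x)) _.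
  by rewrite cst m0 mulr0.
- move=> i; exists (fun y => H i y - e); last first.
    by move=> x; rewrite interior_That => Tx; rewrite -SH.
  split.
    have mT : measurable (@That R)° by apply: open_measurable2; exact: open_interior.
    have Tfin : (@mu2 R (@That R)° < +oo)%E.
      by apply: (mu2_bounded_lty mT) => x /interior_subset; exact: That_norm.
    apply: (@in_L2_bounded R _ _ (B + `|e|) mT Tfin); last exact: eB.
    by apply: measurable_funB => //; exact: mH.
  move=> k; exists (fun x => (al (i, k) - e) + be (i, k) * x.1 + ga (i, k) * x.2).
    exact: poly_le1_affine.
  by move=> x /interior_Khat Kx; rewrite (HE i k) // /d; ring.
Qed.

Lemma divergence_free v u g : Vtil vtx v -> is_Psi vtx Gh v u ->
  Hdiv_with (Omh vtx Gh) u g ->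
  (forall r, Qh vtx Gh r -> \int[@mu2 R]_(x in Omh vtx Gh) (g x * r x) = 0) ->
  {ae @mu2 R, forall x, Omh vtx Gh x -> g x = 0}.
Proof.
move=> vV uP ug orth.
have [w wP] := choice (fun i => velocity_piecesP i uP).
have [M UM] := bounded_U.
have oO : open (Omh vtx Gh) by exact: open_interior.
have OU y : Omh vtx Gh y -> U y by rewrite OmhE => /interior_subset.
have OM y : Omh vtx Gh y -> `|y| <= M by move=> /OU; exact: UM.
have mO := open_measurable2 oO; have Ofin := mu2_bounded_lty mO OM.
have DO i k : F i @` @Kint R k `<=` Omh vtx Gh.
  rewrite OmhE -open_subsetE; last exact: open_piece.
  by move=> _ [x Kx <-]; exists i => //; exists x => //; exact/Tint_That/Kint_Tint/Kx.
pose al (n : I * 'I_3) := q10 (w n.1 (n.2, ord0)) + q01 (w n.1 (n.2, ord_max)).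
pose be (n : I * 'I_3) := 2 * q20 (w n.1 (n.2, ord0)) + q11 (w n.1 (n.2, ord_max)).
pose ga (n : I * 'I_3) := q11 (w n.1 (n.2, ord0)) + 2 * q02 (w n.1 (n.2, ord_max)).
pose d n x := al n + be n * x.1 + ga n * x.2.
have dE n x : qdx (w n.1 (n.2, ord0)) x + qdy (w n.1 (n.2, ord_max)) x = d n x.
  by rewrite /d /al /be /ga /qdx /qdy; ring.
have H1 : {ae @mu2 R, forall y, forall n : I * 'I_3, (F n.1 @` @Kint R n.2) y ->
    g y = d n (F' n.1 y) / qjac (q n.1) (p n.1) (F' n.1 y)}.
  apply: ae2_forall => n; have [wn _] := wP n.1.
  have := @piece_divergence R (q n.1) (p n.1) (c n.1) (F' n.1) (c_gt0 n.1) (@J_ge n.1)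
    (@F'K n.1) (Omh vtx Gh) u g (w n.1 (n.2, ord0)) (w n.1 (n.2, ord_max)) M n.2 oO OM ug
    (DO n.1 n.2) (wn n.2).
  by apply: ae2S => y h Dy; rewrite -dE; exact: h.
have H2 := @ae_Kint R I q p.
have [C hC] := velocity_bound vV wP.
have g0 : \int[@mu2 R]_(x in Omh vtx Gh) g x = 0.
  apply: (@integral_Hdiv_eq0 R _ u g M C oO OM ug).
  apply: ae2S H2 => y h Oy j z nOz.
  have [i [k [x Kx xy]]] := h (OU y Oy).
  by rewrite -xy; apply: (hC i k x z Kx); rewrite -OmhE.
have [P [e [B [mP PB PE QP]]]] := test_function al be ga.
have [_ gL2 _] := ug.
have gi := in_L2_integrable mO Ofin gL2.
have gPi : (@mu2 R).-integrable (Omh vtx Gh) (EFin \o (fun x => g x * P x)).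
  by apply: (integrable2_Mbounded mO gi (mP _ mO)) => x _; exact: PB.
have gP0 : \int[@mu2 R]_(x in Omh vtx Gh) (g x * P x) = 0.
  have := orth _ QP.
  have -> : (fun x => g x * (P x - e)) = (fun x => g x * P x - e * g x).
    by apply/funext => x; ring.
  rewrite (Rintegral2B mO gPi (integrable2Z mO e gi)).
  by rewrite (Rintegral2Z mO e gi) g0 mulr0 subr0.
have H3 := ae2I H1 H2.
have gPE y : (forall n : I * 'I_3, (F n.1 @` @Kint R n.2) y ->
    g y = d n (F' n.1 y) / qjac (q n.1) (p n.1) (F' n.1 y)) /\
    (U y -> exists i k, (F i @` @Kint R k) y) -> Omh vtx Gh y ->
    exists s J : R, [/\ 0 < J, g y = s / J & P y = s].
  move=> [h1 h2] Oy; have [i [k Ky]] := h2 (OU y Oy).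
  exists (d (i, k) (F' i y)), (qjac (q i) (p i) (F' i y)); split.
  - have [x Kx <-] := Ky; have Tx : @That R x by exact/Tint_That/Kint_Tint/Kx.
    by rewrite F'K // qjac_gt0.
  - exact: (h1 (i, k)).
  - exact: (PE (i, k)).
have H4 : {ae @mu2 R, forall y, Omh vtx Gh y -> g y * P y = 0}.
  apply: ae_ge0_integral_eq0 => //.
  apply: ae2S H3 => y h Oy; have [s [J [J0 -> ->]]] := gPE y h Oy.
  by rewrite mulrAC mulr_ge0 ?invr_ge0 ?(ltW J0) // -expr2 sqr_ge0.
apply: ae2S (ae2I H3 H4) => y [h h4] Oy; have [s [J [J0 gE Py]]] := gPE y h Oy.
have := h4 Oy; rewrite gE Py mulrAC => /eqP.
by rewrite !mulf_eq0 invr_eq0 (gt_eqF J0) orbF orbb => /eqP ->; rewrite mul0r.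
Qed.
End Assembly.

Theorem lemma5p2 (R : realType) (k : nat) (Om : set (R * R))
  (C c1 c2 sigma : R) (I : finType) (vtx : I -> 'I_3 -> R * R)
  (G : R * R -> R * R) (Gh : I -> R * R -> R * R)
  (k_gt0 : (0 < k)%N) (Om_smooth : smooth_domain k Om)
  (mesh : isoparametric_mesh vtx Gh Om C c1 c2 sigma G)
  (uh : R * R -> R * R) (uh_in : Vh vtx Gh uh)
  (div_uh : R * R -> R) (div_uhP : Hdiv_with (Omh vtx Gh) uh div_uh)
  (div_orth : forall q, Qh vtx Gh q ->
     \int[@mu2 R]_(x in Omh vtx Gh) (div_uh x * q x) = 0) :
  {ae @mu2 R, forall x, Omh vtx Gh x -> div_uh x = 0}.
Proof.
have [_ c1_gt0 _ _] := im_const mesh.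
have [v vV uP] := uh_in.
have Ftil_inj i x y : @That R x -> @That R y -> Ftil vtx i x = Ftil vtx i y -> x = y.
  by move=> Tx Ty e; have [F' FK _] := im_Ftil_inv mesh i; rewrite -(FK x Tx) e FK.
have [qp FE] := quadratic_Fiso (im_interpolant mesh).
have invF i : exists F', forall x, @That R x -> F' (Fiso vtx Gh i x) = x.
  by have [F' FK _] := im_Fiso_inv mesh i; exists F'.
have [F' F'K] := choice invF.
have F_rv i a : Fiso vtx Gh i (rv R a) = vtx i a.
  (* Vertices are the interpolation nodes with two equal indices, and [G] fixes them. *)
  rewrite /Fiso /= Ftil_rv; have [_ /(_ a a) /=] := im_interpolant mesh i.
  have -> : 2^-1 *: (vtx i a + vtx i a) = vtx i a.
    by case: (vtx i a) => u1 u2; congr pair; rewrite /= /GRing.scale /=; field.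
  by move=> ->; exact: im_G_vertex mesh i a.
have F_edge i a b (t : R) : a != b -> shared vtx i a b -> 0 <= t <= 1 ->
    Fiso vtx Gh i ((1 - t) *: rv R a + t *: rv R b) = (1 - t) *: vtx i a + t *: vtx i b.
  move=> ab [j [a' [b' [ij _ ea eb]]]] t01.
  (* An edge common to two triangles is mapped onto itself by [Gh i], hence is straight, and the
     isoparametric map is then affine along it. *)
  have st : straight_edge vtx Gh i a b.
    exists (vtx i a), (vtx i b); rewrite -(im_interior_edge mesh ij ab ea eb) /Fiso -image_comp.
    congr (_ @` _); apply/seteqP; split.
      by move=> _ [_ [s [s01 ->]] <-]; exists s; rewrite Ftil_edge.
    move=> _ [s [s01 ->]]; exists ((1 - s) *: rv R a + s *: rv R b); first by exists s.
    by rewrite Ftil_edge.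
  by rewrite (im_straight_affine mesh ab st t01) !F_rv.
apply: (@divergence_free R I vtx Gh (fun i => (qp i).1) (fun i => (qp i).2) F'
  (fun i => c1 * hT vtx i ^+ 2) _ _ _ _ _ _ _ _ _ v uh div_uh) => //.
- by move=> i x Tx; rewrite -FE F'K.
- by move=> i; rewrite mulr_gt0 // exprn_gt0 // hT_gt0 //; exact: Ftil_inj.
- move=> i x Tx; rewrite -det_Jac_qmap -FE.
  by have /andP[] := im_det mesh i Tx.
- by move=> i a; rewrite -FE.
- move=> i j ij; by rewrite -!FE; exact: (im_disjoint mesh ij).
- by move=> i a b t ab sh t01; rewrite -FE F_edge.
- exact: im_conforming mesh.
Qed.
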